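(* Let $X=\overline{\mathcal{R}[T_\infty]}$ be the Ghys–Kenyon minimal set. The equivalence relation $\mathcal{R}$ on $X$ is affable, and the (topological) transverse dynamics of the Ghys–Kenyon lamination $(\boldsymbol{M},\boldsymbol{\mathcal{L}})$ is represented by a minimal dynamical system on the Cantor set: that is, $\mathcal{R}$ is stably orbit equivalent to the orbit equivalence relation of a minimal homeomorphism of the Cantor set.
   Context: Ambient space. $\mathcal{Z}^2$ is the Cayley graph of $\mathbb{Z}^2$ for the generators $(\pm1,0),(0,\pm1)$ (vertices $\mathbb{Z}^2$, edges of length 1). $\mathcal{T}$ is the set of infinite connected subgraphs of $\mathcal{Z}^2$ containing $0$. For $T\in\mathcal{T}$, $B_T(0,N)$ is the open ball of centre $0$ and radius $N$ for the path metric of $T$. For $T,T'\in\mathcal{T}$ let $R(T,T')=\sup\{N\geq1: B_T(0,N)=B_{T'}(0,N)\}$ ($0$ if this set is empty) and $d(T,T')=e^{-R(T,T')}$; $(\mathcal{T},d)$ is compact. $\mathcal{R}$ identifies $T$ and $T'$ iff $T'=T-v$ for some vertex $v$ of $T$; $\mathcal{R}[T]$ is the class of $T$. Kenyon tree. $T_1$ is the tree made of the segments $[-1,1]\times\{0\}$ and $\{0\}\times[-2,2]$. Given $T_n$, take the union of the images of $T_n+(0,2^n)$ under the rotations about $0$ of angles $0,\pi/2,\pi,3\pi/2$, and remove the two terminal edges (with their terminal vertices) contained in the horizontal axis; the result is $T_{n+1}$. The $T_n$ are increasing and $T_\infty=\bigcup_{n\geq1}T_n$. $X=\overline{\mathcal{R}[T_\infty]}$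 (closure in $\mathcal{T}$); $\mathcal{R}$ also denotes its restriction to $X$. Lamination. The Ghys–Kenyon lamination $(\boldsymbol{M},\boldsymbol{\mathcal{L}})$ is a compact lamination by Riemann surfaces having $X$ as a complete transversal, whose holonomy pseudogroup reduced to $X$ is generated by the partial translations $T\mapsto T-v$, defined on $\{T\in X: v\in T\}$, $v\in\mathbb{Z}^2$; thus the equivalence relation induced on $X$ is $\mathcal{R}$, and the transverse dynamics of $\boldsymbol{\mathcal{L}}$ is represented by $\mathcal{R}$ on $X$. Topological relations. A topological equivalence relation on a space $X$ is one whose graph carries a locally compact Hausdorff topology making it a topological groupoid (source and range maps, partial multiplication continuous, inversion a homeomorphism); it is $\beta$-discrete if the diagonal is open in it. A $\beta$-discrete equivalence relation is compact if the complement of the diagonal in it is compact. An equivalence relation on a totally disconnected space $X$ is affable if it is the union of an increasing sequence of compact ($\beta$-discrete) equivalence relations $\mathcal{R}_n$ on $X$; endowed with the inductive limit topology it is then a $\beta$-discrete relation $\varinjlim\mathcal{R}_n$, called approximately finite (this topology need not be the one below). $\mathcal{R}$ itself carries the $\beta$-discrete topology generated by the sets $\{(T,T-v): T\in U,\ v\in T\}$, $U\subset X$ open, $v\in\mathbb{Z}^2$. Two relations $\mathcal{R}$ on $X$ and $\mathcal{R}'$ on $X'$ are (topologically) orbit equivalent if there is a homeomorphism $X\to X'$ mapping each $\mathcal{R}$-class onto an $\mathcal{R}'$-class; they are stably orbit equivalent if there are open sets $Z\subset X$, $Z'\subset X'$ meeting all classes of $\mathcal{R}$ and $\mathcal{R}'$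 such that the induced relations $\mathcal{R}|_Z$ and $\mathcal{R}'|_{Z'}$ are orbit equivalent. A homeomorphism is minimal if all its orbits are dense. *)

(* Defs.v *)
From mathcomp Require Import all_boot all_order all_algebra.
From HB Require Import structures.
From mathcomp Require Import mathcomp_extra boolp classical_sets functions.
From mathcomp Require Import cardinality reals ereal topology normedtype exp.
From mathcomp Require Import cantor Rstruct zify.

Set Implicit Arguments.
Unset Strict Implicit.
Unset Printing Implicit Defensive.

Import Order.TTheory GRing.Theory Num.Theory.

Local Open Scope classical_set_scope.
Local Open Scope ring_scope.

Local Notation R := Rdefinitions.R.

Definition vertex := (int * int)%type.

Definition adjacent (u v : vertex) : Prop :=
  `|u.1 - v.1| + `|u.2 - v.2| = 1.

(* An edge is represented by both of its orientations. *)
Record subgraph := Subgraph {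
  vset : set vertex;
  eset : set (vertex * vertex);
  eset_adjacent : forall u v, eset (u, v) -> adjacent u v;
  eset_sym : forall u v, eset (u, v) -> eset (v, u);
  eset_vset : forall u v, eset (u, v) -> vset u }.

Lemma subgraph_eq (G G' : subgraph) :
  vset G = vset G' -> eset G = eset G' -> G = G'.
Proof.
case: G G' => V E a s w [V' E' a' s' w'] /= eV eE; subst V' E'.
by congr Subgraph; exact: Prop_irrelevance.
Qed.

Definition walk (G : subgraph) (u v : vertex) (p : seq vertex) : Prop :=
  path [rel x y | (x, y) \in eset G] u p /\ last u p = v.

Definition connected_subgraph (G : subgraph) : Prop :=
  forall u v, vset G u -> vset G v -> exists p, walk G u v p.

Definition path_dist (G : subgraph) (u v : vertex) : \bar R :=
  ereal_inf [set (size p)%:R%:E | p in walk G u v].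

(* The open ball of centre 0 and integer radius N in the geometric
   realization of G, recorded as its vertices and the open edges which meet it.
   Since Z^2 is bipartite, an edge with an endpoint at distance less than N from
   0 has its whole interior in the ball, so that no information is lost. *)
Definition open_ball (G : subgraph) (N : nat) :
    set vertex * set (vertex * vertex) :=
  let inside v := (path_dist G 0%R v < N%:R%:E)%E in
  ([set v | inside v],
   [set e | eset G e /\ (inside e.1 \/ inside e.2)]).

Lemma walk_rcons G u v p w : walk G u v p -> eset G (v, w) ->
  walk G u w (rcons p w).
Proof.
move=> [up lp] vw; split; last by rewrite last_rcons.
by rewrite rcons_path up lp /=; exact/mem_set.
Qed.

Lemma walk_cat G u v w p q : walk G u v p -> walk G v w q ->
  walk G u w (p ++ q).
Proof.
by move=> [up lp] [vq lq]; split; rewrite ?cat_path ?last_cat ?up lp.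
Qed.

Lemma walk_sym G u v p : walk G u v p -> exists q, walk G v u q.
Proof.
elim: p u => [u [_ /= ->]|x p IHp u [/= /andP[ux xp] lp]]; first by exists [::].
have [//|q vq] := IHp x.
by exists (rcons q u); apply: walk_rcons vq _; apply: eset_sym; exact/set_mem.
Qed.

Lemma path_dist_lt G u v (N : nat) : (path_dist G u v < N%:R%:E)%E <->
  exists2 p, walk G u v p & (size p < N)%N.
Proof.
split=> [/ereal_inf_lt[_ [p wp <-]]|[p wp pN]].
  by rewrite lte_fin ltr_nat => pN; exists p.
apply: (@le_lt_trans _ _ (size p)%:R%:E); last by rewrite lte_fin ltr_nat.
by apply: ereal_inf_lbound; exists p.
Qed.

Record rooted := Rooted {
  graph :> subgraph;
  rooted_inf : infinite_set (vset graph);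
  rooted_connected : connected_subgraph graph;
  rooted0 : vset graph 0 }.

Lemma graph_inj : injective graph.
Proof.
case=> G i c z [G' i' c' z'] /= eG; subst G'.
by congr Rooted; exact: Prop_irrelevance.
Qed.

HB.instance Definition _ := gen_eqMixin rooted.
HB.instance Definition _ := gen_choiceMixin rooted.

Definition agreement (T T' : rooted) : set nat :=
  [set N | (1 <= N)%N /\ open_ball T N = open_ball T' N].

(* Adding 0 sets the supremum of the empty set to 0. *)
Definition agreement_radius (T T' : rooted) : \bar R :=
  ereal_sup (0%E |` [set N%:R%:E | N in agreement T T']).

(* expeR extends exp by expeR -oo = 0. *)
Definition rooted_dist (T T' : rooted) : R :=
  fine (expeR (- agreement_radius T T')).

Lemma agreement_sym T T' : agreement T T' = agreement T' T.
Proof. by apply/seteqP; split=> N [N1 e]; split. Qed.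

Lemma ball_walk (T T' : subgraph) N u p : open_ball T N = open_ball T' N ->
  walk T 0 u p -> (size p <= N)%N -> walk T' 0 u p.
Proof.
move=> eE; elim/last_ind: p u => [u []//|p x IHp u []].
rewrite rcons_path last_rcons size_rcons => /andP[pp ex] <- pN.
have := IHp (last 0 p) (conj pp erefl) (ltnW pN).
move=> w'; apply: walk_rcons w' _.
have : (open_ball T N).2 (last 0 p, x).
  split; first exact/set_mem.
  by left; apply/path_dist_lt; exists p.
by rewrite eE => -[].
Qed.

Lemma ball_mono (T T' : subgraph) M N : (M <= N)%N ->
  open_ball T N = open_ball T' N -> open_ball T M = open_ball T' M.
Proof.
move=> MN; have half G G' : open_ball G N = open_ball G' N ->
    (open_ball G M).1 `<=` (open_ball G' M).1 /\
    (open_ball G M).2 `<=` (open_ball G' M).2.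
  move=> e; have sV v : (path_dist G 0%R v < M%:R%:E)%E ->
      (path_dist G' 0%R v < M%:R%:E)%E.
    move=> /path_dist_lt[p wp pM]; apply/path_dist_lt; exists p => //.
    by apply: ball_walk e wp _; exact: leq_trans (ltnW pM) MN.
  have up H v : (path_dist H 0%R v < M%:R%:E)%E -> (path_dist H 0%R v < N%:R%:E)%E.
    by move=> /lt_le_trans; apply; rewrite lee_fin ler_nat.
  split=> [v /sV//|d [Gd di]].
  have : (open_ball G N).2 d by split=> //; case: di => /up; [left|right].
  rewrite e => -[G'd _]; split=> //.
  by case: di => /sV; [left|right].
move=> e; have [a b] := half _ _ e; have [a' b'] := half _ _ (esym e).
by apply: injective_projections; apply/seteqP.
Qed.

Lemma agreement_radius_ge0 T T' : (0 <= agreement_radius T T')%E.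
Proof. by apply: ereal_sup_ubound; left. Qed.

Lemma rooted_distE T T' :
  (rooted_dist T T')%:E = expeR (- agreement_radius T T').
Proof.
rewrite /rooted_dist fineK//.
by case: (agreement_radius T T') (agreement_radius_ge0 T T').
Qed.

Lemma rooted_distxx T : rooted_dist T T = 0.
Proof.
rewrite /rooted_dist (_ : agreement_radius T T = +oo%E)//.
apply/eqyP => r r0.
have [N rN] : exists N : nat, r < N.+1%:R.
  by exists (Num.truncn r); exact: truncnS_gt.
apply: (@le_trans _ _ (N.+1%:R)%:E); first by rewrite lee_fin ltW.
by apply: ereal_sup_ubound; right; exists N.+1.
Qed.

Lemma rooted_dist0 T T' : rooted_dist T T' = 0 -> T = T'.
Proof.
move=> d0; have half S S' : rooted_dist S S' = 0 ->
    vset S `<=` vset S' /\ eset S `<=` eset S'.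
  move=> e; have /eqP : expeR (- agreement_radius S S') = 0%E.
    by rewrite -rooted_distE e.
  rewrite expeR_eq0 eqe_oppLR /= => /eqP Ry.
  have V v : vset S v -> exists N, (agreement S S') N /\ (open_ball S N).1 v.
    move=> Sv; have [p wp] := rooted_connected (rooted0 S) Sv.
    have : (((size p)%:R : R)%:E < agreement_radius S S')%E by rewrite Ry ltry.
    move=> /ereal_sup_gt[_ [->|[N SN <-]]]; rewrite lte_fin.
      by rewrite ltNge ler0n.
    rewrite ltr_nat.
    move=> pN; exists N; split=> //=; apply/path_dist_lt.
    by exists p.
  split=> [v|[u v]].
    move=> /V[N [[_ ->]]] /path_dist_lt[p [pp <-] _].
    case/lastP: p pp => [_|p x]; first exact: rooted0.
    rewrite rcons_path last_rcons => /andP[_ /set_mem].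
    by move=> /eset_sym/eset_vset.
  move=> uv; have [N [[_ e'] bu]] := V _ (eset_vset uv).
  have : (open_ball S N).2 (u, v) by split=> //; left.
  by rewrite e' => -[].
have d0' : rooted_dist T' T = 0.
  by rewrite /rooted_dist /agreement_radius agreement_sym.
have [a b] := half _ _ d0; have [a' b'] := half _ _ d0'.
by apply/graph_inj/subgraph_eq; apply/seteqP.
Qed.

Lemma rooted_dist_sym T T' : rooted_dist T T' = rooted_dist T' T.
Proof. by rewrite /rooted_dist /agreement_radius agreement_sym. Qed.

Lemma rooted_dist_ge0 T T' : 0 <= rooted_dist T T'.
Proof. by rewrite -lee_fin rooted_distE expeR_ge0. Qed.

Lemma rooted_dist_triangle T2 T1 T3 :
  rooted_dist T1 T3 <= rooted_dist T1 T2 + rooted_dist T2 T3.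
Proof.
have le S1 S2 S3 S4 : agreement S3 S4 `<=` agreement S1 S2 ->
    rooted_dist S1 S2 <= rooted_dist S3 S4.
  move=> s; rewrite -lee_fin !rooted_distE lee_expeR leeN2.
  by apply: ereal_sup_le; apply: setUS; exact: image_subset.
have [s|/existsNP[N /not_implyP[[N1 e12] n23]]] :=
  pselect (agreement T1 T2 `<=` agreement T2 T3).
  apply: le_trans (le _ _ T1 T2 _) _; last by rewrite lerDl rooted_dist_ge0.
  by move=> M h; have [_ e] := s _ h; case: h => M1 e'; split=> //; rewrite e'.
apply: le_trans (le _ _ T2 T3 _) _; last by rewrite lerDr rooted_dist_ge0.
move=> M [M1 e23]; split=> //; rewrite -e23; apply: ball_mono e12.
rewrite leqNgt; apply/negP => NM; apply: n23; split=> //.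
by apply: ball_mono e23; exact: ltnW.
Qed.

HB.instance Definition _ := @isMetric.Build R rooted rooted_dist
  rooted_distxx rooted_dist0 rooted_dist_sym rooted_dist_triangle.

Section image_subgraph.
Variables (f : vertex -> vertex).
Hypothesis f_adj : forall u v, adjacent u v -> adjacent (f u) (f v).
Variable G : subgraph.

Let V := f @` vset G.
Let E := [set (f e.1, f e.2) | e in eset G].

Let E_adj u v : E (u, v) -> adjacent u v.
Proof. by move=> [[x y] xy [<- <-]]; exact: f_adj (eset_adjacent xy). Qed.

Let E_sym u v : E (u, v) -> E (v, u).
Proof. by move=> [[x y] xy [<- <-]]; exists (y, x) => //; exact: eset_sym. Qed.

Let E_V u v : E (u, v) -> V u.
Proof. by move=> [[x y] xy [<- _]]; exists x => //; exact: eset_vset xy. Qed.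

Definition image_subgraph := Subgraph E_adj E_sym E_V.
End image_subgraph.

Lemma translation_adjacent (t u v : vertex) :
  adjacent u v -> adjacent (u + t) (v + t).
Proof.
have e (x y z : int) : x + z - (y + z) = x - y.
  by rewrite opprD addrACA subrr addr0.
by rewrite /adjacent /= !e.
Qed.

Definition translate (t : vertex) : subgraph -> subgraph :=
  image_subgraph (@translation_adjacent t).

Definition rot90 (u : vertex) : vertex := (- u.2, u.1).

Lemma rot90_adjacent k u v :
  adjacent u v -> adjacent (iter k rot90 u) (iter k rot90 v).
Proof.
move=> uv; elim: k => [//|k]; rewrite !iterS /adjacent /=.
by rewrite -opprD normrN addrC.
Qed.

Definition rotate (k : nat) : subgraph -> subgraph :=
  image_subgraph (@rot90_adjacent k).

Section union_subgraph.
Variables (I : Type) (G : I -> subgraph).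

Let V := \bigcup_i vset (G i).
Let E := \bigcup_i eset (G i).

Let E_adj u v : E (u, v) -> adjacent u v.
Proof. by move=> [i _]; exact: eset_adjacent. Qed.

Let E_sym u v : E (u, v) -> E (v, u).
Proof. by move=> [i _ uv]; exists i => //; exact: eset_sym. Qed.

Let E_V u v : E (u, v) -> V u.
Proof. by move=> [i _ uv]; exists i => //; exact: eset_vset uv. Qed.

Definition union_subgraph := Subgraph E_adj E_sym E_V.
End union_subgraph.

Section induced_subgraph.
Variable A : set vertex.

Let E := [set e : vertex * vertex | [/\ adjacent e.1 e.2, A e.1 & A e.2]].

Let E_adj u v : E (u, v) -> adjacent u v. Proof. by case. Qed.

Let E_sym u v : E (u, v) -> E (v, u).
Proof.
by move=> [uv Au Av]; split=> //; rewrite /adjacent /= !(distrC v.1, distrC v.2).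
Qed.

Let E_V u v : E (u, v) -> A u. Proof. by case. Qed.

Definition induced_subgraph := Subgraph E_adj E_sym E_V.
End induced_subgraph.

Section prune_axis.
Variable G : subgraph.

Definition terminal (v : vertex) : Prop :=
  vset G v /\ exists! w, eset G (v, w).

Definition axis_terminal (v : vertex) : Prop :=
  terminal v /\ exists w, [/\ eset G (v, w), v.2 = 0 & w.2 = 0].

Let V := vset G `\` axis_terminal.
Let E := [set e | [/\ eset G e, ~ axis_terminal e.1 & ~ axis_terminal e.2]].

Let E_adj u v : E (u, v) -> adjacent u v.
Proof. by case=> /eset_adjacent. Qed.

Let E_sym u v : E (u, v) -> E (v, u).
Proof. by case=> /eset_sym. Qed.

Let E_V u v : E (u, v) -> V u.
Proof. by case=> /eset_vset. Qed.

(* Removes the terminal edges contained in the horizontal axis together with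
   their terminal vertices. *)
Definition prune_axis := Subgraph E_adj E_sym E_V.
End prune_axis.

Definition kenyon_seed : subgraph :=
  union_subgraph (fun b : bool => induced_subgraph
    (if b then [set v : vertex | `|v.1| <= 1 /\ v.2 = 0]
          else [set v : vertex | v.1 = 0 /\ `|v.2| <= 2])).

Definition kenyon_step (n : nat) (G : subgraph) : subgraph :=
  prune_axis (union_subgraph (fun k : 'I_4 =>
    rotate k (translate (0, (2 ^ n)%:Z) G))).

(* kenyon n is T_(n+1). *)
Fixpoint kenyon (n : nat) : subgraph :=
  if n is m.+1 then kenyon_step m.+1 (kenyon m) else kenyon_seed.

Lemma connected_prune G : connected_subgraph G ->
  connected_subgraph (prune_axis G).
Proof.
move=> cG u v [Gu nu] [Gv nv]; have [p [up]] := cG _ _ Gu Gv.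
case: (shortenP up) => q uq qU _ lq {p up}.
exists q; split=> //; rewrite -lq in nv => {v Gv lq Gu cG}.
elim: q u uq qU nu nv => [//|x q IHq] u /= /andP[/set_mem ux xq] /andP[ui xU].
move=> nu nl; have nx : ~ axis_terminal G x.
  case: q {IHq} xq xU nl ui => [//|y q] /= /andP[/set_mem xy _] _ _ ui.
  move=> [[_ [w [_ wU]]] _]; move: ui; rewrite !inE.
  by rewrite -(wU _ (eset_sym ux)) (wU _ xy) eqxx !orbT.
by rewrite IHq// andbT; apply/mem_set; split.
Qed.

Lemma connected_image f f_adj G : connected_subgraph G ->
  connected_subgraph (@image_subgraph f f_adj G).
Proof.
move=> cG _ _ [u Gu <-] [v Gv <-]; have [p [up lp]] := cG _ _ Gu Gv.
exists (map f p); split; last by rewrite last_map lp.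
rewrite path_map; apply: sub_path up => x y /= /set_mem xy.
by apply/mem_set; exists (x, y).
Qed.

Lemma connected_union I (G : I -> subgraph) w :
  (forall i, connected_subgraph (G i)) -> (forall i, vset (G i) w) ->
  connected_subgraph (union_subgraph G).
Proof.
move=> cG Gw; have sub i u v p : walk (G i) u v p ->
    walk (union_subgraph G) u v p.
  move=> [up lp]; split=> //; apply: sub_path up => x y /= /set_mem xy.
  by apply/mem_set; exists i.
move=> u v [i _ Gu] [j _ Gv].
have [p /sub wp] := cG _ _ _ Gu (Gw i).
have [q /sub wq] := cG _ _ _ (Gw j) Gv.
by exists (p ++ q); exact: walk_cat wp wq.
Qed.

Lemma kenyon_spec n : let h := (2 ^ n.+1)%:Z in
  [/\ connected_subgraph (kenyon n), vset (kenyon n) 0,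
      eset (kenyon n) ((0, h), (0, h - 1)) &
      eset (kenyon n) ((0, - h), (0, - h + 1))].
Proof.
elim: n => [|n IHn] /=.
  have V0 b : vset (induced_subgraph
    (if b then [set v : vertex | `|v.1| <= 1 /\ v.2 = 0]
          else [set v : vertex | v.1 = 0 /\ `|v.2| <= 2])) 0.
    by case: b; split.
  split.
  - apply: (connected_union _ V0) => b u v.
    set G := induced_subgraph _ => Gu Gv.
    suff c w : vset G w -> exists p, walk G 0 w p.
      have [p /walk_sym[p' wp]] := c _ Gu; have [q wq] := c _ Gv.
      by exists (p' ++ q); exact: walk_cat wp wq.
    have st p x y : walk G 0 x p -> vset G x -> vset G y -> adjacent x y ->
        walk G 0 y (rcons p y).
      by move=> wp Gx Gy xy; apply: walk_rcons wp _; split.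
    have w0 : walk G 0 0 [::] by [].
    have G0 : vset G 0 by exact: V0.
    case: w => a c; case: b @G Gu Gv st w0 G0 => G _ _ st w0 G0 [/= ha hc].
      have [->|e] := eqVneq a 0; first by exists [::]; rewrite hc.
      exists [:: (a, c)]; apply: (st [::] 0) => //.
      by rewrite /adjacent /=; lia.
    have [c0|c0] := eqVneq c 0; first by exists [::]; rewrite ha c0.
    have [c1|c1] := eqVneq `|c| 1.
      exists [:: (a, c)]; apply: (st [::] 0) => //.
      by rewrite /adjacent /=; lia.
    have w1 : walk G 0 (0, Num.sg c) [:: (0, Num.sg c)].
      apply: (st [::] 0) => //; first by split=> //=; lia.
      by rewrite /adjacent /=; lia.
    exists [:: (0, Num.sg c); (a, c)]; apply: (st _ _ _ w1) => //.
      by split=> //=; lia.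
    by rewrite /adjacent /=; lia.
  - by exists true => //; exact: (V0 true).
  - by exists false => //; split; rewrite /adjacent /=.
  - by exists false => //; split; rewrite /adjacent /=.
case: IHn => cK K0 top bot; set G := kenyon n.
set h := (2 ^ n.+1)%:Z in top bot *.
have h2 : 2 <= h by rewrite /h expnS; have := expn_gt0 2 n; lia.
rewrite (_ : (2 ^ n.+2)%:Z = h + h); last by rewrite /h (expnS 2 n.+1); lia.
set U := union_subgraph _.
have V0 (k : 'I_4) : vset (rotate k (translate (0, h) G)) 0.
  exists 0; last by elim: (val k) => [//|j]; rewrite iterS => ->.
  exists (0, - h); first exact: eset_vset bot.
  by congr pair; rewrite /= ?addr0 ?addNr.
have cU : connected_subgraph U.
  by apply: (connected_union (w := 0)) => // k; do 2!apply: connected_image.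
have E (k : 'I_4) x y x' y' : eset G ((x, y), (x', y')) ->
    eset U (iter k rot90 (x, y + h), iter k rot90 (x', y' + h)).
  move=> e; exists k => //; exists ((x, y + h), (x', y' + h)) => //.
  exists ((x, y), (x', y')) => //=.
  by congr (pair (pair _ _) (pair _ _)); rewrite /= addr0.
have E0 := E ord0 _ _ _ _ bot; have E1 := E (inord 1) _ _ _ _ bot.
have E0t := E ord0 _ _ _ _ top; have E2t := E (inord 2) _ _ _ _ top.
rewrite !inordK//= in E0 E1 E0t E2t.
rewrite /rot90 /= ?addNr ?oppr0 in E0 E1 E0t E2t.
have off x y : y != 0 -> ~ axis_terminal U (x, y).
  by move=> /eqP y0 [_ [w [_ /= /y0]]].
split.
- exact: connected_prune.
- split; first by exists ord0 => //; exact: V0.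
  by move=> [[_ [w [_ wU]]] _]; have := wU _ E0; rewrite (wU _ E1) => -[]; lia.
- split; [|by apply: off; lia|by apply: off; lia].
  by rewrite (_ : h + h - 1 = h - 1 + h)//; lia.
- split; [|by apply: off; lia|by apply: off; lia].
  rewrite (_ : - (h + h) + 1 = - (h - 1 + h)); last by lia.
  exact: E2t.
Qed.

Definition kenyon_union : subgraph := union_subgraph kenyon.

Lemma kenyon_union_inf : infinite_set (vset kenyon_union).
Proof.
apply: (@sub_infinite_set _ (range (fun n => (0, (2 ^ n.+1)%:Z) : vertex))).
  move=> _ [n _ <-]; exists n => //.
  by have [_ _ /eset_vset] := kenyon_spec n.
rewrite (eq_finite_set (inj_card_eq _)); first exact: infinite_nat.
by move=> m n _ _ [/eqP]; rewrite eqn_exp2l// eqSS => /eqP.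
Qed.

Lemma kenyon_union0 : vset kenyon_union 0.
Proof. by exists 0%N => //; have [_] := kenyon_spec 0. Qed.

Lemma kenyon_union_connected : connected_subgraph kenyon_union.
Proof.
by apply: (connected_union (w := 0)) => n; have [] := kenyon_spec n.
Qed.

Definition kenyon_tree : rooted :=
  Rooted kenyon_union_inf kenyon_union_connected kenyon_union0.

Definition rel_class (X : Type) (Rel : set (X * X)) (x : X) : set X :=
  [set y | Rel (x, y)].

Definition restrict_rel (X : Type) (Rel : set (X * X)) (Z : set X) :
    set (Z * Z) :=
  [set zz | Rel (val zz.1, val zz.2)].
Arguments restrict_rel {X} Rel Z _.

Definition is_equivalence (X : Type) (Rel : set (X * X)) : Prop :=
  [/\ forall x, Rel (x, x),
      forall x y, Rel (x, y) -> Rel (y, x) &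
      forall x y z, Rel (x, y) -> Rel (y, z) -> Rel (x, z)].

Definition homeomorphism (X Y : topologicalType) (f : X -> Y) : Prop :=
  continuous f /\
  exists g : Y -> X, [/\ continuous g, cancel f g & cancel g f].

Definition orbit_equivalent (X X' : topologicalType)
    (Rel : set (X * X)) (Rel' : set (X' * X')) : Prop :=
  exists2 f : X -> X', homeomorphism f &
    forall x, f @` rel_class Rel x = rel_class Rel' (f x).

Definition meets_all_classes (X : Type) (Rel : set (X * X)) (Z : set X) : Prop :=
  forall x, rel_class Rel x `&` Z !=set0.

Definition stably_orbit_equivalent (X X' : topologicalType)
    (Rel : set (X * X)) (Rel' : set (X' * X')) : Prop :=
  exists (Z : set X) (Z' : set X'),
    [/\ open Z, open Z', meets_all_classes Rel Z, meets_all_classes Rel' Z' &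
        orbit_equivalent (restrict_rel Rel Z) (restrict_rel Rel' Z')].

(* For a bijection h this is the orbit relation of the action of Z. *)
Definition orbit_relation (X : Type) (h : X -> X) : set (X * X) :=
  [set xy | exists n, iter n h xy.1 = xy.2 \/ iter n h xy.2 = xy.1].

Definition minimal_homeomorphism (X : topologicalType) (h : X -> X) : Prop :=
  homeomorphism h /\ forall x, dense (rel_class (orbit_relation h) x).

(* A topology on the graph of a relation Rel is given by a topological space G
   and a bijection p from G onto Rel.  The groupoid operations are those of the
   graph, transported along p.  Continuity of the unit map x |-> (x, x) says that
   the unit space of the groupoid is X with its own topology. *)
Section topological_relations.
Variables (X G : topologicalType) (p : G -> X * X).

Definition composable : set (G * G) :=
  [set gg | (p gg.1).2 = (p gg.2).1].

Record topological_relation (Rel : set (X * X)) : Prop := {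
  trel_equivalence : is_equivalence Rel;
  trel_inj : injective p;
  trel_graph : range p = Rel;
  trel_locally_compact : locally_compact [set: G];
  trel_hausdorff : hausdorff_space G;
  trel_source : continuous (fun g => (p g).1);
  trel_range : continuous (fun g => (p g).2);
  trel_unit : exists2 e : X -> G,
    (forall x, p (e x) = (x, x)) & continuous e;
  trel_inv : exists2 i : G -> G,
    (forall g, p (i g) = ((p g).2, (p g).1)) & homeomorphism i;
  trel_mul : exists2 m : composable -> G,
    (forall gg, p (m gg) = ((p (val gg).1).1, (p (val gg).2).2)) &
    continuous m }.

Definition diagonal : set G := [set g | (p g).1 = (p g).2].

Definition beta_discrete (Rel : set (X * X)) : Prop :=
  topological_relation Rel /\ open diagonal.

Definition compact_relation (Rel : set (X * X)) : Prop :=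
  beta_discrete Rel /\ compact (~` diagonal).

End topological_relations.

(* The topology of (G, p) is the inductive limit of those of the (Gn n, pn n). *)
Definition inductive_limit_topology (X : Type) (Gn : nat -> topologicalType)
    (pn : forall n, Gn n -> X * X) (G : topologicalType) (p : G -> X * X) :
    Prop :=
  forall U : set G, open U <-> forall n, open (pn n @^-1` (p @` U)).

(* For arbitrary increasing sequences of compact relations, the inductive limit
   topology may fail to be locally compact; that it makes the union a
   beta-discrete relation is part of the definition. *)
Definition affable (X : topologicalType) (Rel : set (X * X)) : Prop :=
  totally_disconnected [set: X] /\
  exists (Rn : nat -> set (X * X)) (Gn : nat -> topologicalType)
      (pn : forall n, Gn n -> X * X),
    [/\ forall n, compact_relation (pn n) (Rn n),
        forall n, Rn n `<=` Rn n.+1,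
        Rel = \bigcup_n Rn n &
        exists (G : topologicalType) (p : G -> X * X),
          beta_discrete p Rel /\ inductive_limit_topology pn p].

Definition translation_rel : set (rooted * rooted) :=
  [set TT : rooted * rooted | exists2 v, vset TT.1 v &
     graph TT.2 = translate (- v) TT.1].

Definition ghys_kenyon_set : set rooted :=
  closure (rel_class translation_rel kenyon_tree).

Definition ghys_kenyon_rel : set (ghys_kenyon_set * ghys_kenyon_set) :=
  restrict_rel translation_rel ghys_kenyon_set.

(* Main.v *)
(* The tree T_oo is the subgraph induced by 0 and the vertices 2^k g, with g.1 + g.2 odd.
   A vertex u with odd coordinate sum is uniquely 2u' + a, where a is a unit vector (its
   lead) and u' is again odd; iterating u |-> u' yields the address of u, that is, the
   leads together with a bit (the status) telling whether u + a is a vertex.  Addresses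
   are characterized by a local rule, and the initial segments of the address of u and the
   balls around u determine each other.  Hence X is, up to the parity of the root, the
   compact space of sequences obeying the rule, and two elements of X are equivalent iff
   their sequences are eventually equal, or both eventually constant of status true (the
   class of T_oo).
   Replacing "eventually" by "from n on" gives the compact relations which exhaust R.

   On a clopen transversal where the first letters are normalized, the sequences are the
   infinite paths of a stationary Bratteli diagram.  The eventually constant sequences of
   status true form two cofinality classes, and the incoming edges can be ordered so that
   these are the classes of the unique minimal path and of the unique maximal path.  As
   the Vershik map sends the latter to the former, its orbits are the classes of R. *)

From HB Require Import structures.
From mathcomp Require Import all_boot all_order all_algebra.
From mathcomp Require Import mathcomp_extra boolp classical_sets functions.
From mathcomp Require Import cardinality reals ereal topology normedtype exp.
From mathcomp Require Import cantor Rstruct zify.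
From mathcomp Require sequences.
Require Import Defs.

Set Implicit Arguments.
Unset Strict Implicit.
Unset Printing Implicit Defensive.

Import Order.TTheory GRing.Theory Num.Theory.

Local Open Scope classical_set_scope.
Local Open Scope ring_scope.

(** * The vertices of the Kenyon tree *)

(** The status carries information from infinity: where two consecutive leads are equal, the rule
    only says that the two statuses are equal. Along a constant sequence of leads both values remain
    possible, so the leads alone do not code X.

    The class of T_oo is the obstacle to a Vershik map. The four neighbours of 0 are fixed by u |->
    u', and their addresses are the four constant sequences of status true; all four tails belong to
    one class of R, whereas a Vershik map with one minimal and one maximal path joins only two
    cofinality classes. The diagram is therefore not the graph of the address rule. Its paths forget
    the axis of the leads while the address runs straight, keeping only the sign, and this turns the
    four constant tails into two. The axis can be read again from the tail as soon as the path stops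
    running straight, so that no other classes are merged.

    Trees enter only through the words of directions that can be walked from the root. Words are
    insensitive to translation, they determine balls, and they behave simply under u |-> 2u. *)

Definition odd_vertex (v : vertex) : bool := odd `|v.1 + v.2|.

Definition twice (v : vertex) : vertex := (v.1 * 2, v.2 * 2).

Inductive present : vertex -> Prop :=
| present0 : present 0
| present_odd v : odd_vertex v -> present v
| present_twice v : present v -> present (twice v).

Lemma vertexP (u v : vertex) : u = v <-> u.1 = v.1 /\ u.2 = v.2.
Proof. by split=> [->//|]; case: u v => [x y] [x' y'] /= [-> ->]. Qed.

Lemma twice_inj : injective twice.
Proof. by move=> [x y] [x' y'] /vertexP[/= h h']; congr pair; lia. Qed.

Lemma present_twiceE v : present (twice v) <-> present v.
Proof.
split=> [|pv]; last exact: present_twice.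
move: {1 3}(twice v) (erefl (twice v)) => w wE pw; case: pw wE => [|u|u pu].
- case: v => x y /vertexP[/= h h'].
  by rewrite (_ : (x, y) = 0); [exact: present0|apply/vertexP => /=; lia].
- by move=> o e; move: o; rewrite e /odd_vertex /=; lia.
- by move=> /twice_inj <-.
Qed.

Lemma present_odd_odd x y : odd `|x| -> odd `|y| -> ~ present (x, y).
Proof.
move=> ox oy; have [w wE] : exists w, w = (x, y) by exists (x, y).
rewrite -wE => pw; case: pw wE => [|v o|v _] /vertexP[/= h h']; [lia| |lia].
by move: o; rewrite /odd_vertex h h'; lia.
Qed.

Lemma present_axis x y : x = 0 \/ y = 0 -> present (x, y).
Proof.
move: {2}(absz x + absz y)%N (leqnn (absz x + absz y)) => n.
elim: n x y => [|n IHn] x y xn h.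
  by rewrite (_ : (x, y) = 0); [exact: present0|apply/vertexP => /=; lia].
have [o|o] := boolP (odd_vertex (x, y)); first exact: present_odd.
have [xy0|xy0] := eqVneq (absz x + absz y)%N 0%N; first by apply: IHn h; lia.
rewrite /odd_vertex /= in o.
rewrite (_ : (x, y) = twice ((x %/ 2)%Z, (y %/ 2)%Z)); last first.
  by apply/vertexP => /=; lia.
by apply/present_twice/IHn; lia.
Qed.

Lemma present_rot90 k v : present (iter k rot90 v) <-> present v.
Proof.
have H u : present u -> present (rot90 u).
  elim=> [|{}u o|{}u pu IHu].
  - by rewrite (_ : rot90 0 = 0) //; exact: present0.
  - by apply: present_odd; move: u o => [x y]; rewrite /odd_vertex /=; lia.
  - rewrite (_ : rot90 _ = twice (rot90 u)); first exact: present_twice.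
    by case: u {pu IHu} => x y; rewrite /rot90 /twice /= mulNr.
elim: k => //= k <-; split=> [/H/H/H|]; last exact: H.
by rewrite /rot90 /= !opprK; case: (iter k _ v).
Qed.

(** Whether a vertex outside the lattice 2^m Z^2 is present is decided at a scale 2^k with k < m,
    hence is periodic of period 2^m. Only lattice points will need separate care. *)
Lemma present_shift m v t : present v ->
  (forall a b, v <> (a * (2 ^ m)%:Z, b * (2 ^ m)%:Z)) ->
  present (v + (t.1 * (2 ^ m)%:Z, t.2 * (2 ^ m)%:Z)).
Proof.
elim: m v => [|m IHm] v pv nv.
  by case: (nv v.1 v.2); rewrite expn0 !mulr1 -surjective_pairing.
have e : (2 ^ m.+1)%:Z = (2 ^ m)%:Z * 2 by rewrite expnSr PoszM.
case: pv nv => [|u o|u pu] nv.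
- by have := nv 0 0; rewrite !mul0r.
- apply: present_odd; move: u o {nv} => [x y].
  rewrite /odd_vertex /= e !mulrA.
  by set A := t.1 * _; set B := t.2 * _; lia.
- rewrite (_ : _ + _ = twice (u + (t.1 * (2 ^ m)%:Z, t.2 * (2 ^ m)%:Z))).
    apply/present_twice/IHm => // a b uE; apply: (nv a b).
    by rewrite uE /twice /= e !mulrA.
  by case: u {pu nv} => x y; rewrite /twice e /=; congr pair => /=; rewrite mulrDl mulrA.
Qed.

Definition diamond (h : int) : set vertex :=
  [set v | present v /\ `|v.1| + `|v.2| <= h].

(** For h = 2^n these are the vertices of T_n (see [kenyonE]); the two missing points are the
    corners that pruning cuts off. *)
Definition kenyon_tile (h : int) : set vertex :=
  [set v | diamond h v /\ ~ (v.2 = 0 /\ `|v.1| = h)].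

Lemma kenyon_seedE : kenyon_seed = induced_subgraph (kenyon_tile 2).
Proof.
have T2 (x y : int) : kenyon_tile 2 (x, y) <->
    (y = 0 /\ `|x| <= 1) \/ (x = 0 /\ `|y| <= 2).
  split=> [[[/= pv h] n]|].
    have [o|o] := boolP (odd `|x| && odd `|y|).
      by case/andP: o => ox oy; case: (present_odd_odd ox oy pv).
    by lia.
  by case=> -[h h']; (split; [split=> /=; [apply: present_axis|]|move=> /=]); lia.
have S b (x y : int) : (if b then [set v : vertex | `|v.1| <= 1 /\ v.2 = 0]
          else [set v : vertex | v.1 = 0 /\ `|v.2| <= 2]) (x, y) <->
    (if b then (y = 0 /\ `|x| <= 1) else (x = 0 /\ `|y| <= 2)).
  by case: b => /=; tauto.
apply: subgraph_eq; apply/seteqP; split.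
- by move=> [x y] [b _ h0]; have h := (S b x y).1 h0; apply/T2; case: b h {h0}; tauto.
- by move=> [x y] /T2[h|h]; [exists true|exists false] => //; exact: (S true x y).2.
- move=> [[x y] [x' y']] [b _ [uv h0 h0']].
  have h := (S b x y).1 h0; have h' := (S b x' y').1 h0'.
  by split=> //; apply/T2; case: b h h' {h0 h0'}; tauto.
- move=> [[x y] [x' y']] [] /= uv /T2 h /T2 h'.
  have uv' := uv; rewrite /adjacent /= in uv'.
  suff [b hb] : exists b : bool, (if b then (y = 0 /\ `|x| <= 1) else (x = 0 /\ `|y| <= 2))
     /\ (if b then (y' = 0 /\ `|x'| <= 1) else (x' = 0 /\ `|y'| <= 2)).
    by exists b => //; split=> //; case: hb => hb hb'; [exact: (S b x y).2|exact: (S b x' y').2].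
  have [y0|y0] := eqVneq y 0; have [y0'|y0'] := eqVneq y' 0; [exists true|exists false..]; lia.
Qed.

Section kenyon_step.
Variables (m : nat) (hm : (0 < m)%N).
Let h := (2 ^ m)%:Z.

Let h2 : exists k : int, h = 2 * k /\ 0 < k.
Proof.
exists (2 ^ m.-1)%:Z; rewrite /h -{1}(prednK hm) expnS PoszM; split=> //.
by have := expn_gt0 2 m.-1; lia.
Qed.

Let G := induced_subgraph (kenyon_tile h).
Let U := union_subgraph (fun k : 'I_4 => rotate k (translate (0, h) G)).

Let in_shift v : kenyon_tile h v ->
  diamond (h + h) (v + (0, h)) /\ `|v.1| + `|v.2| <= h.
Proof.
have [k [hk k0]] := h2.
move=> [[pv vh] nv]; split=> //; split; last by move: vh; case: v {pv nv} => x y /=; lia.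
have [[[a b] vE]|nE] := pselect (exists ab : int * int, v = (ab.1 * h, ab.2 * h)); last first.
  have := @present_shift m v (0, 1) pv; rewrite /= mul0r mul1r; apply=> a b vE.
  by apply: nE; exists (a, b).
move: pv vh nv; rewrite vE {v vE} /= => pv vh nv.
(* The lattice points of the diamond are its centre and its four corners. A horizontal corner would
   be shifted to (h, h) or (-h, h), which is absent, but the tile omits these corners; the other
   three points land on the vertical axis. *)
have ab1 : `|a| + `|b| <= 1.
  rewrite !normrM in vh; have : `|h| = h by lia.
  by move=> hE; rewrite hE -mulrDl in vh; nia.
have -> : (a * h, b * h) + (0, h) = (a * h, (b + 1) * h) by apply/vertexP => /=; lia.
apply: present_axis; left.
have [->|a0] := eqVneq a 0; first by rewrite mul0r.
exfalso; apply: nv; have -> : b = 0 by lia.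
have [->|->] : a = 1 \/ a = -1 by lia.
  by split; lia.
by split; lia.
Qed.

Let of_shift (x y : int) : present (x, y) -> `|x| + `|y - h| <= h ->
  kenyon_tile h (x, y - h).
Proof.
have [k [hk k0]] := h2.
move=> pv vh.
(* Up to a rotation and division by 2^m, such a point is (1, 1), whose coordinates are both odd. *)
have lat : ~ (y = h /\ `|x| = h).
  move=> [yh xh]; have : present (1, 1).
    have P j (a b : int) : present (a * (2 ^ j)%:Z, b * (2 ^ j)%:Z) -> present (a, b).
      elim: j => [|j IHj]; first by rewrite expn0 !mulr1.
      by rewrite expnSr PoszM !mulrA => /(present_twiceE (_, _)); exact: IHj.
    apply: (P m); rewrite -/h !mul1r.
    have [xE|xE] : x = h \/ x = - h by lia.
      by move: pv; rewrite xE yh.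
    by move: pv; rewrite xE yh => /(present_rot90 1 (h, h)).
  exact: present_odd_odd.
split; last by move=> /=; lia.
split=> //=.
have [[[a b] vE]|nE] := pselect (exists ab : int * int, (x, y) = (ab.1 * h, ab.2 * h)).
  move: vE => /vertexP[/= xE yE].
  apply: present_axis; have : `|a| + `|b - 1| <= 1.
    have hE : `|h| = h by lia.
    move: vh; rewrite (_ : y - h = (b - 1) * h) ?xE; last by lia.
    by rewrite !normrM hE -mulrDl; nia.
  move=> ab; have [a0|a0] := eqVneq a 0; first by left; rewrite xE a0 mul0r.
  by right; rewrite yE; (have -> : b = 1 by lia); lia.
rewrite (_ : (x, y - h) = (x, y) + (0 * h, -1 * h)); last by apply/vertexP => /=; lia.
apply: (@present_shift m (x, y) (0, -1) pv) => a b vE.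
by apply: nE; exists (a, b).
Qed.

Let rotK k (v : vertex) : exists u, iter k rot90 u = v.
Proof.
elim: k v => [|k IHk] v; first by exists v.
have [u uE] := IHk (v.2, - v.1).
by exists u; rewrite iterS uE /rot90 /= opprK; case: v {uE}.
Qed.

Let rot_norm k (v : vertex) :
  `|(iter k rot90 v).1| + `|(iter k rot90 v).2| = `|v.1| + `|v.2|.
Proof. by elim: k => //= k IHk; rewrite normrN addrC. Qed.

Let sector (v : vertex) : `|v.1| + `|v.2| <= h + h -> exists k : 'I_4,
  exists2 u, iter k rot90 u = v & `|u.1| + `|u.2 - h| <= h.
Proof.
case: v => x y /= vh.
have [c|[c|[c|c]]] : `|x| <= y \/ `|x| <= - y \/ `|y| <= x \/ `|y| <= - x by lia.
- by exists ord0, (x, y) => //=; lia.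
- by exists (inord 2), (- x, - y) => /=; [rewrite inordK //= /rot90 /= ?opprK|lia].
- by exists (inord 3), (- y, x) => /=; [rewrite inordK //= /rot90 /= ?opprK|lia].
- by exists (inord 1), (y, - x) => /=; [rewrite inordK //= /rot90 /= ?opprK|lia].
Qed.

Let rot_adjacent k u v : adjacent (iter k rot90 u) (iter k rot90 v) -> adjacent u v.
Proof.
elim: k => //= k IHk a; apply: IHk; move: a; rewrite /adjacent /=.
by rewrite -opprD normrN addrC.
Qed.

Let U_vset : vset U = diamond (h + h).
Proof.
apply/seteqP; split.
  move=> _ [k _ [_ [v Gv <-] <-]] /=.
  have [[p n] _] := in_shift Gv.
  by split; [exact/present_rot90|rewrite rot_norm].
move=> v [pv vh]; have [k [[x y] uv uh]] := sector vh.
exists k => //; exists (x, y) => //; exists (x, y - h).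
  by apply: of_shift uh; apply/(present_rot90 k); rewrite uv.
by apply/vertexP => /=; lia.
Qed.

Let U_eset : eset U = [set e | [/\ adjacent e.1 e.2, diamond (h + h) e.1 & diamond (h + h) e.2]].
Proof.
have [k0 [hk k00]] := h2.
apply/seteqP; split.
  move=> [u v] uv /=; split; first exact: eset_adjacent uv.
    by rewrite -U_vset; exact: eset_vset uv.
  by rewrite -U_vset; exact: eset_vset (eset_sym uv).
(* Every edge has exactly one odd endpoint, so it suffices to treat the edges issuing from odd
   vertices. *)
suff H u v : odd_vertex u -> adjacent u v -> diamond (h + h) u ->
    diamond (h + h) v -> eset U (u, v).
  move=> [u v] [/= uv Du Dv]; have [ou|ou] := boolP (odd_vertex u); first exact: H.
  suff : eset U (v, u) by exact: eset_sym.
  apply: H => //.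
    by move: uv ou; rewrite /adjacent /odd_vertex; case: u {Du} v {Dv} => x y [x' y'] /=; lia.
  by move: uv; rewrite /adjacent !(distrC u.1, distrC u.2).
move=> ou uv [pu uh] [pv vh].
have [k [[x y] ku xyh]] := sector uh.
have [[x' y'] kv] := rotK k v.
have p1 : present (x, y) by apply/(present_rot90 k); rewrite ku.
have p2 : present (x', y') by apply/(present_rot90 k); rewrite kv.
have a : adjacent (x, y) (x', y') by apply: (@rot_adjacent k); rewrite ku kv.
have o : odd_vertex (x, y).
  move: ou; rewrite -ku; elim: (val k) => //= j IHj; case: (iter j _ _) IHj => z t IHj.
  by move: IHj; rewrite /odd_vertex /rot90 /= => IHj oj; apply: IHj; lia.
(* As h is even, the odd vertex (x, y) is at odd distance from (0, h), hence at distance less than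
   h, and its neighbour stays in the same diamond. *)
have xyh' : `|x'| + `|y' - h| <= h.
  by move: a o xyh; rewrite /adjacent /odd_vertex /=; lia.
exists k => //; exists ((x, y), (x', y')); last by rewrite /= ku kv.
exists ((x, y - h), (x', y' - h)); last by congr pair; apply/vertexP => /=; lia.
split; [|exact: of_shift|exact: of_shift].
by move: a; rewrite /adjacent /=; lia.
Qed.

(** The horizontal diameter of the diamond is entirely present, so its inner points have two
    neighbours on it, while an end has only one neighbour in the diamond. *)
Let U_axis v : axis_terminal U v <-> v.2 = 0 /\ `|v.1| = h + h.
Proof.
have [k [hk k0]] := h2.
have Ux (x x' : int) : `|x| <= h + h -> `|x'| <= h + h -> `|x - x'| = 1 ->
    eset U ((x, 0), (x', 0)).
  move=> xh xh' xx; rewrite U_eset; split.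
  - by rewrite /adjacent /=; lia.
  - by split; [exact: present_axis (or_intror erefl)|rewrite /=; lia].
  - by split; [exact: present_axis (or_intror erefl)|rewrite /=; lia].
split.
  case: v => x y [[Uv [w [_ wU]]] [_ [_ /= y0 _]]]; subst y; split=> //.
  move: Uv; rewrite U_vset => -[_ /= xh]; apply: contrapT => nx.
  have := wU _ (Ux x (x + 1) _ _ _); rewrite (wU _ (Ux x (x - 1) _ _ _)); try lia.
  by move=> /(_ _ _ _)/vertexP[] /=; lia.
case: v => x y /= [-> xh].
have [s sE] : exists s : int, s = if 0 <= x then -1 else 1 by eexists.
have e : eset U ((x, 0), (x + s, 0)) by apply: Ux; case: ifP sE; lia.
split; last by exists (x + s, 0).
split; first exact: eset_vset e.
exists (x + s, 0); split=> // -[x' y']; rewrite U_eset => -[/= a _ [_ /= b]].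
by apply/vertexP; move: a b; rewrite /adjacent /=; case: ifP sE; lia.
Qed.

Lemma kenyon_step_tile :
  kenyon_step m (induced_subgraph (kenyon_tile h)) = induced_subgraph (kenyon_tile (h + h)).
Proof.
apply: subgraph_eq; apply/seteqP; split.
- by move=> v [Uv nv]; split; [rewrite -U_vset|move=> /U_axis].
- move=> v [Dv nv]; have Uv : vset U v by rewrite U_vset.
  by split=> //= /U_axis.
- move=> [u v] [Uuv nu nv]; move: Uuv; rewrite U_eset => -[/= a Du Dv].
  by split=> //; split=> // /U_axis.
- move=> [u v] [/= uv [Du nu] [Dv nv]].
  have e : eset U (u, v) by rewrite U_eset.
  by split=> //= /U_axis.
Qed.
End kenyon_step.

Lemma kenyonE n : kenyon n = induced_subgraph (kenyon_tile (2 ^ n.+1)%:Z).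
Proof.
elim: n => [|n IHn]; first exact: kenyon_seedE.
rewrite [LHS]/= IHn kenyon_step_tile //; congr (induced_subgraph (kenyon_tile _)).
by rewrite (expnS 2 n.+1); lia.
Qed.

Lemma kenyon_union_vset v : vset kenyon_union v <-> present v.
Proof.
split=> [[n _]|pv]; first by rewrite kenyonE => -[[]].
(* The strict inequality keeps [v] off the corners missing from the tile. *)
have [n vn] : exists n, `|v.1| + `|v.2| < (2 ^ n.+1)%:Z.
  exists (absz v.1 + absz v.2)%N; have := ltn_expl (absz v.1 + absz v.2).+1 (ltnSn 1).
  by lia.
exists n => //; rewrite kenyonE; split; first by split=> //; exact: ltW.
by case: v {pv} vn => x y /=; lia.
Qed.

Lemma kenyon_union_eset u v : eset kenyon_union (u, v) <->
  [/\ adjacent u v, present u & present v].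
Proof.
split=> [[n _]|[uv pu pv]]; first by rewrite kenyonE => -[/= uv [[pu _] _] [[pv _] _]].
have [n vn] : exists n, `|u.1| + `|u.2| + `|v.1| + `|v.2| < (2 ^ n.+1)%:Z.
  exists (absz u.1 + absz u.2 + absz v.1 + absz v.2)%N.
  by have := ltn_expl (absz u.1 + absz u.2 + absz v.1 + absz v.2).+1 (ltnSn 1); lia.
exists n => //; rewrite kenyonE; split=> //; split.
- by split=> //; case: u v {uv pu pv} vn => x y [x' y'] /=; lia.
- by case: u v {uv pu pv} vn => x y [x' y'] /=; lia.
- by split=> //; case: u v {uv pu pv} vn => x y [x' y'] /=; lia.
- by case: u v {uv pu pv} vn => x y [x' y'] /=; lia.
Qed.

(** * Walks and addresses *)

Definition direction := (bool * bool)%type.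

(* The second bit tells horizontal directions, the first one positive ones. *)
Definition vect (a : direction) : vertex :=
  let s := if a.1 then 1 else -1 in if a.2 then (s, 0) else (0, s).

Definition opposite (a : direction) : direction := (~~ a.1, a.2).

Lemma oppositeK a : opposite (opposite a) = a.
Proof. by case: a => -[] []. Qed.

Lemma vect_opposite a : vect (opposite a) = - vect a.
Proof. by apply/vertexP; case: a => -[] [] /=; lia. Qed.

Lemma vect_inj : injective vect.
Proof. by move=> [[] []] [[] []] /vertexP[/= h h'] //; exfalso; lia. Qed.

Lemma adjacentP u v : adjacent u v <-> exists a, v = u + vect a.
Proof.
split=> [uv|[a ->]]; last first.
  by rewrite /adjacent /=; case: u a => x y [[] []] /=; lia.
exists (if u.1 == v.1 then u.2 < v.2 else u.1 < v.1, u.1 != v.1).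
apply/vertexP; move: uv; rewrite /adjacent /vect /=.
by case: u v => x y [x' y'] /=; case: eqP => /= h; case: ltrP => /=; lia.
Qed.

(** Walks are words of directions instead of lists of vertices, so that walks issuing from different
    roots can be compared. *)
Fixpoint dwalk (E : set (vertex * vertex)) (u : vertex) (s : seq direction) : Prop :=
  if s is a :: s' then E (u, u + vect a) /\ dwalk E (u + vect a) s' else True.

Definition wend (u : vertex) (s : seq direction) : vertex :=
  foldl (fun u a => u + vect a) u s.

Lemma wendD u v s : wend (u + v) s = wend u s + v.
Proof. by elim: s u => //= a s IHs u; rewrite addrAC IHs. Qed.

Lemma wend_shift u s : wend u s = wend 0 s + u.
Proof. by rewrite -wendD add0r. Qed.

Lemma wend_cat u s s' : wend u (s ++ s') = wend (wend u s) s'.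
Proof. exact: foldl_cat. Qed.

Lemma dwalk_cat E u s s' :
  dwalk E u (s ++ s') <-> dwalk E u s /\ dwalk E (wend u s) s'.
Proof. by elim: s u => [|a s IHs] u /=; [tauto|rewrite IHs; tauto]. Qed.

Definition agree (N : nat) (W W' : seq direction -> Prop) :=
  forall s, (size s <= N)%N -> W s <-> W' s.

Lemma agree_sym N W W' : agree N W W' -> agree N W' W.
Proof. by move=> a s /a; tauto. Qed.

Lemma agree_trans N W W' W'' : agree N W W' -> agree N W' W'' -> agree N W W''.
Proof. by move=> a b s sN; rewrite (a s sN) (b s sN). Qed.

Lemma agree_mono M N W W' : (M <= N)%N -> agree N W W' -> agree M W W'.
Proof. by move=> MN a s sM; apply: a; exact: leq_trans MN. Qed.

Lemma agree_recenter N E E' u u' s : agree (size s + N) (dwalk E u) (dwalk E' u') ->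
  dwalk E u s -> agree N (dwalk E (wend u s)) (dwalk E' (wend u' s)).
Proof.
move=> a us t tN; have := a (s ++ t); rewrite size_cat leq_add2l tN => /(_ isT).
have := a s; rewrite leq_addr => /(_ isT); rewrite !dwalk_cat; tauto.
Qed.

Fixpoint positions (u : vertex) (s : seq direction) : seq vertex :=
  if s is a :: s' then u + vect a :: positions (u + vect a) s' else [::].

Lemma size_positions u s : size (positions u s) = size s.
Proof. by elim: s u => //= a s IHs u; rewrite IHs. Qed.

Lemma last_positions u s : last u (positions u s) = wend u s.
Proof. by elim: s u => //= a s IHs u; rewrite IHs. Qed.

Lemma dwalk_walk (G : subgraph) u s :
  dwalk (eset G) u s <-> walk G u (wend u s) (positions u s).
Proof.
rewrite /walk last_positions; elim: s u => [|a s IHs] u /=; first by [].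
rewrite IHs; split=> [[e [p _]]|[/andP[/set_mem e p] _]]; split=> //.
by rewrite p andbT; exact/mem_set.
Qed.

Lemma walk_dwalk (G : subgraph) u v p : walk G u v p ->
  exists s, [/\ p = positions u s, dwalk (eset G) u s & wend u s = v].
Proof.
elim: p u => [|w p IHp] u [/= up lp]; first by exists [::].
case/andP: up => /set_mem e wp.
have /adjacentP[a wE] := eset_adjacent e.
have [s [pE ws lE]] := IHp w (conj wp lp).
by exists (a :: s); rewrite /= -wE -pE.
Qed.

(** An edge meeting the open ball of radius N is, in one orientation, the last step of a walk of
    length at most N; the ball and the set of words of length at most N thus determine each
    other. *)
Lemma open_ball_agree (T T' : subgraph) N :
  open_ball T N = open_ball T' N <-> agree N (dwalk (eset T) 0) (dwalk (eset T') 0).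
Proof.
split.
  have H (S S' : subgraph) s : open_ball S N = open_ball S' N -> (size s <= N)%N ->
      dwalk (eset S) 0 s -> dwalk (eset S') 0 s.
    move=> e sN /dwalk_walk w; apply/dwalk_walk; apply: ball_walk e w _.
    by rewrite size_positions.
  by move=> e s sN; split; exact: H.
have H (S S' : subgraph) : agree N (dwalk (eset S) 0) (dwalk (eset S') 0) ->
    (open_ball S N).1 `<=` (open_ball S' N).1 /\
    (open_ball S N).2 `<=` (open_ball S' N).2.
  move=> a.
  have V v : (open_ball S N).1 v -> exists s, [/\ (size s < N)%N, dwalk (eset S) 0 s,
      dwalk (eset S') 0 s & wend 0 s = v].
    move=> /path_dist_lt[p /walk_dwalk[s [-> ws sv]]]; rewrite size_positions => sN.
    by exists s; split=> //; apply/a => //; exact: ltnW.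
  have V' v : (open_ball S N).1 v -> (open_ball S' N).1 v.
    move=> /V[s [sN _ ws sv]]; apply/path_dist_lt; exists (positions 0 s).
      by rewrite -sv; apply/dwalk_walk.
    by rewrite size_positions.
  have Ed u v : eset S (u, v) -> (open_ball S N).1 u -> eset S' (u, v).
    move=> uv /V[s [sN ws ws' su]]; have /adjacentP[b vE] := eset_adjacent uv.
    have /a : (size (rcons s b) <= N)%N by rewrite size_rcons.
    rewrite -cats1 !dwalk_cat /= su -vE; tauto.
  split=> // -[u v] [/= Suv uv]; split; last by case: uv => /V' h; [left|right].
  case: uv => [|/(Ed _ _ (eset_sym Suv))/eset_sym//]; exact: Ed.
move=> a; have [a1 a2] := H _ _ a; have [b1 b2] := H _ _ (agree_sym a).
by apply: injective_projections; apply/seteqP.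
Qed.

Lemma eset_translate t (G : subgraph) u v :
  eset (translate t G) (u, v) <-> eset G (u - t, v - t).
Proof.
split=> [[[x y] /= xy [<- <-]]|uv]; first by rewrite !addrK.
by exists (u - t, v - t) => //; rewrite !subrK.
Qed.

Lemma vset_translate t (G : subgraph) u : vset (translate t G) u <-> vset G (u - t).
Proof.
split=> [[x xy <-]|uv]; first by rewrite addrK.
by exists (u - t) => //; rewrite subrK.
Qed.

Lemma dwalk_translate t (G : subgraph) u s :
  dwalk (eset (translate t G)) u s <-> dwalk (eset G) (u - t) s.
Proof.
move: (eset (translate t G)) (@eset_translate t G) => E EG.
by elim: s u => //= a s IHs u; rewrite IHs EG addrAC.
Qed.

(** * Self-similarity of T_oo: parents, addresses and balls *)

Definition gwalk := dwalk (eset kenyon_union).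

Lemma gwalk_cons u a s : gwalk u (a :: s) <->
  present u /\ present (u + vect a) /\ gwalk (u + vect a) s.
Proof.
rewrite -[gwalk u _]/(eset kenyon_union (u, u + vect a) /\ gwalk (u + vect a) s).
rewrite kenyon_union_eset; split=> [[[_ ? ?] ?]//|[pu [pv w]]].
by split=> //; split=> //; apply/adjacentP; exists a.
Qed.

(** For an odd vertex the odd coordinate gives the axis of the lead. The two candidates for u' on
    that axis are adjacent, so exactly one of them is odd; the sign bit tests the candidate
    belonging to the positive direction. *)
Definition lead (u : vertex) : direction :=
  if odd `|u.1| then (odd `|((u.1 - 1) %/ 2)%Z + (u.2 %/ 2)%Z|, true)
  else (odd `|(u.1 %/ 2)%Z + ((u.2 - 1) %/ 2)%Z|, false).

Definition parent (u : vertex) : vertex :=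
  (((u.1 - (vect (lead u)).1) %/ 2)%Z, ((u.2 - (vect (lead u)).2) %/ 2)%Z).

Definition prepend (a : direction) (u : vertex) : vertex := twice u + vect a.

Lemma odd_prepend a u : odd_vertex (prepend a u).
Proof. by case: u a => x y [[] []]; rewrite /odd_vertex /=; lia. Qed.

Lemma lead_prepend a u : odd_vertex u -> lead (prepend a u) = a.
Proof.
case: u a => x y [[] []]; rewrite /odd_vertex /lead /= => o; case: ifP => h;
  congr pair; lia.
Qed.

Lemma parent_prepend a u : odd_vertex u -> parent (prepend a u) = u.
Proof.
move=> o; rewrite /parent lead_prepend //.
by case: u a o => x y [[] []] _; apply/vertexP => /=; lia.
Qed.

Lemma prependK u : odd_vertex u -> prepend (lead u) (parent u) = u.
Proof.
case: u => x y; rewrite /odd_vertex /prepend /parent /lead /= => o.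
by apply/vertexP; case: ifP => h /=; case: ifP => h' /=; lia.
Qed.

Lemma odd_parent u : odd_vertex u -> odd_vertex (parent u).
Proof.
case: u => x y; rewrite /odd_vertex /parent /lead /= => o.
by case: ifP => h /=; case: ifP => h' /=; lia.
Qed.

Definition status (u : vertex) : bool := `[< present (u + vect (lead u)) >].

Definition address (u : vertex) (n : nat) : direction * bool :=
  (lead (iter n parent u), status (iter n parent u)).

Lemma addressS u n : address u n.+1 = address (parent u) n.
Proof. by rewrite /address iterSr. Qed.

Lemma present_twice_vect u a : present (twice u + vect a).
Proof. exact/present_odd/odd_prepend. Qed.

(** A perpendicular turn at 2u + a would lead to a vertex with two odd coordinates, which is absent.
    What remains is to go back to 2u or straight on to 2(u + a). *)
Lemma present_twice_vect2 u a b : present u ->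
  present (twice u + vect a + vect b) <->
  b = opposite a \/ b = a /\ present (u + vect a).
Proof.
move=> pu; have [->|nb] := eqVneq b (opposite a).
  by rewrite vect_opposite addrK present_twiceE; tauto.
have [->|nb'] := eqVneq b a.
  have -> : twice u + vect a + vect a = twice (u + vect a).
    by apply/vertexP => /=; lia.
  rewrite present_twiceE; split=> [|[e|[]]//]; first by right.
  by move: e; case: a {nb} => -[] [].
split=> [p|[e|[e _]]]; [|by move: nb; rewrite e eqxx|by move: nb'; rewrite e eqxx].
exfalso; move: p nb nb'; case: u {pu} => x y.
rewrite (_ : _ + _ = ((twice (x, y) + vect a + vect b).1,
  (twice (x, y) + vect a + vect b).2)); last exact: surjective_pairing.
by case: a b => -[] [] [[] []] // /present_odd_odd H _ _; apply: H => /=; lia.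
Qed.

(** An odd [u] is the midpoint between 2u' and 2(u' + [vect (lead u)]). The first end is always
    present, the second one according to the status. *)
Lemma present_vect u a : odd_vertex u ->
  present (u + vect a) <-> a = opposite (lead u) \/ a = lead u /\ status u.
Proof.
move=> o; rewrite -{1}(prependK o) /prepend present_twice_vect2; last first.
  by apply: present_odd; exact: odd_parent.
have := prependK o; rewrite /status asboolE /prepend => uE.
have -> : present (u + vect (lead u)) <-> present (parent u + vect (lead u)).
  rewrite -{1}uE present_twice_vect2; last exact/present_odd/odd_parent.
  have n : lead u <> opposite (lead u) by case: (lead u) => -[] [].
  by tauto.
by [].
Qed.

(** As [u + vect (lead u)] is twice [parent u + vect (lead u)], the status tells whether the odd
    vertex [parent u] has a neighbour in the direction [lead u]; [present_vect] answers this at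
    [parent u]. *)
Lemma statusE u : odd_vertex u -> status u =
  ((lead u).2 == (lead (parent u)).2) &&
  (((lead u).1 != (lead (parent u)).1) || status (parent u)).
Proof.
move=> o; have o1 := odd_parent o; apply/idP/idP.
  rewrite asboolE -{1}(prependK o) /prepend => /(present_twice_vect2 _ _ (present_odd o1)).
  case=> [e|[_]]; first by move: e; case: (lead u) => -[] [].
  rewrite present_vect // => -[|[]] ->; first by rewrite /= eqxx; case: (_.1).
  by rewrite !eqxx /= => ->.
move=> h; rewrite asboolE -{1}(prependK o) /prepend.
apply/(present_twice_vect2 _ _ (present_odd o1)); right; split=> //.
apply/present_vect => //; case/andP: h => /eqP h2 h1.
have [h11|h11] := eqVneq (lead u).1 (lead (parent u)).1.
  right; rewrite h11 eqxx /= in h1; split=> //; move: h11 h2.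
  by case: (lead u) (lead (parent u)) => [a b] [c d] /= -> ->.
left; move: h11 h2; rewrite /opposite.
by case: (lead u) (lead (parent u)) => -[] [] [[] []].
Qed.

Definition duplicate (s : seq direction) : seq direction :=
  flatten [seq [:: a; a] | a <- s].

Lemma size_duplicate s : size (duplicate s) = (size s).*2.
Proof. by elim: s => //= a s ->. Qed.

Lemma wend_duplicate u s : wend (twice u) (duplicate s) = twice (wend u s).
Proof.
elim: s u => //= a s IHs u; rewrite -IHs; congr (wend _ _).
by apply/vertexP => /=; lia.
Qed.

Lemma gwalk_duplicate u s : present u -> gwalk (twice u) (duplicate s) <-> gwalk u s.
Proof.
elim: s u => [|a s IHs] u pu; first by [].
rewrite [duplicate _]/= !gwalk_cons present_twice_vect2 //.
have -> : twice u + vect a + vect a = twice (u + vect a).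
  by apply/vertexP => /=; lia.
have n : a <> opposite a by case: a => -[] [].
have q := present_twice_vect u a; have p2 := present_twice pu.
split=> [[_ [_ [_ [[//|[_ p]] w]]]]|[_ [p w]]].
  by rewrite -(IHs _ p).
by rewrite (IHs _ p); tauto.
Qed.

(** Two letters of a walk from 2u either return to 2u or repeat one step of a walk from u. Hence M
    letters at u control 2M letters at 2u. *)
Lemma agree_twice M u u' : present u -> present u' ->
  agree M (gwalk u) (gwalk u') -> agree M.*2 (gwalk (twice u)) (gwalk (twice u')).
Proof.
elim: M u u' => [|M IHM] u u' pu pu' a s.
  by rewrite leqn0 size_eq0 => /eqP ->.
case: s => [|b [|c s]] sM.
- by [].
- have := present_twice_vect u b; have := present_twice_vect u' b.
  have := present_twice pu; have := present_twice pu'.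
  by rewrite !gwalk_cons /gwalk /=; tauto.
rewrite !gwalk_cons !present_twice_vect2 //.
have p2 := present_twice pu; have p2' := present_twice pu'.
have q := present_twice_vect u b; have q' := present_twice_vect u' b.
have sM' : (size s <= M.*2)%N by [].
have [->|nc] := eqVneq c (opposite b).
  have := IHM _ _ pu pu' (agree_mono (leqnSn M) a) s sM'.
  by rewrite vect_opposite !addrK; tauto.
have [->|nc'] := eqVneq c b; last first.
  by split=> -[_ [_ [_ [[e|[e _]] _]]]]; exfalso; move: nc nc'; rewrite e eqxx.
have D v : twice v + vect b + vect b = twice (v + vect b).
  by apply/vertexP => /=; lia.
rewrite !D; have := a [:: b] isT; rewrite !gwalk_cons /gwalk /= => ab.
have n : b <> opposite b by case: (b) => -[] [].
have H : present (u + vect b) /\ gwalk (twice (u + vect b)) s <->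
    present (u' + vect b) /\ gwalk (twice (u' + vect b)) s.
  have K (p1 : present (u + vect b)) (p1' : present (u' + vect b)) :
      gwalk (twice (u + vect b)) s <-> gwalk (twice (u' + vect b)) s.
    apply: IHM => // t tM; have := a (b :: t) tM; rewrite !gwalk_cons.
    by clear -pu pu' p1 p1'; tauto.
  by clear -K ab pu pu'; tauto.
have R v W : present (twice v) -> present (twice v + vect b) ->
    (present (twice v) /\ present (twice v + vect b) /\ present (twice v + vect b) /\
      (b = opposite b \/ b = b /\ present (v + vect b)) /\ W) <->
    (present (v + vect b) /\ W) by clear -n; tauto.
by rewrite !R.
Qed.

Lemma agree_halve M u u' : present u -> present u' ->
  agree M.*2 (gwalk (twice u)) (gwalk (twice u')) -> agree M (gwalk u) (gwalk u').
Proof.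
move=> pu pu' a s sM.
rewrite -(gwalk_duplicate s pu) -(gwalk_duplicate s pu').
by apply: a; rewrite size_duplicate leq_double.
Qed.

Lemma present_oddvect u a : odd_vertex u -> gwalk u [:: a] <->
  a = opposite (lead u) \/ a = lead u /\ status u.
Proof.
move=> o; rewrite gwalk_cons /gwalk /= present_vect //.
have := present_odd o; tauto.
Qed.

Lemma even_twice w : present w -> ~~ odd_vertex w -> exists2 g, present g & w = twice g.
Proof.
case=> [_|v o|v pv _]; last by exists v.
  by exists 0; [exact: present0|apply/vertexP].
by rewrite o.
Qed.

Lemma gwalk_even w a : present w -> ~~ odd_vertex w -> gwalk w [:: a].
Proof.
move=> pw /(even_twice pw)[g pg wE]; rewrite gwalk_cons /gwalk /=; split=> //.
by split=> //; rewrite wE; exact: present_twice_vect.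
Qed.

(** Balls of radius 1 detect parity: a present even vertex has all four neighbours, an odd one has
    none perpendicular to its lead. *)
Lemma odd_vertexP w : present w -> odd_vertex w <-> ~ (forall a, gwalk w [:: a]).
Proof.
move=> pw; split=> [o h|h]; last first.
  by apply: contrapT => /negP o; apply: h => a; exact: gwalk_even.
have /(present_oddvect _ o) := h ((lead w).1, ~~ (lead w).2).
by case: (lead w) => -[] [] [e|[e _]]; discriminate.
Qed.

Lemma agree_odd w w' : present w -> present w' -> agree 1 (gwalk w) (gwalk w') ->
  odd_vertex w = odd_vertex w'.
Proof.
move=> pw pw' a; apply/idP/idP => /odd_vertexP o; apply/odd_vertexP => // h; apply: o => // b;
  by apply/a.
Qed.

Lemma parentE u : odd_vertex u -> u + vect (opposite (lead u)) = twice (parent u).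
Proof. by move=> o; rewrite -{1}(prependK o) /prepend vect_opposite addrK. Qed.

Lemma wend1 u a : wend u [:: a] = u + vect a. Proof. by []. Qed.

Lemma agree_prepend N u u' : odd_vertex u -> odd_vertex u' -> lead u = lead u' ->
  agree N.+1 (gwalk (twice (parent u))) (gwalk (twice (parent u'))) ->
  agree N (gwalk u) (gwalk u').
Proof.
move=> o o' le a; have := @agree_recenter N _ _ _ _ [:: lead u] a.
rewrite !wend1 -/gwalk -/(prepend _ _) -/(prepend _ _) prependK // le prependK //; apply.
rewrite -/gwalk; apply/gwalk_cons; have := odd_parent o => o1; have p1 := present_odd o1.
split; first exact: present_twice.
by split=> //; exact: present_twice_vect.
Qed.

Lemma agree_parent N u u' : odd_vertex u -> odd_vertex u' -> lead u = lead u' ->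
  agree N.+1 (gwalk u) (gwalk u') ->
  agree N (gwalk (twice (parent u))) (gwalk (twice (parent u'))).
Proof.
move=> o o' le a; have := @agree_recenter N _ _ _ _ [:: opposite (lead u)] a.
rewrite !wend1 -/gwalk parentE // le parentE //; apply.
by rewrite -/gwalk -le; apply/present_oddvect => //; left.
Qed.

(** The first letter of the address decides the first step; it leads to an even vertex, from which
    every second step is allowed. *)
Lemma address0_agree u u' : odd_vertex u -> odd_vertex u' ->
  address u 0 = address u' 0 -> agree 2 (gwalk u) (gwalk u').
Proof.
move=> o o' [le se].
have P a : gwalk u [:: a] <-> gwalk u' [:: a] by rewrite !present_oddvect // le se.
case=> [|a [|b []]] // _.
have E v : odd_vertex v -> gwalk v [:: a] -> gwalk v [:: a; b].
  move=> ov /gwalk_cons[pv [pva _]]; rewrite gwalk_cons; split=> //; split=> //.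
  apply: gwalk_even => //; case: v a ov {P pv pva} => x y [[] []]; rewrite /odd_vertex /=; lia.
by split=> h; apply: E => //; apply/P; move: h; rewrite !gwalk_cons /gwalk /=; tauto.
Qed.

(** The radius comes from the recursion r |-> 2r - 1 with initial value 2: passing from the parent
    to its double doubles the radius, and stepping from there to the vertex costs 1. *)
Lemma address_agree n u u' : odd_vertex u -> odd_vertex u' ->
  (forall i, (i <= n)%N -> address u i = address u' i) -> agree (2 ^ n).+1 (gwalk u) (gwalk u').
Proof.
elim: n u u' => [|n IHn] u u' o o' c; first by apply: address0_agree => //; exact: c.
have o1 := odd_parent o; have o1' := odd_parent o'.
have le : lead u = lead u' by have := c 0%N isT => -[].
apply: agree_prepend => //.
have := agree_twice (present_odd o1) (present_odd o1') (IHn _ _ o1 o1' _).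
rewrite doubleS expnS mul2n; apply=> i h.
by rewrite -!addressS; exact: c.
Qed.

Lemma agree_lead u u' : odd_vertex u -> odd_vertex u' ->
  agree 3 (gwalk u) (gwalk u') -> lead u = lead u'.
Proof.
move=> o o' a.
(* The parent is the neighbour whose half is an odd vertex, that is, some two-step
   straight walk from it fails. *)
pose q (v : vertex) c := gwalk v [:: c] /\ ~ (forall b, gwalk v [:: c; b; b]).
have qE v c : odd_vertex v -> q v c <-> c = opposite (lead v).
  move=> ov; have o1 := odd_parent ov; have p1 := present_odd o1.
  have T g b : present g -> gwalk (twice g) [:: b; b] <-> gwalk g [:: b].
    exact: (@gwalk_duplicate g [:: b]).
  have C w e s : gwalk w (e :: s) <-> gwalk w [:: e] /\ gwalk (w + vect e) s.
    by rewrite !gwalk_cons /gwalk /=; tauto.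
  split=> [[/(present_oddvect _ ov)[//|[cE st]] nb]|cE].
    exfalso; apply: nb => b; rewrite C; split.
      by apply/present_oddvect => //; right.
    have -> : v + vect c = twice (parent v + vect c).
      by rewrite -{1}(prependK ov) cE /prepend; apply/vertexP => /=; lia.
    have pc : present (parent v + vect c).
      by apply/present_twiceE; move: st; rewrite asboolE cE -{1}(prependK ov) /prepend;
        rewrite (_ : _ + _ + _ = twice (parent v + vect (lead v))) //; apply/vertexP => /=; lia.
    apply/T => //; apply: gwalk_even => //.
    by case: (parent v) c o1 {cE pc} => x y [[] []]; rewrite /odd_vertex /=; lia.
  split; first by apply/present_oddvect => //; left.
  move=> h; have /odd_vertexP := o1; apply=> // b; apply/T => //.
  by have := h b; rewrite C cE parentE // => -[].
have qq c : q u c <-> q u' c.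
  rewrite /q (a [:: c] isT); split=> -[h1 h2]; split=> // h3; apply: h2 => b.
    exact/(a [:: c; b; b]).
  exact/(a [:: c; b; b]).
have : q u' (opposite (lead u)) by apply/qq/qE.
by move=> /qE -/(_ o') /(congr1 opposite); rewrite !oppositeK.
Qed.

Lemma agree_status u u' : odd_vertex u -> odd_vertex u' -> lead u = lead u' ->
  agree 1 (gwalk u) (gwalk u') -> status u = status u'.
Proof.
move=> o o' le /(_ [:: lead u] isT); rewrite !present_oddvect // -le.
have n : lead u <> opposite (lead u) by case: (lead u) => -[] [].
by move=> h; apply/idP/idP; move: h n; tauto.
Qed.

(** Radius 3 shows the lead, by [agree_lead]. One more letter requires twice the radius at the
    double of the parent, plus room for the step that leads there. *)
Fixpoint address_radius (n : nat) : nat :=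
  if n is m.+1 then (address_radius m).*2.+2 else 3.

Lemma agree_address n u u' : odd_vertex u -> odd_vertex u' ->
  agree (address_radius n) (gwalk u) (gwalk u') ->
  forall i, (i <= n)%N -> address u i = address u' i.
Proof.
have r3 m : (3 <= address_radius m)%N.
  by case: m => //= m; rewrite !ltnS -[1%N]/(1.*2./2); elim: m => //= m IHm; lia.
elim: n u u' => [|n IHn] u u' o o' a i.
  rewrite leqn0 => /eqP->; have le := agree_lead o o' a.
  by congr pair => //; exact: agree_status o o' le (agree_mono _ a).
have o1 := odd_parent o; have o1' := odd_parent o'.
have le := agree_lead o o' (agree_mono (r3 n.+1) a).
case: i => [_|i iN].
  by congr pair => //; apply: agree_status o o' le (agree_mono _ a).
rewrite !addressS; apply: IHn => //; apply: agree_halve; [exact: present_odd..|].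
by apply: agree_mono (agree_parent o o' le a).
Qed.

Definition address_rule (y : nat -> direction * bool) := forall n,
  (y n).2 = ((y n).1.2 == (y n.+1).1.2) && (((y n).1.1 != (y n.+1).1.1) || (y n.+1).2).

Lemma odd_iter_parent n u : odd_vertex u -> odd_vertex (iter n parent u).
Proof. by move=> o; elim: n => //= n; exact: odd_parent. Qed.

Lemma address_ruleP u : odd_vertex u -> address_rule (address u).
Proof.
by move=> o n; rewrite /address /=; apply: statusE; exact: odd_iter_parent.
Qed.

Lemma odd_vect a : odd_vertex (vect a). Proof. by case: a => -[] []. Qed.

Lemma vect_prepend a : vect a = prepend (opposite a) (vect a).
Proof. by apply/vertexP; case: a => -[] []. Qed.

Lemma lead_vect a : lead (vect a) = opposite a.
Proof. by rewrite vect_prepend lead_prepend // odd_vect. Qed.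

Lemma parent_vect a : parent (vect a) = vect a.
Proof. by rewrite {1}vect_prepend parent_prepend // odd_vect. Qed.

(** A neighbour a of 0 equals 2a - a, so it is its own parent with lead pointing to 0. These are the
    four constant addresses of status true. *)
Lemma address_vect a n : address (vect a) n = (opposite a, true).
Proof.
have -> : address (vect a) n = address (vect a) 0.
  by elim: n => // n <-; rewrite addressS parent_vect.
rewrite /address /= lead_vect; congr pair; apply/asboolP.
by rewrite lead_vect vect_opposite subrr; exact: present0.
Qed.

Lemma address_prepend a u n : odd_vertex u -> address (prepend a u) n.+1 = address u n.
Proof. by move=> o; rewrite addressS parent_prepend. Qed.

Lemma address_prepend0 a u y : odd_vertex u -> address_rule y -> (y 0%N).1 = a ->
  (forall i, (i <= 0)%N -> address u i = y i.+1) -> address (prepend a u) 0 = y 0%N.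
Proof.
move=> o ry y0 yE.
rewrite [LHS]surjective_pairing (address_ruleP (odd_prepend a u) 0) address_prepend // yE //.
have -> : (address (prepend a u) 0).1 = (y 0%N).1 by rewrite y0 /address /= lead_prepend.
by rewrite -ry -surjective_pairing.
Qed.

Lemma address_realized y n : address_rule y ->
  exists2 u, odd_vertex u & forall i, (i <= n)%N -> address u i = y i.
Proof.
elim: n y => [|n IHn] y ry.
  pose a := (y 0%N).1.
  (* The parent is chosen among the neighbours of 0. Its lead is [opposite b]: for b = a it has the
     axis of a and the opposite sign, which forces status true; otherwise the axes differ and the
     status is false. *)
  pose b : direction := if (y 0%N).2 then a else (a.1, ~~ a.2).
  exists (prepend a (vect b)); first exact: odd_prepend.
  move=> i; rewrite leqn0 => /eqP ->; rewrite [LHS]surjective_pairing.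
  rewrite (address_ruleP (odd_prepend a _) 0) address_prepend ?odd_vect // address_vect.
  rewrite /address /= lead_prepend ?odd_vect // /b /a.
  by case: (y 0%N) => -[] [] [] [].
have [|u ou uE] := IHn (fun i => y i.+1); first by move=> i; exact: ry.
exists (prepend (y 0%N).1 u); first exact: odd_prepend.
move=> [_|i iN]; last by rewrite address_prepend // uE.
by apply: address_prepend0 => // i; rewrite leqn0 => /eqP ->; exact: uE.
Qed.

(** For w = 2^k g with g odd, the address of w + a begins with k - 1 letters pointing back to w,
    then has one letter of lead a, and continues as the address of g, whatever a is. If k is large
    or w = 0, only the letters pointing to w appear up to m. *)
Lemma address_even m w : present w -> ~~ odd_vertex w ->
  (exists2 j, (j <= m)%N & forall a b i, (j < i)%N -> address (w + vect a) i = address (w + vect b) i)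
  \/ (forall a i, (i <= m)%N -> address (w + vect a) i = (opposite a, true)).
Proof.
elim: m w => [|m IHm] w pw ew; have [g pg wE] := even_twice pw ew.
  have [og|eg] := boolP (odd_vertex g).
    left; exists 0%N => // a b [//|i] _; rewrite wE -!/(prepend _ _) !address_prepend //.
  right=> a i; rewrite leqn0 => /eqP ->.
  have E : w + vect a = prepend (opposite a) (g + vect a).
    by rewrite wE /prepend vect_opposite; apply/vertexP => /=; lia.
  have o1 : odd_vertex (g + vect a).
    by case: g a eg {pg wE E} => x y [[] []]; rewrite /odd_vertex /=; lia.
  have le : lead (w + vect a) = opposite a by rewrite E lead_prepend.
  rewrite /address /= le; congr pair; apply/asboolP.
  by rewrite le vect_opposite addrK.
have [og|eg] := boolP (odd_vertex g).
  left; exists 0%N => // a b [//|i] _; rewrite wE -!/(prepend _ _) !address_prepend //.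
have E a : w + vect a = prepend (opposite a) (g + vect a).
  by rewrite wE /prepend vect_opposite; apply/vertexP => /=; lia.
have o1 a : odd_vertex (g + vect a).
  by case: g a eg {pg wE E} => x y [[] []]; rewrite /odd_vertex /=; lia.
have [[j jm jE]|h] := IHm g pg eg; [left|right].
  by exists j.+1 => // a b [//|i] ji; rewrite !E !address_prepend //; exact: jE.
move=> a [_|i im]; last by rewrite E address_prepend // h.
have le : lead (w + vect a) = opposite a by rewrite E lead_prepend.
rewrite /address /= le; congr pair; apply/asboolP.
by rewrite le vect_opposite addrK.
Qed.

(** The walk from u to 2^n times its n-th ancestor: step to 2u', then perform every step of the walk
    of u' twice. It is computed from the leads alone, hence makes sense in every tree of X. *)
Fixpoint center_walk (d : nat -> direction) (n : nat) : seq direction :=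
  if n is m.+1 then opposite (d 0%N) :: duplicate (center_walk (fun i => d i.+1) m) else [::].

Definition leads (u : vertex) (i : nat) : direction := lead (iter i parent u).

Definition center n u := iter n twice (iter n parent u).

Lemma center_walkP n u : odd_vertex u ->
  gwalk u (center_walk (leads u) n) /\ wend u (center_walk (leads u) n) = center n u.
Proof.
elim: n u => [|n IHn] u o; first by [].
have o1 := odd_parent o; have [w e] := IHn _ o1.
have le : center_walk (fun i => leads u i.+1) n = center_walk (leads (parent u)) n.
  by congr (center_walk _ _); apply/funext => i; rewrite /leads iterSr.
rewrite [center_walk _ _]/= le -cat1s wend_cat wend1 -[leads u 0]/(lead u) parentE //.
rewrite wend_duplicate e; split; last by rewrite /center -iterSr.
rewrite /gwalk dwalk_cat wend1 parentE //; split.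
  by apply/present_oddvect => //; left.
by apply/gwalk_duplicate => //; exact: present_odd.
Qed.

Lemma eq_center_walk n d d' : (forall i, (i < n)%N -> d i = d' i) ->
  center_walk d n = center_walk d' n.
Proof.
elim: n d d' => //= n IHn d d' e; rewrite e //; congr (_ :: duplicate _).
by apply: IHn => i iN; exact: e.
Qed.

(** * Limits of translates *)

Local Notation R := Rdefinitions.R.
Local Notation expR := sequences.expR.

Definition rwalk (T : rooted) := dwalk (eset T) 0.

Lemma agree_open_ball (T T' : rooted) N :
  agree N (rwalk T) (rwalk T') <-> open_ball T N = open_ball T' N.
Proof. by rewrite open_ball_agree. Qed.

Lemma agree_dist (T T' : rooted) N : (0 < N)%N ->
  agree N (rwalk T) (rwalk T') -> rooted_dist T T' <= expR (- N%:R).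
Proof.
move=> N0 /agree_open_ball e; rewrite -lee_fin rooted_distE.
rewrite -[X in (_ <= X)%E]/(expeR (- N%:R%:E)) lee_expeR leeN2.
by apply: ereal_sup_ubound; right; exists N.
Qed.

Lemma dist_agree (T T' : rooted) N :
  rooted_dist T T' < expR (- N%:R) -> agree N (rwalk T) (rwalk T').
Proof.
rewrite -lte_fin rooted_distE -[X in (_ < X)%E]/(expeR (- N%:R%:E)).
rewrite lte_expeR lteN2 => /ereal_sup_gt[_ [->|[M [M1 MN] <-]]].
  by rewrite lte_fin ltNge ler0n.
rewrite lte_fin ltr_nat => NM.
by apply/agree_open_ball; apply: ball_mono MN; exact: ltnW.
Qed.

Lemma small_exp (e : R) : 0 < e -> exists N : nat, expR (- N%:R) < e.
Proof.
move=> e0; exists (Num.truncn e^-1).+1.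
rewrite expRN -[ltRHS]invrK ltf_pV2 ?posrE ?invr_gt0 ?expR_gt0 //.
apply: (@lt_le_trans _ _ (Num.truncn e^-1).+1%:R); first exact: truncnS_gt.
by apply: le_trans (expR_ge1Dx _); rewrite lerDr.
Qed.

Lemma nbhs_rooted (T : rooted) (U : set rooted) :
  nbhs T U <-> exists N, forall T', agree N (rwalk T) (rwalk T') -> U T'.
Proof.
split=> [/nbhs_ballP[e /= e0 eU]|[N NU]].
  have [N Ne] := small_exp e0; exists N.+1 => T' a; apply: eU.
  rewrite ballEmdist /=; apply: le_lt_trans (agree_dist (ltn0Sn N) a) _.
  by apply: le_lt_trans Ne; rewrite ler_expR lerN2 ler_nat.
apply/nbhs_ballP; exists (expR (- N%:R)); first exact: expR_gt0.
by move=> T'; rewrite ballEmdist /= => /dist_agree; exact: NU.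
Qed.

Lemma rooted_ext (T T' : rooted) :
  (forall N, agree N (rwalk T) (rwalk T')) -> T = T'.
Proof.
move=> a; apply: rooted_dist0; apply/eqP; rewrite eq_le rooted_dist_ge0 andbT leNgt.
apply/negP => /small_exp[N]; apply/negP; rewrite -leNgt.
apply: le_trans (agree_dist (ltn0Sn N) (a _)) _.
by rewrite ler_expR lerN2 ler_nat.
Qed.

Lemma vset_rwalk (T : rooted) v : vset T v <-> exists2 s, rwalk T s & wend 0 s = v.
Proof.
split=> [vT|[s]].
  have [p /walk_dwalk[s [_ w e]]] := rooted_connected (rooted0 T) vT.
  by exists s.
elim/last_ind: s => [_ <-|s a _]; first exact: rooted0.
rewrite /rwalk -cats1 dwalk_cat wend_cat => -[_ [/eset_sym/eset_vset + _]] <-.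
by [].
Qed.

Section reroot.
Variables (T : rooted) (v : vertex) (Tv : vset T v).

Let inf : infinite_set (vset (translate (- v) T)).
Proof.
have e : vset T = (fun u => u + v) @` vset (translate (- v) T).
  apply/seteqP; split=> [u Tu|_ [u /vset_translate + <-]]; last by rewrite opprK.
  by exists (u - v); [apply/vset_translate; rewrite opprK subrK|rewrite subrK].
by move=> f; apply: (rooted_inf (r := T)); rewrite e; exact: finite_image.
Qed.

Let zero : vset (translate (- v) T) 0.
Proof. by apply/vset_translate; rewrite opprK add0r. Qed.

Definition reroot : rooted :=
  Rooted inf (connected_image (@rooted_connected T)) zero.

Lemma rwalk_reroot s : rwalk reroot s <-> dwalk (eset T) v s.
Proof. by rewrite /rwalk dwalk_translate opprK add0r. Qed.

Lemma translation_rel_reroot : translation_rel (T, reroot).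
Proof. by exists v. Qed.
End reroot.

Lemma translation_relP (T T' : rooted) : translation_rel (T, T') <->
  exists (v : vertex) (Tv : vset T v), T' = reroot Tv.
Proof.
split=> [[v Tv e]|[v [Tv ->]]]; last exact: translation_rel_reroot.
by exists v, Tv; exact: graph_inj.
Qed.

Lemma translation_rel_refl T : translation_rel (T, T).
Proof.
apply/translation_relP; exists 0, (rooted0 T); apply: rooted_ext => N s _.
by rewrite rwalk_reroot.
Qed.

Lemma translation_rel_trans T1 T2 T3 :
  translation_rel (T1, T2) -> translation_rel (T2, T3) -> translation_rel (T1, T3).
Proof.
move=> /translation_relP[v [Tv ->]] /translation_relP[w [Tw ->]].
have Tvw : vset T1 (w + v) by move: Tw => /vset_translate; rewrite opprK.
apply/translation_relP; exists (w + v), Tvw; apply: rooted_ext => N s _.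
by rewrite !rwalk_reroot /= dwalk_translate opprK.
Qed.

Lemma translation_rel_sym T1 T2 : translation_rel (T1, T2) -> translation_rel (T2, T1).
Proof.
move=> /translation_relP[v [Tv ->]].
have T0 : vset (reroot Tv) (- v).
  by apply/vset_translate; rewrite opprK addNr; exact: rooted0.
apply/translation_relP; exists (- v), T0; apply: rooted_ext => N s _.
by rewrite !rwalk_reroot /= dwalk_translate opprK addNr.
Qed.

Lemma ghys_kenyonP (T : rooted) : ghys_kenyon_set T <->
  forall N, exists2 v, present v & agree N (rwalk T) (gwalk v).
Proof.
split=> [TX N|h U /nbhs_rooted[N NU]].
  have /TX[T' [[v /kenyon_union_vset pv e] a]] :
      nbhs T [set T' | agree N (rwalk T) (rwalk T')] by apply/nbhs_rooted; exists N.
  exists v => //; apply: agree_trans a _ => s _.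
  by rewrite /rwalk e dwalk_translate opprK add0r.
have [v /kenyon_union_vset pv a] := h N.
exists (@reroot kenyon_tree v pv); split; first exact: translation_rel_reroot.
by apply: NU; apply: agree_trans a _ => s _; rewrite rwalk_reroot.
Qed.

Lemma ghys_kenyon_rel_closed T T' :
  ghys_kenyon_set T -> translation_rel (T, T') -> ghys_kenyon_set T'.
Proof.
move=> /ghys_kenyonP TX /translation_relP[v [Tv ->]].
have [s Ts sv] := (vset_rwalk T v).1 Tv; subst v.
apply/ghys_kenyonP => N; have [u pu a] := TX (size s + N)%N.
have us : gwalk u s by apply/a => //; exact: leq_addr.
exists (wend u s).
  elim/last_ind: s us {Ts Tv a} => [//|s b _].
  rewrite /gwalk -cats1 dwalk_cat wend_cat => -[_ [/kenyon_union_eset[_ _ + _]]].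
  by [].
have := agree_recenter a Ts; apply: agree_trans => t _.
by rewrite rwalk_reroot.
Qed.

Section limit.
Variable v : nat -> vertex.
Hypothesis pv : forall n, present (v n).
Hypothesis av : forall m n, (m <= n)%N -> agree m (gwalk (v m)) (gwalk (v n)).

(** The limit tree is specified by its walks: a word is allowed if it is allowed at [v n] for some,
    equivalently every, n at least its length. *)
Let W s := gwalk (v (size s)) s.

Let WE n s : (size s <= n)%N -> W s <-> gwalk (v n) s.
Proof. by move=> sn; exact: av. Qed.

Let V := [set wend 0 s | s in W].
Let E := [set e : vertex * vertex |
  exists s a, W (rcons s a) /\ e = (wend 0 s, wend 0 s + vect a)].

Let W_rcons n s a : (size s < n)%N -> W (rcons s a) <->
  gwalk (v n) s /\ eset kenyon_union (wend (v n) s, wend (v n) s + vect a).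
Proof.
by move=> sn; rewrite (@WE n) ?size_rcons // /gwalk -cats1 dwalk_cat /=; tauto.
Qed.

Let E_adj u w : E (u, w) -> adjacent u w.
Proof. by move=> [s [a [_ [-> ->]]]]; apply/adjacentP; exists a. Qed.

Let E_V u w : E (u, w) -> V u.
Proof.
move=> [s [a [Ws [-> _]]]]; exists s => //.
by move: Ws; rewrite (@W_rcons (size s).+1 s a (ltnSn _)) (@WE (size s).+1) // => -[].
Qed.

Let E_sym u w : E (u, w) -> E (w, u).
Proof.
move=> [s [a [Ws [-> ->]]]]; exists (rcons s a), (opposite a); split; last first.
  by rewrite -cats1 wend_cat /= vect_opposite addrK.
have := Ws; rewrite !(@W_rcons (size s).+2) ?size_rcons //.
rewrite -[in X in _ -> X]cats1 wend_cat /gwalk dwalk_cat /= vect_opposite addrK => -[w1 e].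
by split; [|exact: (@eset_sym kenyon_union)].
Qed.

Let G := Subgraph E_adj E_sym E_V.

Let walkE s : dwalk (eset G) 0 s <-> W s.
Proof.
elim/last_ind: s => [|s a IHs]; first by [].
rewrite -{1}cats1 dwalk_cat IHs /=; split=> [[Ws [[s' [a' [Ws' ee]]] _]]|Ws].
  have /= e := congr1 fst ee; have /= e' := congr1 snd ee.
  have aa : a' = a by apply: vect_inj; move: e'; rewrite e => /addrI.
  (* The edge may be witnessed by another word [s'] with the same end as [s]. At [v n], with n
     beyond both lengths, the two words lead to the same vertex of T_oo. *)
  subst a'; pose n := (size s + size s').+1.
  have := Ws'; rewrite !(@W_rcons n) ?(@WE n) in Ws *; rewrite /n; try lia.
  by rewrite (wend_shift _ s) e -wend_shift => -[_].
split; last by split=> //; exists s, a.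
by move: Ws; rewrite (@W_rcons (size s).+1 s a (ltnSn _)) (@WE (size s).+1) // => -[].
Qed.

Let conn : connected_subgraph G.
Proof.
have c0 u : vset G u -> exists p, walk G 0 u p.
  by move=> [s Ws <-]; exists (positions 0 s); apply/dwalk_walk/walkE.
move=> u w /c0[p /walk_sym[p' wp]] /c0[q wq].
by exists (p' ++ q); exact: walk_cat wp wq.
Qed.

(* A finite limit would contain, up to translation, the whole component of [v n] for
   large [n]. *)
Let inf : infinite_set (vset G).
Proof.
move=> finV.
have ex u : exists s, V u -> W s /\ wend 0 s = u.
  by have [[s Ws e]|nV] := pselect (V u); [exists s|exists [::]].
pose f u := projT1 (cid (ex u)).
have fP u : V u -> W (f u) /\ wend 0 (f u) = u by exact: (projT2 (cid (ex u))).
have [L LP] : exists L, forall u, V u -> (size (f u) <= L)%N.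
  have /finite_seqP[r rE] := finV.
  exists (\max_(u <- r) size (f u))%N => u; rewrite -[V u]/(vset G u) rE /= => ur.
  exact: (@leq_bigmax_seq _ r xpredT (fun u => size (f u))).
have sub s : gwalk (v L.+1) s -> V (wend 0 s).
  elim/last_ind: s => [_|s a IHs]; first by exists [::].
  rewrite /gwalk -cats1 dwalk_cat => -[/IHs /fP[Wt tE] [e _]].
  set t := f _ in Wt tE.
  have tL : (size t <= L)%N by apply: LP; rewrite -tE; exists t.
  exists (rcons t a); last by rewrite -cats1 !wend_cat tE.
  apply/(@W_rcons L.+1) => //; split; first by apply/WE => //; exact: leqW.
  by rewrite (wend_shift _ t) tE -wend_shift.
apply: kenyon_union_inf.
apply: (@sub_finite_set _ _ ((fun u => u + v L.+1) @` V)); last exact: finite_image.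
move=> u Ku; have /kenyon_union_vset p0 := pv L.+1.
have [p /walk_dwalk[s [_ ws <-]]] := kenyon_union_connected p0 Ku.
by exists (wend 0 s); [exact: sub|rewrite -wend_shift].
Qed.

Lemma rooted_limit : exists T : rooted,
  ghys_kenyon_set T /\ forall n, agree n (rwalk T) (gwalk (v n)).
Proof.
have z : vset G 0 by exists [::].
exists (Rooted inf conn z); set T := Rooted _ _ _.
have a n : agree n (rwalk T) (gwalk (v n)).
  by move=> s sn; rewrite -(WE sn); exact: walkE.
by split=> //; apply/ghys_kenyonP => N; exists (v N).
Qed.
End limit.

(** * Coded spaces *)

Lemma nbhs_set_type (X : topologicalType) (A : set X) (x : A) (U : set A) :
  nbhs x U <-> exists2 V, nbhs (val x) V & forall x' : A, V (val x') -> U x'.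
Proof.
split=> [[_ [[V oV <-] Vx] VU]|[V]].
  by exists V; [exact: open_nbhs_nbhs|exact: VU].
rewrite nbhsE => -[W [oW Wx] WV] VU.
by exists (val @^-1` W); split=> //=; [exists W|move=> x' /WV/VU].
Qed.

(** Expresses that E is a homeomorphism of T onto a closed subset of the product of copies of a
    discrete K: the three clauses give the topology, injectivity and closedness of the image. *)
Definition coded (T : topologicalType) (K : Type) (E : T -> nat -> K) :=
  [/\ forall x U, nbhs x U <->
        exists n, forall x', (forall i, (i < n)%N -> E x i = E x' i) -> U x',
      forall x x', (forall i, E x i = E x' i) -> x = x' &
      forall a, (forall n, exists x, forall i, (i < n)%N -> E x i = a i) ->
        exists x, forall i, E x i = a i].

Section coded.
Variables (T : topologicalType) (K : finType) (E : T -> nat -> K).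
Hypothesis cE : coded E.

Lemma coded_cylinder_open n (P : (nat -> K) -> Prop) :
  (forall a b, (forall i, (i < n)%N -> a i = b i) -> P a -> P b) ->
  open [set x | P (E x)].
Proof.
have [nb _ _] := cE => Pn; rewrite openE => x Px; apply/nb; exists n => x' xx'.
exact: Pn xx' Px.
Qed.

Lemma coded_cylinder_clopen n (P : (nat -> K) -> Prop) :
  (forall a b, (forall i, (i < n)%N -> a i = b i) -> P a -> P b) ->
  clopen [set x | P (E x)].
Proof.
move=> Pn; split; first exact: coded_cylinder_open Pn.
rewrite -openC; apply: (@coded_cylinder_open n (fun a => ~ P a)) => a b ab na Pb.
by apply: na; apply: Pn Pb => i iN; rewrite ab.
Qed.

(** K being finite, an ultrafilter selects a value for each letter. Each initial segment of the
    selected sequence is taken on a member of the ultrafilter, so the sequence is realized by a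
    point, which is the limit. *)
Lemma coded_compact : compact [set: T].
Proof.
have [nb inj comp] := cE; rewrite compact_ultra => F UF _.
have ex n : exists k, F [set x | E x n = k].
  have [//|h] := pselect (exists k, F [set x | E x n = k]).
  have H k : F (~` [set x | E x n = k]).
    have [Fk|//] := in_ultra_setVsetC [set x | E x n = k] UF.
    by case: h; exists k.
  have : F (\bigcap_(k in [set k | k \in enum K]) ~` [set x | E x n = k]).
    elim: (enum K) => [|k s IHs].
      by rewrite (_ : [set k | _] = set0) ?bigcap_set0; [exact: filterT|rewrite predeqE].
    by apply: filterS (filterI (H k) IHs) => x [nk h'] k'; rewrite /= inE => /predU1P[->|/h'].
  by move=> /filter_ex[x /(_ (E x n))]; rewrite /= mem_enum => /(_ isT).
pose a n := projT1 (cid (ex n)).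
have aP n : F [set x | E x n = a n] := projT2 (cid (ex n)).
have aN n : F [set x | forall i, (i < n)%N -> E x i = a i].
  elim: n => [|n IHn]; first by apply: filterS filterT => x _ i.
  apply: filterS (filterI IHn (aP n)) => x [h e] i.
  by rewrite ltnS leq_eqVlt => /predU1P[->//|/h].
have [x xa] : exists x, forall i, E x i = a i.
  by apply: comp => n; have /filter_ex[x] := aN n; exists x.
exists x; split=> // U /nb[n nU]; apply: filterS (aN n) => x' x'a.
by apply: nU => i iN; rewrite xa x'a.
Qed.

Lemma coded_separated x y : x != y -> exists U : set T, [/\ clopen U, U x & ~ U y].
Proof.
have [_ inj _] := cE => xy.
have [i xyi] : exists i, E x i <> E y i.
  by apply/existsNP => h; move: xy; rewrite (inj _ _ h) eqxx.
exists [set z | E z i = E x i]; split=> //=; last by move=> /esym.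
apply: (@coded_cylinder_clopen i.+1 (fun a => a i = E x i)) => a b ab <-.
by rewrite ab.
Qed.

Lemma coded_zero_dimensional : zero_dimensional T.
Proof. exact: coded_separated. Qed.

Lemma coded_hausdorff : hausdorff_space T.
Proof.
move=> x y cl; apply: contrapT => /eqP /coded_separated[U [[oU cU] Ux Uy]].
have nU : nbhs x U by apply: open_nbhs_nbhs.
have nC : nbhs y (~` U) by apply: open_nbhs_nbhs; split=> //; rewrite openC.
by have [z []] := cl _ _ nU nC.
Qed.

Lemma coded_continuous (T' : topologicalType) (K' : Type) (E' : T' -> nat -> K') (f : T -> T') :
  coded E' ->
  (forall x n, exists m, forall x', (forall i, (i < m)%N -> E x i = E x' i) ->
    E' (f x) n = E' (f x') n) -> continuous f.
Proof.
move=> [nb' _ _] h x U /nb'[n nU]; have [nb _ _] := cE.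
have [m mP] : exists m, forall x', (forall i, (i < m)%N -> E x i = E x' i) ->
    forall i, (i < n)%N -> E' (f x) i = E' (f x') i.
  elim: n {nU} => [|n [m IHm]]; first by exists 0%N.
  have [m' m'P] := h x n; exists (maxn m m') => x' xx' i.
  rewrite ltnS leq_eqVlt => /predU1P[->|iN].
    by apply: m'P => j jm; apply: xx'; rewrite leq_max jm orbT.
  by apply: IHm => // j jm; apply: xx'; rewrite leq_max jm.
by apply/nb; exists m => x' xx'; apply: nU; exact: mP.
Qed.

Lemma coded_subset n (P : (nat -> K) -> Prop) (A : set T) :
  (forall a b, (forall i, (i < n)%N -> a i = b i) -> P a -> P b) ->
  (forall x, A x <-> P (E x)) -> coded (fun x : A => E (val x)).
Proof.
have [nb inj comp] := cE => Pn AP; split.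
- move=> x U; rewrite nbhs_set_type; split=> [[V /nb[m mV] VU]|[m mU]].
    by exists m => x' xx'; apply: VU; exact: mV.
  exists [set z | forall i, (i < m)%N -> E (val x) i = E z i].
    by apply/nb; exists m.
  exact: mU.
- by move=> x x' e; apply: val_inj; exact: inj.
- move=> a h; have [|x xa] := comp a.
    by move=> m; have [x xa] := h m; exists (val x).
  have Ax : A x.
    apply/AP; have [z za] := h n; have /AP Pz := set_mem (valP z).
    by apply: Pn Pz => i iN; rewrite xa za.
  by exists (exist _ x (mem_set Ax)).
Qed.
End coded.

(** * Coding of X by parities and addresses *)

Definition east : direction := (true, true).

(** Addresses are meant for odd vertices. A present even vertex has all four neighbours and borrows
    the address of the eastern one, an arbitrary choice; the parity bit of [vaddress] keeps the two
    apart. *)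
Definition base (v : vertex) : vertex := if odd_vertex v then v else v + vect east.

Definition vaddress (v : vertex) (n : nat) : bool * (direction * bool) :=
  (odd_vertex v, address (base v) n).

Lemma odd_base v : odd_vertex (base v).
Proof. by rewrite /base; case: ifP => //; case: v => x y; rewrite /odd_vertex /=; lia. Qed.

Lemma agree_base N v v' : present v -> present v' ->
  agree N.+1 (gwalk v) (gwalk v') -> agree N (gwalk (base v)) (gwalk (base v')).
Proof.
move=> pv pv' a; have o := agree_odd pv pv' (agree_mono (ltn0Sn N) a).
rewrite /base -o; case: ifP => ov; first exact: agree_mono a.
by apply: (agree_recenter (s := [:: east]) a); apply: gwalk_even; rewrite ?ov.
Qed.

Lemma base_agree N v v' : present v -> present v' -> odd_vertex v = odd_vertex v' ->
  agree N.+1 (gwalk (base v)) (gwalk (base v')) -> agree N (gwalk v) (gwalk v').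
Proof.
move=> pv pv' o; rewrite /base -o; case: ifP => ov a; first exact: agree_mono a.
have := agree_recenter (s := [:: opposite east]) a.
rewrite !wend1 vect_opposite !addrK; apply.
rewrite -/gwalk gwalk_cons vect_opposite addrK.
by have /gwalk_cons[_ [pe _]] := gwalk_even east pv (negbT ov).
Qed.

Lemma vaddress_agree n v v' : present v -> present v' ->
  (forall i, (i <= n)%N -> vaddress v i = vaddress v' i) -> agree (2 ^ n) (gwalk v) (gwalk v').
Proof.
move=> pv pv' e; apply: base_agree => //; first by have [] := e 0%N isT.
apply: address_agree; [exact: odd_base|exact: odd_base|move=> i iN].
by have /(congr1 snd) := e i iN.
Qed.

Lemma agree_vaddress n v v' : present v -> present v' ->
  agree (address_radius n).+1 (gwalk v) (gwalk v') ->
  forall i, (i <= n)%N -> vaddress v i = vaddress v' i.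
Proof.
move=> pv pv' a i iN; congr pair; first exact: agree_odd (agree_mono (ltn0Sn _) a).
by apply: (agree_address (odd_base v) (odd_base v') (agree_base pv pv' a)).
Qed.

Lemma address_radius_mono m n : (m <= n)%N -> (address_radius m <= address_radius n)%N.
Proof.
elim: n => [|n IHn]; first by rewrite leqn0 => /eqP->.
by rewrite leq_eqVlt => /predU1P[->//|/IHn h] /=; lia.
Qed.

Notation GK := (set_type ghys_kenyon_set).

Lemma approx (T : GK) N : exists v, present v /\ agree N (rwalk (val T)) (gwalk v).
Proof. by have /ghys_kenyonP/(_ N)[v] := set_mem (valP T); exists v. Qed.

(** The letter is read at some vertex of T_oo whose ball agrees with that of T far enough; by [keyE]
    the choice of this vertex is immaterial. *)
Definition key (T : GK) (n : nat) : bool * (direction * bool) :=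
  vaddress (projT1 (cid (approx T (address_radius n).+1))) n.

Lemma keyE (T : GK) n v : present v ->
  agree (address_radius n).+1 (rwalk (val T)) (gwalk v) ->
  forall i, (i <= n)%N -> key T i = vaddress v i.
Proof.
move=> pv a i iN; rewrite /key; case: cid => w [pw b] /=.
apply: (@agree_vaddress i) => //; apply: agree_trans (agree_sym b) _.
by apply: agree_mono a; rewrite ltnS; exact: address_radius_mono.
Qed.

Lemma key_agree (T : GK) n v : present v ->
  (forall i, (i <= n)%N -> key T i = vaddress v i) -> agree (2 ^ n) (rwalk (val T)) (gwalk v).
Proof.
move=> pv e; have [w [pw a]] := approx T (maxn (address_radius n).+1 (2 ^ n)).
apply: agree_trans (agree_mono (leq_maxr _ _) a) _.
apply: vaddress_agree => // i iN; rewrite -e //; apply/esym.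
exact: keyE (agree_mono (leq_maxl _ _) a) _ iN.
Qed.

Lemma key_agree2 (T T' : GK) n : (forall i, (i <= n)%N -> key T i = key T' i) ->
  agree (2 ^ n) (rwalk (val T)) (rwalk (val T')).
Proof.
move=> e; have [v [pv a]] := approx T' (address_radius n).+1.
have h i (iN : (i <= n)%N) := keyE pv a iN.
apply: agree_trans (agree_sym (key_agree pv h)).
by apply: key_agree => // i iN; rewrite e // h.
Qed.

Lemma agree_key (T T' : GK) n : agree (address_radius n).+1 (rwalk (val T)) (rwalk (val T')) ->
  forall i, (i <= n)%N -> key T i = key T' i.
Proof.
move=> a; have [v [pv b]] := approx T' (address_radius n).+1.
by move=> i iN; rewrite (keyE pv (agree_trans a b)) // (keyE pv b).
Qed.

Lemma key_limit a : (forall n, exists2 v, present v & forall i, (i <= n)%N -> vaddress v i = a i) ->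
  exists T : GK, forall i, key T i = a i.
Proof.
move=> h; have ex n : exists v, present v /\ forall i, (i <= n)%N -> vaddress v i = a i.
  by have [v] := h n; exists v.
pose v n := projT1 (cid (ex n)).
have vP n : present (v n) /\ forall i, (i <= n)%N -> vaddress (v n) i = a i.
  exact: projT2 (cid (ex n)).
have [||T [TX TP]] := @rooted_limit v; first by move=> n; case: (vP n).
  move=> m n mn; apply: agree_mono (ltnW (ltn_expl m (ltnSn 1))) _.
  apply: vaddress_agree; [by case: (vP m)|by case: (vP n)|move=> i im].
  by rewrite (vP m).2 // (vP n).2 // (leq_trans im).
exists (exist _ T (mem_set TX)) => i.
pose r := maxn i (address_radius i).+1.
rewrite (@keyE _ i (v r) (vP r).1 _ i) //; first by rewrite (vP r).2 // leq_maxl.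
by apply: agree_mono (TP r); exact: leq_maxr.
Qed.

Lemma coded_key : coded key.
Proof.
split.
- move=> T U; rewrite nbhs_set_type; split=> [[V /nbhs_rooted[N NV] VU]|[n nU]].
    exists N.+1 => T' e; apply: VU; apply: NV.
    by apply: agree_mono (key_agree2 e); apply: ltnW; exact: ltn_expl.
  exists [set S | agree (address_radius n).+1 (rwalk (val T)) (rwalk S)].
    by apply/nbhs_rooted; exists (address_radius n).+1.
  by move=> T' a; apply: nU => i /ltnW; exact: agree_key.
- move=> T T' e; apply: val_inj; apply: rooted_ext => N.
  apply: agree_mono (@key_agree2 T T' N _) => //; apply: ltnW; exact: ltn_expl.
- move=> a h; apply: key_limit => n; have [T Ta] := h n.+1.
  have [v [pv av]] := approx T (address_radius n).+1.
  by exists v => // i iN; rewrite -(keyE pv av) // Ta.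
Qed.

Lemma key_odd (T : GK) n : (key T n).1 = (key T 0).1.
Proof.
have [v [pv a]] := approx T (address_radius n).+1.
by rewrite !(keyE pv a).
Qed.

Lemma key_rule (T : GK) : address_rule (fun n => (key T n).2).
Proof.
move=> n; have [v [pv a]] := approx T (address_radius n.+1).+1.
by rewrite !(keyE pv a) //; exact: address_ruleP (odd_base v) n.
Qed.

Lemma key_surj y : address_rule y -> exists T : GK, forall n, key T n = (true, y n).
Proof.
move=> ry; apply: (@key_limit (fun n => (true, y n))) => n.
have [u ou uE] := address_realized n ry.
exists u; first exact: present_odd.
by move=> i iN; rewrite /vaddress /base ou uE.
Qed.

(** * Translation classes as tail classes of addresses *)

Definition straight (n : nat) (y : nat -> direction * bool) :=
  forall i, (n <= i)%N -> y i = ((y n).1, true).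

Definition cofinal (n : nat) (y y' : nat -> direction * bool) :=
  (forall i, (n <= i)%N -> y i = y' i) \/ (straight n y /\ straight n y').

Definition tail_equivalent (y y' : nat -> direction * bool) := exists n, cofinal n y y'.

Lemma straight_mono m n y : (m <= n)%N -> straight m y -> straight n y.
Proof. by move=> mn h i ni; rewrite (h i (leq_trans mn ni)) (h n mn). Qed.

Lemma straight_tail n y y' : (forall i, (n <= i)%N -> y i = y' i) ->
  straight n y -> straight n y'.
Proof. by move=> e h i ni; rewrite -!e // h. Qed.

Lemma cofinal_mono m n y y' : (m <= n)%N -> cofinal m y y' -> cofinal n y y'.
Proof.
move=> mn [h|[h h']]; [left=> i ni|right; split; exact: straight_mono mn _].
exact: h (leq_trans mn ni).
Qed.

Lemma cofinal_refl n y : cofinal n y y. Proof. by left. Qed.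

Lemma cofinal_sym n y y' : cofinal n y y' -> cofinal n y' y.
Proof. by move=> [h|[h h']]; [left=> i ni; rewrite h|right]. Qed.

Lemma cofinal_trans n y1 y2 y3 : cofinal n y1 y2 -> cofinal n y2 y3 -> cofinal n y1 y3.
Proof.
move=> [h|[h1 h2]] [h'|[h2' h3]].
- by left=> i ni; rewrite h // h'.
- right; split=> //; apply: straight_tail h2' => i ni; by rewrite h.
- by right; split=> //; exact: straight_tail h' h2.
- by right.
Qed.

Lemma tail_equivalent_refl y : tail_equivalent y y.
Proof. by exists 0%N; exact: cofinal_refl. Qed.

Lemma tail_equivalent_sym y y' : tail_equivalent y y' -> tail_equivalent y' y.
Proof. by move=> [n /cofinal_sym]; exists n. Qed.

Lemma tail_equivalent_trans y1 y2 y3 :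
  tail_equivalent y1 y2 -> tail_equivalent y2 y3 -> tail_equivalent y1 y3.
Proof.
move=> [m c] [n c']; exists (maxn m n).
by apply: cofinal_trans (cofinal_mono (leq_maxl m n) c) (cofinal_mono (leq_maxr m n) c').
Qed.

Definition addr (T : GK) (n : nat) : direction * bool := (key T n).2.

Definition rooted_odd (T : GK) : bool := (key T 0).1.

Lemma addrE (T : GK) n v : present v ->
  agree (address_radius n).+1 (rwalk (val T)) (gwalk v) ->
  forall i, (i <= n)%N -> addr T i = address (base v) i.
Proof. by move=> pv a i iN; rewrite /addr (keyE pv a). Qed.

Lemma rooted_oddE (T : GK) v : present v ->
  agree 4 (rwalk (val T)) (gwalk v) -> rooted_odd T = odd_vertex v.
Proof. by move=> pv a; rewrite /rooted_odd (@keyE T 0 v pv a). Qed.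

Lemma key_inj (T T' : GK) : rooted_odd T = rooted_odd T' ->
  (forall i, addr T i = addr T' i) -> T = T'.
Proof.
move=> o e; have [_ inj _] := coded_key; apply: inj => i.
by rewrite [LHS]surjective_pairing [RHS]surjective_pairing !(key_odd _ i)
  -/(rooted_odd T) -/(rooted_odd T') o -/(addr T i) -/(addr T' i) e.
Qed.

Section reroot_gk.
Variables (T : GK) (s : seq direction) (Ts : rwalk (val T) s).

Let Tv : vset (val T) (wend 0 s).
Proof. by apply/vset_rwalk; exists s. Qed.

Let TX : ghys_kenyon_set (reroot Tv).
Proof.
apply: (ghys_kenyon_rel_closed (T := val T)); last exact: translation_rel_reroot.
exact: set_mem (valP T).
Qed.

Definition gk_reroot : GK := exist _ (reroot Tv) (mem_set TX).

Lemma gk_reroot_rel : translation_rel (val T, val gk_reroot).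
Proof. exact: translation_rel_reroot. Qed.

Lemma dwalk_gk_reroot u t :
  dwalk (eset (val gk_reroot)) u t <-> dwalk (eset (val T)) (u + wend 0 s) t.
Proof. by rewrite dwalk_translate opprK. Qed.

Lemma agree_gk_reroot N v : agree (size s + N) (rwalk (val T)) (gwalk v) ->
  agree N (rwalk (val gk_reroot)) (gwalk (wend v s)).
Proof.
move=> a; apply: agree_trans (agree_recenter a Ts) => t _.
exact: rwalk_reroot.
Qed.
End reroot_gk.

Lemma reroot_gkP (T T' : GK) : translation_rel (val T, val T') ->
  exists s (Ts : rwalk (val T) s), T' = gk_reroot Ts.
Proof.
move=> /translation_relP[w [Tw e]]; have [s Ts sw] := (vset_rwalk (val T) w).1 Tw.
exists s, Ts; apply: val_inj; rewrite e /=; apply: rooted_ext => N t _.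
by rewrite !rwalk_reroot sw.
Qed.

(** [addr T] comes from the eastern neighbour of the even root, [addr T'] from the neighbour in
    direction a. By [address_even], once either address departs from its constant straight value the
    tails agree; if neither does, both are straight. *)
Lemma even_step (T T' : GK) a : ~~ rooted_odd T ->
  (forall N v, present v -> agree N.+1 (rwalk (val T)) (gwalk v) ->
    agree N (rwalk (val T')) (gwalk (v + vect a))) ->
  tail_equivalent (addr T) (addr T').
Proof.
move=> eT TT'.
have E n : exists v, [/\ present v, ~~ odd_vertex v,
    forall i, (i <= n)%N -> addr T i = address (v + vect east) i &
    forall i, (i <= n)%N -> addr T' i = address (v + vect a) i].
  have [v [pv av]] := approx T (address_radius n).+2.
  have r3 : (3 <= address_radius n)%N by apply: leq_trans (address_radius_mono (leq0n n)).
  have ev : ~~ odd_vertex v.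
    by rewrite -(@rooted_oddE T v pv) //; apply: agree_mono av; lia.
  exists v; split=> // i iN.
    by rewrite (@addrE T n v) // ?/base ?(negbTE ev) //; apply: agree_mono av.
  have ov : odd_vertex (v + vect a).
    by case: v a ev {pv av TT'} => x y [[] []]; rewrite /odd_vertex /=; lia.
  rewrite (@addrE T' n (v + vect a)) // ?/base ?ov //; first exact: present_odd.
  exact: TT'.
have key i0 (b c : direction) (S S' : GK) :
    (forall n, exists v, [/\ present v, ~~ odd_vertex v,
      forall i, (i <= n)%N -> addr S i = address (v + vect b) i &
      forall i, (i <= n)%N -> addr S' i = address (v + vect c) i]) ->
    addr S i0 <> (opposite b, true) -> tail_equivalent (addr S) (addr S').
  move=> ES nS; exists i0.+1; left=> i ii0.
  have [v [pv ev vS vS']] := ES i.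
  rewrite vS // vS' //; have [[j ji h]|h] := address_even i0 pv ev.
    by apply: h; exact: leq_ltn_trans ji ii0.
  by case: nS; rewrite vS ?h // ltnW.
have [[i0 n0]|] := pselect (exists i0, addr T i0 <> (opposite east, true)).
  exact: key n0.
move=> /forallNP hT.
have [[i0 n0]|] := pselect (exists i0, addr T' i0 <> (opposite a, true)).
  apply/tail_equivalent_sym; apply: (key i0 a east T' T) => // n.
  by have [v [pv ev vS vS']] := E n; exists v; split.
move=> /forallNP hT'; exists 0%N; right.
have h1 i : addr T i = (opposite east, true) by exact: contrapT (hT i).
have h2 i : addr T' i = (opposite a, true) by exact: contrapT (hT' i).
by split=> i _; rewrite ?h1 ?h2.
Qed.

(** One end of every edge is even. If the root of T is odd, then that of T' is even and the opposite
    step recovers T from T', so that [even_step] applies in the other direction. *)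
Lemma step_equivalent (T T' : GK) a (Ta : rwalk (val T) [:: a]) :
  T' = gk_reroot Ta -> tail_equivalent (addr T) (addr T').
Proof.
move=> T'E.
have A N v : agree N.+1 (rwalk (val T)) (gwalk v) ->
    agree N (rwalk (val T')) (gwalk (v + vect a)).
  by move=> av; rewrite T'E; exact: (@agree_gk_reroot _ _ Ta N v av).
have [oT|eT] := boolP (rooted_odd T); last by apply: (even_step (a := a)) => // N v _; exact: A.
have B : rwalk (val T') [:: opposite a].
  have [v [pv av]] := approx T 2.
  have av' := A _ _ av; apply/av' => //.
  have /av h : (size [:: a] <= 2)%N by [].
  have /h := Ta.
  rewrite !gwalk_cons vect_opposite addrK => -[_ [p _]]; split=> //; split=> //.
have TE : T = gk_reroot B.
  apply: val_inj; rewrite /=; apply: rooted_ext => N t tN.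
  have [v [pv av]] := approx T N.+2.
  have b : agree N.+1 (rwalk (val T')) (gwalk (v + vect a)) by exact: A.
  have e : wend (v + vect a) [:: opposite a] = v by rewrite wend1 vect_opposite addrK.
  have := agree_gk_reroot B b; rewrite e => c.
  rewrite -[reroot _]/(val (gk_reroot B)) (c t tN); apply: av.
  by apply: leq_trans tN _; rewrite ltnW // ltnW.
have eT' : ~~ rooted_odd T'.
  have [v [pv av]] := approx T 5.
  have av' : agree 4 (rwalk (val T')) (gwalk (v + vect a)) by exact: A.
  have ov : odd_vertex v.
    by rewrite -(@rooted_oddE T v pv) //; exact: agree_mono av.
  have /gwalk_cons[_ [p _]] : gwalk v [:: a] by apply/av.
  rewrite (@rooted_oddE T' (v + vect a)) //.
  by case: v a ov {pv av av' p A Ta T'E B TE} => x y [[] []]; rewrite /odd_vertex /=; lia.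
apply/tail_equivalent_sym; apply: (even_step (a := opposite a)) => // N v _ av.
by rewrite TE; exact: (@agree_gk_reroot _ _ B N v av).
Qed.

Lemma rel_tail_equivalent (T T' : GK) :
  translation_rel (val T, val T') -> tail_equivalent (addr T) (addr T').
Proof.
move=> /reroot_gkP[s [Ts ->]].
elim/last_ind: s Ts => [|s a IHs] Ts.
  suff -> : gk_reroot Ts = T by exact: tail_equivalent_refl.
  apply: val_inj; apply: rooted_ext => N t _.
  by rewrite /rwalk dwalk_gk_reroot add0r.
have Ts' : rwalk (val T) s.
  by move: Ts; rewrite /rwalk -cats1 dwalk_cat => -[].
apply: tail_equivalent_trans (IHs Ts') _.
have Ta : rwalk (val (gk_reroot Ts')) [:: a].
  by apply/rwalk_reroot; move: Ts; rewrite /rwalk -cats1 dwalk_cat => -[].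
apply: (step_equivalent (Ta := Ta)); apply: val_inj; apply: rooted_ext => N t _.
rewrite /rwalk !dwalk_gk_reroot !add0r.
by rewrite -cats1 wend_cat !wend1 add0r addrC.
Qed.

Lemma rel_odd (T : GK) : exists T' : GK,
  [/\ translation_rel (val T, val T'), rooted_odd T' & forall i, addr T' i = addr T i].
Proof.
have [oT|eT] := boolP (rooted_odd T).
  by exists T; split=> //; exact: translation_rel_refl.
have Te : rwalk (val T) [:: east].
  have [v [pv av]] := approx T 4.
  by apply/av => //; apply: gwalk_even => //; rewrite -(rooted_oddE pv av).
have A n : exists v, [/\ present v, ~~ odd_vertex v,
    agree (address_radius n).+1 (rwalk (val T)) (gwalk v) &
    agree (address_radius n).+1 (rwalk (val (gk_reroot Te))) (gwalk (v + vect east))].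
  have [v [pv av]] := approx T (address_radius n).+2.
  exists v; split=> //; [|exact: agree_mono av|exact: (@agree_gk_reroot _ _ Te _ v av)].
  rewrite -(@rooted_oddE T v pv) //; apply: agree_mono av.
  by have := address_radius_mono (leq0n n); rewrite /=; lia.
have ob v : ~~ odd_vertex v -> odd_vertex (v + vect east).
  by case: v => x y; rewrite /odd_vertex /=; lia.
exists (gk_reroot Te); split; first exact: gk_reroot_rel.
  have [v [pv ev a a']] := A 0%N.
  by rewrite (@rooted_oddE _ (v + vect east)) //; [exact: ob|apply: present_odd; exact: ob].
move=> i; have [v [pv ev a a']] := A i.
rewrite (addrE _ a') ?(addrE pv a) //; last by apply: present_odd; exact: ob.
by rewrite /base ob // (negbTE ev).
Qed.

Lemma agree_iter_twice n M u u' : present u -> present u' ->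
  agree M (gwalk u) (gwalk u') -> agree M (gwalk (iter n twice u)) (gwalk (iter n twice u')).
Proof.
move=> pu pu' a; have P v : present v -> present (iter n twice v).
  by move=> pv; elim: n => //= n; exact: present_twice.
elim: n {P} => //= n IHn; apply: agree_mono (agree_twice _ _ IHn).
- by rewrite -addnn leq_addr.
- by elim: n {IHn} => //= n; exact: present_twice.
- by elim: n {IHn} => //= n; exact: present_twice.
Qed.

(** In approximating vertices, the n-th ancestors have addresses that agree on long initial
    segments, so their surroundings agree, and so do those of their multiples by 2^n. Rerooting T
    and T' at these centres, which [center_walk] reaches, yields the same tree. *)
Lemma tail_rel (T T' : GK) n : rooted_odd T -> rooted_odd T' ->
  (forall i, (n <= i)%N -> addr T i = addr T' i) -> translation_rel (val T, val T').
Proof.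
move=> oT oT' e.
pose w (S : GK) := center_walk (fun i => (addr S i).1) n.
have A (S : GK) (oS : rooted_odd S) N m : exists v, [/\ odd_vertex v,
    agree N (rwalk (val S)) (gwalk v),
    forall i, (i <= m)%N -> addr S i = address v i &
    w S = center_walk (leads v) n].
  have [v [pv av]] := approx S (maxn N (address_radius (maxn m n)).+1).
  have av' := agree_mono (leq_maxr _ _) av.
  have ov : odd_vertex v.
    rewrite -(@rooted_oddE S v pv) //; apply: agree_mono av'.
    by have := address_radius_mono (leq0n (maxn m n)); rewrite /=; lia.
  have aE i (h : (i <= maxn m n)%N) : addr S i = address v i.
    by rewrite (addrE pv av') // /base ov.
  exists v; split=> //; first exact: agree_mono (leq_maxl _ _) av.
    by move=> i im; apply: aE; rewrite leq_max im.
  by apply: eq_center_walk => i iN; rewrite aE // leq_max (ltnW iN) orbT.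
have W (S : GK) (oS : rooted_odd S) : rwalk (val S) (w S).
  have [v [ov av _ wE]] := A S oS (size (w S)) 0%N.
  by apply/av => //; rewrite wE; exact: (center_walkP n ov).1.
apply: translation_rel_trans (gk_reroot_rel (W T oT)) _.
apply: translation_rel_sym; rewrite -/translation_rel.
suff <- : gk_reroot (W T' oT') = gk_reroot (W T oT) by exact: gk_reroot_rel.
apply: val_inj; apply: rooted_ext => N.
have [v [ov av vE wE]] := A T oT (size (w T) + N)%N (n + N)%N.
have [v' [ov' av' vE' wE']] := A T' oT' (size (w T') + N)%N (n + N)%N.
apply: agree_trans (agree_gk_reroot (W T' oT') av') _.
apply: agree_sym; apply: agree_trans (agree_gk_reroot (W T oT) av) _.
rewrite wE wE' !(center_walkP n _).2 //.
have p1 := odd_iter_parent n ov; have p1' := odd_iter_parent n ov'.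
apply: agree_iter_twice; [exact: present_odd..|].
apply: agree_mono (@address_agree N _ _ p1 p1' _).
  by apply: ltnW; apply: ltnW; rewrite ltnS; exact: ltn_expl.
move=> i iN; have S u : address (iter n parent u) i = address u (n + i).
  by rewrite /address -!iterD addnC.
by rewrite !S -vE -?vE' ?leq_add2l // e // leq_addr.
Qed.

(** A straight tail is the address of a neighbour of 0; prepending the first n leads gives an actual
    vertex of T_oo. *)
Lemma straight_address n y : address_rule y -> straight n y ->
  exists2 u, odd_vertex u & forall i, address u i = y i.
Proof.
elim: n y => [|n IHn] y ry sy.
  exists (vect (opposite (y 0%N).1)); first exact: odd_vect.
  by move=> i; rewrite address_vect oppositeK (sy i).
have [||u ou uE] := IHn (fun i => y i.+1).
- by move=> i; exact: ry.
- by move=> i ni; rewrite (sy i.+1).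
exists (prepend (y 0%N).1 u); first exact: odd_prepend.
move=> [|i]; last by rewrite address_prepend.
by apply: (address_prepend0 (y := y)) => // i _; exact: uE.
Qed.

Lemma straight_rel (T : GK) n : rooted_odd T -> straight n (addr T) ->
  translation_rel (kenyon_tree, val T).
Proof.
move=> oT sT; have [u ou uE] := straight_address (key_rule T) sT.
have Ku : vset kenyon_tree u by apply/kenyon_union_vset; exact: present_odd.
suff <- : reroot Ku = val T by exact: translation_rel_reroot.
apply: rooted_ext => N; apply: (@agree_trans _ _ (gwalk u)).
  by move=> s _; rewrite rwalk_reroot.
apply: agree_sym; apply: agree_mono (@key_agree T N u (present_odd ou) _).
  by apply: ltnW; exact: ltn_expl.
move=> i _; rewrite /vaddress ou /base ou uE [LHS]surjective_pairing key_odd.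
by rewrite -/(rooted_odd T) oT.
Qed.

Theorem translation_rel_tail (T T' : GK) :
  translation_rel (val T, val T') <-> tail_equivalent (addr T) (addr T').
Proof.
split; first exact: rel_tail_equivalent.
have [S [TS oS eS]] := rel_odd T; have [S' [TS' oS' eS']] := rel_odd T'.
move=> c; apply: translation_rel_trans TS _.
apply: translation_rel_sym; apply: translation_rel_trans TS' _.
apply: translation_rel_sym; move: c; rewrite -(funext eS) -(funext eS') => -[n [h|[h h']]].
  exact: (tail_rel oS oS' h).
exact: translation_rel_trans (translation_rel_sym (straight_rel oS h)) (straight_rel oS' h').
Qed.

(** * Increasing unions of compact relations *)

(** Says that every Q n is open in G and receives from G the topology of a subspace of X x X. The
    constant sequence covers a single compact relation, so one proof serves for the levels and for
    their union. *)
Definition box_nbhs (X G : topologicalType) (p : G -> X * X) (Q : nat -> set (X * X)) :=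
  forall n g, Q n (p g) -> forall U, nbhs g U <-> exists A B,
    [/\ nbhs (p g).1 A, nbhs (p g).2 B &
        forall g', Q n (p g') -> A (p g').1 -> B (p g').2 -> U g'].

Section groupoid.
Variables (X G : topologicalType) (p : G -> X * X) (Q : nat -> set (X * X)).
Hypothesis compactX : compact [set: X].
Hypothesis hausdorffX : hausdorff_space X.
Hypothesis Q_equiv : forall n, is_equivalence (Q n).
Hypothesis Q_mono : forall n, Q n `<=` Q n.+1.
Hypothesis Q_closed : forall n, closed (Q n).
Hypothesis Q_diagonal : forall n (x : X), exists2 A : set X, nbhs x A &
  forall a b, A a -> A b -> Q n (a, b) -> a = b.
Hypothesis p_inj : injective p.
Hypothesis p_range : range p = \bigcup_n Q n.
Hypothesis p_nbhs : box_nbhs p Q.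

Let Q_le m n : (m <= n)%N -> Q m `<=` Q n.
Proof.
move=> /subnK <-; elim: (n - m)%N => [//|k IHk] x /IHk.
by rewrite addSn; exact: Q_mono.
Qed.

Let p_ex n xy : Q n xy -> exists g, p g = xy.
Proof.
move=> Qxy; have : (\bigcup_n Q n) xy by exists n.
by rewrite -p_range => -[g _ <-]; exists g.
Qed.

Let p_Q g : exists n, Q n (p g).
Proof.
have : (range p) (p g) by exists g.
by rewrite p_range => -[n _ h]; exists n.
Qed.

Lemma groupoid_source : continuous (fun g => (p g).1).
Proof.
move=> g A nA; have [n Qg] := p_Q g; apply/(p_nbhs Qg).
by exists A, setT; split=> //; exact: filterT.
Qed.

Lemma groupoid_range : continuous (fun g => (p g).2).
Proof.
move=> g A nA; have [n Qg] := p_Q g; apply/(p_nbhs Qg).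
by exists setT, A; split=> //; exact: filterT.
Qed.

Lemma groupoid_hausdorff : hausdorff_space G.
Proof.
move=> g g' cl; apply: p_inj; apply: injective_projections.
  apply: hausdorffX => A B nA nB.
  by have [h [hA hB]] := cl _ _ (groupoid_source nA) (groupoid_source nB); exists (p h).1.
apply: hausdorffX => A B nA nB.
by have [h [hA hB]] := cl _ _ (groupoid_range nA) (groupoid_range nB); exists (p h).2.
Qed.

Lemma groupoid_compact n : compact [set g | Q n (p g)].
Proof.
have cQ : compact (Q n).
  apply: (@subclosed_compact _ _ setT) => //.
  by rewrite -setXTT; exact: compact_setX.
move=> F PF FQ; have [|xy [Qxy cl]] := cQ (p @ F) _.
  by apply: filterS FQ.
have [g pg] := p_ex Qxy; exists g; split; first by rewrite /= pg.
move=> S U FS; have Qg : Q n (p g) by rewrite pg.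
move=> /(p_nbhs Qg)[A [B [nA nB AB]]].
have F1 : F (p @^-1` (p @` (S `&` [set g | Q n (p g)]))).
  by apply: filterS (filterI FS FQ) => h Sh; exists h.
have nAB : nbhs xy (A `*` B) by rewrite -pg; exists (A, B).
have [] := cl _ _ F1 nAB.
by move=> _ [[h [Sh Qh] <-] [Ah Bh]]; exists h; split=> //; exact: AB.
Qed.

Lemma groupoid_locally_compact : locally_compact [set: G].
Proof.
move=> g _; have [n Qg] := p_Q g; exists [set h | Q n (p h)].
  apply: (@filterS _ _ _ [set h | Q n (p h)]); first by [].
  by apply/(p_nbhs Qg); exists setT, setT; split=> //; exact: filterT.
split; first exact: groupoid_compact.
exact: compact_closed groupoid_hausdorff (@groupoid_compact n).
Qed.

Lemma groupoid_diagonal : open (diagonal p).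
Proof.
rewrite openE => g dg; have Qg : Q 0 (p g).
  by case: (Q_equiv 0) => r _ _; rewrite [p g]surjective_pairing -[(p g).2]dg.
have [A nA Ad] := Q_diagonal 0 (p g).1.
apply/(p_nbhs Qg); exists A, A; split=> //; first by rewrite -[(p g).2]dg.
by move=> g' Qg' A1 A2; apply: Ad => //; rewrite -surjective_pairing.
Qed.

Lemma groupoid_relation : topological_relation p (\bigcup_n Q n).
Proof.
split=> //.
- split.
  + by move=> x; exists 0%N => //; case: (Q_equiv 0).
  + by move=> x y [n _ Qxy]; exists n => //; case: (Q_equiv n) => _ s _; exact: s.
  + move=> x y z [m _ Qxy] [n _ Qyz]; exists (maxn m n) => //.
    case: (Q_equiv (maxn m n)) => _ _ t; apply: t (Q_le (leq_maxl m n) Qxy) _.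
    exact: Q_le (leq_maxr m n) _ Qyz.
- exact: groupoid_locally_compact.
- exact: groupoid_hausdorff.
- exact: groupoid_source.
- exact: groupoid_range.
- have Q0 x : Q 0 (x, x) by case: (Q_equiv 0).
  have ex x := p_ex (Q0 x).
  pose e x := projT1 (cid (ex x)); have eP x : p (e x) = (x, x) := projT2 (cid (ex x)).
  exists e => // x U; have Qe : Q 0 (p (e x)) by rewrite eP.
  move=> /(p_nbhs Qe)[A [B]]; rewrite eP /= => -[nA nB AB].
  by apply: filterS (filterI nA nB) => x' [Ax' Bx']; apply: AB; rewrite eP.
- have ex g : exists g', p g' = ((p g).2, (p g).1).
    have [n Qg] := p_Q g; apply: (@p_ex n); case: (Q_equiv n) => _ s _.
    by apply: s; rewrite -surjective_pairing.
  pose i g := projT1 (cid (ex g)).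
  have iP g : p (i g) = ((p g).2, (p g).1) := projT2 (cid (ex g)).
  have ic : continuous i.
    move=> g U; have [n Qg] := p_Q g.
    have s a b : Q n (a, b) -> Q n (b, a) by case: (Q_equiv n) => _ s _; exact: s.
    have Qi : Q n (p (i g)) by rewrite iP; apply: s; rewrite -surjective_pairing.
    move=> /(p_nbhs Qi)[A [B]]; rewrite iP /= => -[nA nB AB].
    apply/(p_nbhs Qg); exists B, A; split=> // g' Qg' Bg' Ag'; apply: AB; rewrite iP //.
    by apply: s; rewrite -surjective_pairing.
  have ii : cancel i i by move=> g; apply: p_inj; rewrite !iP /= -surjective_pairing.
  by exists i => //; split=> //; exists i.
- have ex (gg : composable p) : exists g', p g' = ((p (val gg).1).1, (p (val gg).2).2).
    have [m Qm] := p_Q (val gg).1; have [n Qn] := p_Q (val gg).2.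
    have c : (p (val gg).1).2 = (p (val gg).2).1 := set_mem (valP gg).
    apply: (@p_ex (maxn m n)); case: (Q_equiv (maxn m n)) => _ _ t.
    apply: (t _ (p (val gg).1).2).
      by rewrite -surjective_pairing; apply: Q_le Qm; exact: leq_maxl.
    by rewrite c -surjective_pairing; apply: Q_le Qn; exact: leq_maxr.
  pose m gg := projT1 (cid (ex gg)).
  have mP gg : p (m gg) = ((p (val gg).1).1, (p (val gg).2).2) := projT2 (cid (ex gg)).
  exists m => // gg U; have [n1 Q1] := p_Q (val gg).1; have [n2 Q2] := p_Q (val gg).2.
  pose n := maxn n1 n2.
  have {}Q1 : Q n (p (val gg).1) by apply: Q_le Q1; exact: leq_maxl.
  have {}Q2 : Q n (p (val gg).2) by apply: Q_le Q2; exact: leq_maxr.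
  have H (hh : composable p) : Q n (p (val hh).1) -> Q n (p (val hh).2) -> Q n (p (m hh)).
    move=> h1 h2; have c : (p (val hh).1).2 = (p (val hh).2).1 := set_mem (valP hh).
    rewrite mP; case: (Q_equiv n) => _ _ t; apply: (t _ (p (val hh).1).2).
      by rewrite -surjective_pairing.
    by rewrite c -surjective_pairing.
  move=> /(p_nbhs (H gg Q1 Q2))[A [B]]; rewrite mP /= => -[nA nB AB].
  apply/nbhs_set_type.
  exists ([set g | Q n (p g) /\ A (p g).1] `*` [set g | Q n (p g) /\ B (p g).2]).
    exists ([set g | Q n (p g) /\ A (p g).1], [set g | Q n (p g) /\ B (p g).2]) => //.
    split.
      by apply/(p_nbhs Q1); exists A, setT; split=> //; exact: filterT.
    by apply/(p_nbhs Q2); exists setT, B; split=> //; exact: filterT.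
  by move=> hh [[h1 Ah] [h2 Bh]]; apply: AB; [exact: H|rewrite mP|rewrite mP].
Qed.
End groupoid.

(** A separate name, so that the inductive limit topology can take the place of the subspace
    topology that [set_type] carries. *)
Definition limit_graph (X : topologicalType) (Q : nat -> set (X * X)) : Type :=
  set_type (\bigcup_n Q n).

Section limit_graph.
Variables (X : topologicalType) (Q : nat -> set (X * X)).
Local Notation G := (limit_graph Q).

Definition limit_proj (g : G) : X * X := val g.

Definition limit_open (U : set G) :=
  forall n, open ((fun g : Q n => val g) @^-1` (limit_proj @` U)).

Let inj : injective limit_proj. Proof. exact: val_inj. Qed.

Let openT' : limit_open setT.
Proof.
move=> n; rewrite (_ : _ @^-1` _ = setT); first exact: openT.
rewrite predeqE => g; split=> // _.
have Qg : (\bigcup_n Q n) (val g) by exists n => //; exact: set_mem (valP g).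
by exists (exist _ (val g) (mem_set Qg)).
Qed.

Let openI' : setI_closed limit_open.
Proof.
move=> A B oA oB n; have := openI (oA n) (oB n); congr open.
rewrite predeqE => g; split=> [[[a Aa ag] [b Bb bg]]|[a [Aa Ba] ag]].
  by exists a => //; split=> //; rewrite (_ : a = b) //; apply: inj; rewrite ag bg.
by split; exists a.
Qed.

Let open_bigU' (I : Type) (f : I -> set G) :
  (forall i, limit_open (f i)) -> limit_open (\bigcup_i f i).
Proof.
move=> o n; rewrite (_ : _ @^-1` _ =
    \bigcup_i ((fun g : Q n => val g) @^-1` (limit_proj @` f i))).
  by apply: bigcup_open => i _; exact: o.
rewrite predeqE => g; split=> [[a [i _ fa] ag]|[i _ [a fa ag]]].
  by exists i => //; exists a.
by exists a => //; exists i.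
Qed.

HB.instance Definition _ := gen_eqMixin G.
HB.instance Definition _ := gen_choiceMixin G.
HB.instance Definition _ := isOpenTopological.Build G openT' openI' open_bigU'.

Lemma limit_openE (U : set G) : open U <-> limit_open U. Proof. by []. Qed.
End limit_graph.

Section affable.
Variables (X : topologicalType) (Q : nat -> set (X * X)).
Hypothesis compactX : compact [set: X].
Hypothesis hausdorffX : hausdorff_space X.
Hypothesis zero_dimX : zero_dimensional X.
Hypothesis Q_equiv : forall n, is_equivalence (Q n).
Hypothesis Q_mono : forall n, Q n `<=` Q n.+1.
Hypothesis Q_closed : forall n, closed (Q n).
Hypothesis Q_diagonal : forall n (x : X), exists2 A : set X, nbhs x A &
  forall a b, A a -> A b -> Q n (a, b) -> a = b.
Hypothesis Q_open : forall n xy, Q n xy -> exists A B, [/\ nbhs xy.1 A, nbhs xy.2 B &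
  forall ab, A ab.1 -> B ab.2 -> Q n.+1 ab -> Q n ab].

Let Q_le m n : (m <= n)%N -> Q m `<=` Q n.
Proof.
move=> /subnK <-; elim: (n - m)%N => [//|k IHk] x /IHk.
by rewrite addSn; exact: Q_mono.
Qed.

Let Q_open_le m n xy : Q m xy -> exists A B, [/\ nbhs xy.1 A, nbhs xy.2 B &
  forall ab, A ab.1 -> B ab.2 -> Q n ab -> Q m ab].
Proof.
move=> Qxy; have [mn|/ltnW nm] := leqP m n; last first.
  by exists setT, setT; split=> [||ab _ _]; [exact: filterT..|exact: Q_le].
rewrite -(subnK mn); elim: (n - m)%N => [|k [A [B [nA nB AB]]]].
  by exists setT, setT; split=> //; exact: filterT.
have [A' [B' [nA' nB' AB']]] := Q_open (Q_le (leq_addl k m) Qxy).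
exists (A `&` A'), (B `&` B'); split; [exact: filterI..|].
by move=> ab [a a'] [b b'] /(AB' _ a' b'); exact: AB.
Qed.

Let box_level n : box_nbhs (fun g : Q n => val g) (fun=> Q n).
Proof.
move=> _ g _ U; rewrite nbhs_set_type; split=> [[V [[A B] [nA nB] AB] VU]|[A [B [nA nB AB]]]].
  by exists A, B; split=> // g' _ Ag' Bg'; apply: VU; exact: AB.
exists (A `*` B); first by exists (A, B).
by move=> g' [Ag' Bg']; apply: AB => //; exact: set_mem (valP g').
Qed.

Let box_limit : box_nbhs (@limit_proj X Q) Q.
Proof.
move=> n g Qg U; split.
  rewrite nbhsE => -[V [/limit_openE/(_ n) oV Vg] VU].
  pose g' : Q n := exist _ (limit_proj g) (mem_set Qg).
  have : nbhs g' ((fun g : Q n => val g) @^-1` (@limit_proj X Q @` V)).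
    by apply: open_nbhs_nbhs; split=> //; exists g.
  move=> /(@box_level n 0 g' Qg)[A [B [nA nB AB]]]; exists A, B; split=> // h Qh Ah Bh.
  have [h' Vh' hh'] := AB (exist _ (limit_proj h) (mem_set Qh)) Qh Ah Bh.
  by apply: VU; rewrite (_ : h = h') //; apply: val_inj; exact: esym hh'.
move=> [A [B [nA nB AB]]]; rewrite nbhsE.
exists [set h | Q n (limit_proj h) /\ (interior A (limit_proj h).1 /\ interior B (limit_proj h).2)].
  split; last by split.
  move=> m; rewrite openE => h [h' [Qh' [Ah' Bh']] e].
  have Qh : Q n (val h) by rewrite -e.
  (* Near [h] the pairs of Q m already lie in Q n, by inclusion if m <= n and by repeated openness
     otherwise. This is where [Q_open] makes the inductive limit topology locally that of X x X. *)
  have [A' [B' [nA' nB' AB']]] := Q_open_le m Qh.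
  apply/(@box_level m 0 h (set_mem (valP h))).
  rewrite e in Ah' Bh'.
  exists (interior A `&` A'), (interior B `&` B'); split.
  - by apply: filterI => //; exact: nbhs_interior.
  - by apply: filterI => //; exact: nbhs_interior.
  move=> k Qk [Ak A'k] [Bk B'k].
  have Qk' : (\bigcup_n Q n) (val k) by exists m.
  exists (exist _ (val k) (mem_set Qk')) => //; split=> //.
  exact: AB'.
by move=> h [Qh [Ah Bh]]; apply: AB => //; exact: interior_subset.
Qed.

Lemma affable_union : affable (\bigcup_n Q n).
Proof.
split; first exact: zero_dimension_totally_disconnected.
have const (n : nat) : \bigcup_(_ in [set: nat]) Q n = Q n.
  by rewrite predeqE => x; split=> [[]//|Qx]; exists 0%N.
have rng n : range (fun g : Q n => val g) = Q n.
  rewrite predeqE => x; split=> [[g _ <-]|Qx]; first exact: set_mem (valP g).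
  by exists (exist _ x (mem_set Qx)).
exists Q, (fun n => [the topologicalType of set_type (Q n)]), (fun n g => val g); split=> //.
- move=> n; have T : topological_relation (fun g : Q n => val g) (\bigcup_(_ in [set: nat]) Q n).
    have M : forall k : nat, (fun=> Q n) k `<=` (fun=> Q n) k.+1 by move=> k x.
    have Rg : range (fun g : Q n => val g) = \bigcup_(k in [set: nat]) (fun=> Q n) k by rewrite rng; exact: esym (const n).
    have I : injective (fun g : Q n => val g) by exact: val_inj.
    exact: (groupoid_relation compactX hausdorffX (fun=> Q_equiv n) M (fun=> @Q_closed n)
      I Rg (@box_level n)).
  rewrite const in T; have D : open (diagonal (fun g : Q n => val g)).
    exact: (groupoid_diagonal (fun=> Q_equiv n) (fun=> @Q_diagonal n) (@box_level n)).
  split=> //; apply: (@subclosed_compact _ _ setT) => //; first by rewrite closedC.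
  have := @groupoid_compact _ _ (fun g : Q n => val g) (fun=> Q n) compactX
    (fun=> @Q_closed n) _ (@box_level n) 0; rewrite const rng => /(_ erefl).
  congr compact; rewrite predeqE => g; split=> // _; exact: set_mem (valP g).
exists [the topologicalType of limit_graph Q], (@limit_proj X Q); split; last by [].
split.
  apply: (groupoid_relation compactX hausdorffX Q_equiv Q_mono Q_closed
    _ _ box_limit); first exact: val_inj.
  rewrite predeqE => x; split=> [[g _ <-]|Qx]; first exact: set_mem (valP g).
  by exists (exist _ x (mem_set Qx)).
exact: (groupoid_diagonal Q_equiv Q_diagonal box_limit).
Qed.
End affable.

(** * Affability of the relation on X *)

Lemma near_key (T : GK) n : nbhs T [set S | forall i, (i < n)%N -> key T i = key S i].
Proof. by have [nb _ _] := coded_key; apply/nb; exists n. Qed.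

(** Both alternatives fail at a finite place: the sequences differ at some i, and one of them ceases
    to be straight at some j. Hence the relation at level n is closed. *)
Lemma cofinal_determined n (y1 y2 : nat -> direction * bool) :
  ~ cofinal n y1 y2 ->
  exists k, forall z1 z2, (forall i, (i < k)%N -> z1 i = y1 i) ->
    (forall i, (i < k)%N -> z2 i = y2 i) -> ~ cofinal n z1 z2.
Proof.
move=> nc.
have [i [ni yi]] : exists i, (n <= i)%N /\ y1 i <> y2 i.
  apply: contrapT => h; apply: nc; left=> i ni; apply: contrapT => yi.
  by apply: h; exists i.
have [j [nj yj]] : exists j, (n <= j)%N /\
    (y1 j <> ((y1 n).1, true) \/ y2 j <> ((y2 n).1, true)).
  apply: contrapT => h; apply: nc; right; split=> j nj; apply: contrapT => yj;
    apply: h; exists j; split=> //; [by left|by right].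
exists (maxn i j).+1 => z1 z2 h1 h2 [e|[s1 s2]].
  by apply: yi; rewrite -h1 ?ltnS ?leq_maxl // -h2 ?ltnS ?leq_maxl // e.
have nm : (n < (maxn i j).+1)%N by rewrite ltnS leq_max ni.
case: yj => yj; apply: yj; rewrite -?h1 -?h2 ?ltnS ?leq_maxr //.
  exact: s1.
exact: s2.
Qed.

Theorem ghys_kenyon_affable : affable ghys_kenyon_rel.
Proof.
pose Q (n : nat) : set (GK * GK) := [set TT | cofinal n (addr TT.1) (addr TT.2)].
have -> : ghys_kenyon_rel = \bigcup_n Q n.
  rewrite predeqE => -[T T']; rewrite /ghys_kenyon_rel /restrict_rel /=.
  split=> [/translation_rel_tail[n c]|[n _ c]]; first by exists n.
  by apply/translation_rel_tail; exists n.
apply: affable_union.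
- exact: coded_compact coded_key.
- exact: coded_hausdorff coded_key.
- exact: coded_zero_dimensional coded_key.
- move=> n; split=> [T|T T'|T1 T2 T3]; [exact: cofinal_refl|exact: cofinal_sym|exact: cofinal_trans].
- by move=> n TT; exact: cofinal_mono.
- move=> n; rewrite -openC openE => -[T T'] /cofinal_determined[k kP].
  exists ([set S | forall i, (i < k)%N -> key T i = key S i],
          [set S | forall i, (i < k)%N -> key T' i = key S i]).
    by split; exact: near_key.
  by move=> [S S'] [/= h h']; apply: kP => i ik; rewrite /addr -?h -?h'.
(* The letter n is included because it determines a straight tail; parity is part of each letter of
   the key. Thus two points of this neighbourhood related at level n coincide. *)
- move=> n T; exists [set S | forall i, (i < n.+1)%N -> key T i = key S i]; first exact: near_key.
  move=> S S' h h' c; apply: key_inj; first by rewrite /rooted_odd -h // -h'.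
  have e i : (i <= n)%N -> addr S i = addr S' i by move=> iN; rewrite /addr -h // -h'.
  move=> i; have [/ltnW|ni] := ltnP i n; first exact: e.
  by case: c => [|[s s']]; [exact|rewrite s // s' // e].
move=> n [T T'] /= c.
exists [set S | forall i, (i < n.+2)%N -> key T i = key S i],
       [set S | forall i, (i < n.+2)%N -> key T' i = key S i].
split; [exact: near_key|exact: near_key|move=> [S S'] /= h h' c'].
have e i : (i < n.+2)%N -> addr S i = addr T i by move=> iN; rewrite /addr -h.
have e' i : (i < n.+2)%N -> addr S' i = addr T' i by move=> iN; rewrite /addr -h'.
(* The letters n and n + 1 of S and S' are those of T and T', and [c'] has to be lowered from level
   n + 1 to level n. If [c] and [c'] hold for the same reason, letter n is compared directly; in the
   mixed cases the common letters force equal tails. *)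
case: c => [t|[s s']].
  have t' i : (n.+1 <= i)%N -> addr S i = addr S' i.
    by case: c' => [|[r r'] ni]; [exact|rewrite r // r' // e // e' // t].
  left=> i; rewrite leq_eqVlt => /predU1P[<-|/t'//].
  by rewrite e // e' // t.
have S0 : addr S n = ((addr T n).1, true) by rewrite e // s.
have S1 : addr S n.+1 = ((addr T n).1, true) by rewrite e // s.
have S0' : addr S' n = ((addr T' n).1, true) by rewrite e' // s'.
have S1' : addr S' n.+1 = ((addr T' n).1, true) by rewrite e' // s'.
case: c' => [t|[r r']].
  left=> i; rewrite leq_eqVlt => /predU1P[<-|/t//].
  by rewrite S0 S0' -S1 -S1' t.
right; split=> i; rewrite leq_eqVlt => /predU1P[<-|ni].
- by rewrite S0.
- by rewrite r // S1 S0.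
- by rewrite S0'.
- by rewrite r' // S1' S0'.
Qed.

(** * Vershik maps *)

Section vershik_step.
Variables (V Ed : eqType) (src tgt : Ed -> V) (p q : V).
Variables (first last : V -> Ed) (succ : Ed -> Ed).

Definition is_path (e : nat -> Ed) := forall n, tgt (e n) = src (e n.+1).

(** Two bridging edges, at n and n + 1, join any prefix to any tail. Minimality and the absence of
    isolated points both rest on this. *)
Lemma is_path_connect e g n :
  (forall v w, exists a b, [/\ src a = v, tgt a = src b & tgt b = w]) ->
  is_path e -> is_path g -> exists g', [/\ is_path g',
    forall i, (i < n)%N -> g' i = g i & forall i, (n.+1 < i)%N -> g' i = e i].
Proof.
move=> con pe pg; have [a [b [sa ab tb]]] := con (src (g n)) (src (e n.+2)).
exists (fun i => if (i < n)%N then g i else if i == n then a else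
  if i == n.+1 then b else e i); split=> [i|i ->//|i ni]; last first.
  by rewrite ltnNge (ltnW (ltnW ni)) /= !gtn_eqF // ltnW.
case: (ltngtP i n) => [iN|ni|->].
- move: (iN); rewrite leq_eqVlt => /predU1P[iE|iN1].
    by rewrite iE ltnn eqxx sa -iE pg.
  by rewrite iN1 pg.
- rewrite ltnNge (leqW (ltnW ni)) /= (@gtn_eqF n i.+1 (leqW ni)) eqSS (gtn_eqF ni).
  by case: eqP => [->|_]; [rewrite tb|rewrite pe].
- by rewrite ltnNge leqnSn /= gtn_eqF // eqxx.
Qed.

Definition movable (e : nat -> Ed) (n : nat) : bool := e n != last (tgt (e n)).

(* The edges below level n of the path which is initial below the vertex v of level n. *)
Definition initial (n : nat) (v : V) (k : nat) : Ed :=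
  if k.+1 == n then first v else first p.

(** The odometer carry: the edge f is put at level n, everything below is reset to minimal edges,
    everything above is kept. *)
Definition splice (n : nat) (f : Ed) (e : nat -> Ed) (k : nat) : Ed :=
  if (k < n)%N then initial n (src f) k else if k == n then f else e k.

Lemma splice_lt n f e k : (k < n)%N -> splice n f e k = initial n (src f) k.
Proof. by rewrite /splice => ->. Qed.

Lemma splice_eq n f e : splice n f e n = f.
Proof. by rewrite /splice ltnn eqxx. Qed.

Lemma splice_gt n f e k : (n < k)%N -> splice n f e k = e k.
Proof. by move=> nk; rewrite /splice ltnNge (ltnW nk) /= gtn_eqF. Qed.

Definition vershik (e : nat -> Ed) : nat -> Ed :=
  if pselect (exists n, movable e n) is left h then
    splice (ex_minn h) (succ (e (ex_minn h))) e
  else fun=> first p.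

Lemma vershikE n e : (forall k, (k < n)%N -> ~~ movable e k) -> movable e n ->
  vershik e = splice n (succ (e n)) e.
Proof.
move=> nm mn; rewrite /vershik; case: pselect => [h|[]]; last by exists n.
case: ex_minnP => m mm mmin; suff -> : m = n by [].
apply/eqP; rewrite eqn_leq mmin //= leqNgt; apply/negP => /nm.
by rewrite mm.
Qed.

Lemma vershik_last e : (forall k, ~~ movable e k) -> vershik e = fun=> first p.
Proof.
by move=> nm; rewrite /vershik; case: pselect => // -[n mn]; have := nm n; rewrite mn.
Qed.

Lemma movable_min e : (exists n, movable e n) -> exists n,
  movable e n /\ forall k, (k < n)%N -> ~~ movable e k.
Proof.
move=> h; case: (ex_minnP h) => n mn nmin; exists n; split=> // k kn.
by apply/negP => /nmin; rewrite leqNgt kn.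
Qed.
End vershik_step.

Section vershik.
Variables (V Ed : eqType) (src tgt : Ed -> V) (p q : V).
Variables (first last : V -> Ed) (succ pred : Ed -> Ed).
Hypothesis tgt_first : forall v, tgt (first v) = v.
Hypothesis tgt_last : forall v, tgt (last v) = v.
Hypothesis src_first : forall v, src (first v) = p.
Hypothesis src_last : forall v, src (last v) = q.
Hypothesis tgt_succ : forall e, e != last (tgt e) -> tgt (succ e) = tgt e.
Hypothesis succ_first : forall e, e != last (tgt e) -> succ e != first (tgt e).
Hypothesis succK : forall e, e != last (tgt e) -> pred (succ e) = e.

Local Notation path := (is_path src tgt).
Local Notation mov := (movable tgt last).
Local Notation spl := (splice src p first).
Local Notation h := (vershik src tgt p first last succ).
Local Notation h' := (vershik src tgt q last first pred).

Lemma is_path_replace n f e (r : V) (b : V -> Ed) :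
  (forall v, tgt (b v) = v) -> (forall v, src (b v) = r) ->
  path e -> tgt f = tgt (e n) ->
  path (fun k => if (k < n)%N then initial r b n (src f) k else if k == n then f else e k).
Proof.
move=> tb sb pe fe k; rewrite /initial; case: (ltngtP k n) => kn.
- move: kn; rewrite leq_eqVlt => /predU1P[<-|kn]; first by rewrite ltnn !eqxx tb.
  by rewrite kn ltn_eqF // tb; case: ifP; rewrite sb.
- by rewrite ltnNge ltnW ?ltnS ?(ltnW kn) //= gtn_eqF ?pe // ltnW.
- by rewrite kn ltnNge leqnSn /= gtn_eqF // fe pe.
Qed.

Lemma is_path_splice n f e : path e -> tgt f = tgt (e n) -> path (spl n f e).
Proof. exact: is_path_replace. Qed.

Lemma is_path_constant : path (fun=> first p).
Proof. by move=> n; rewrite tgt_first src_first. Qed.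

Lemma is_path_vershik e : path e -> path (h e).
Proof.
move=> pe; have [ex|nex] := pselect (exists n, mov e n); last first.
  rewrite vershik_last; first exact: is_path_constant.
  by move=> k; apply/negP => mk; apply: nex; exists k.
have [n [mn nm]] := movable_min ex; rewrite (vershikE _ _ _ _ nm mn).
by apply: is_path_splice => //; exact: tgt_succ.
Qed.

Lemma immovable_below e n : path e -> (forall k, (k < n)%N -> ~~ mov e k) ->
  forall k, (k < n)%N -> e k = initial q last n (src (e n)) k.
Proof.
move=> pe nm k kn; have /negPn/eqP ek := nm _ kn.
rewrite /initial; case: eqP => [<-|kn']; first by rewrite -pe.
have kn1 : (k.+1 < n)%N by rewrite ltn_neqAle kn andbT; exact/eqP.
by have /negPn/eqP ek1 := nm _ kn1; rewrite ek pe ek1 src_last.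
Qed.

Lemma immovable e : path e -> (forall k, ~~ mov e k) -> e = fun=> last q.
Proof.
move=> pe nm; apply/funext => k; have /negPn/eqP -> := nm k.
by rewrite pe; have /negPn/eqP -> := nm k.+1; rewrite src_last.
Qed.

(** In the image the edges below n are first edges and the edge at n is not, so n is also the first
    level movable for the reversed order. There [pred] undoes [succ], and the reset puts back the
    last edges that e had below n. The maximal path goes to the minimal one and back. *)
Lemma vershikK e : path e -> h' (h e) = e.
Proof.
move=> pe; have [ex|nex] := pselect (exists n, mov e n); last first.
  have nm k : ~~ mov e k by apply/negP => mk; apply: nex; exists k.
  rewrite (vershik_last _ _ _ _ nm) vershik_last; first by rewrite -(immovable pe nm).
  by move=> k; rewrite /movable tgt_first eqxx.
have [n [mn nm]] := movable_min ex; rewrite (vershikE _ _ _ _ nm mn).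
rewrite (@vershikE _ _ _ _ _ _ _ _ n).
- rewrite splice_eq succK //; apply/funext => k; case: (ltngtP k n) => [kn|kn|->].
  + by rewrite splice_lt // -(immovable_below pe nm kn).
  + by rewrite !splice_gt.
  + by rewrite splice_eq.
- move=> k kn; rewrite /movable splice_lt // /initial.
  by case: ifP; rewrite tgt_first eqxx.
- by rewrite /movable splice_eq tgt_succ //; exact: succ_first.
Qed.

Lemma vershik_local e n : path e -> exists m, forall e', path e' ->
  (forall i, (i < m)%N -> e i = e' i) -> h e n = h e' n.
Proof.
move=> pe; have [ex|nex] := pselect (exists n, mov e n).
  have [k [mk nm]] := movable_min ex; exists (maxn k n).+1 => e' pe' ee'.
  have E i : (i <= k)%N -> e i = e' i by move=> ik; apply: ee'; rewrite ltnS leq_max ik.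
  have mk' : mov e' k by rewrite /movable -E.
  have nm' i : (i < k)%N -> ~~ mov e' i.
    by move=> ik; rewrite /movable -(E i (ltnW ik)); exact: nm.
  rewrite (vershikE _ _ _ _ nm mk) (vershikE _ _ _ _ nm' mk') -E //.
  by rewrite /splice (ee' n) // ltnS leq_maxr.
have nm k : ~~ mov e k by apply/negP => mk; apply: nex; exists k.
(* The first movable level k of a path close to the maximal one must satisfy n + 1 < k: then the
   reset puts [first p] at n, whereas at k - 1 the edge depends on its target. *)
exists n.+2 => e' pe' ee'; rewrite (vershik_last _ _ _ _ nm).
have [ex|nex'] := pselect (exists n, mov e' n); last first.
  rewrite vershik_last // => k; apply/negP => mk; apply: nex'; by exists k.
have [k [mk nm']] := movable_min ex; rewrite (vershikE _ _ _ _ nm' mk).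
have kn : (n.+2 <= k)%N.
  rewrite leqNgt; apply/negP => kn; have := nm k.
  by rewrite /movable ee' // -/(mov e' k) mk.
by rewrite splice_lt ?(leq_trans _ kn) // /initial ltn_eqF.
Qed.

Hypothesis climb : forall (Q : Ed -> Prop) v, Q (first v) ->
  (forall e, tgt e = v -> e != last v -> Q e -> Q (succ e)) ->
  forall e, tgt e = v -> Q e.

Lemma splice_self n e : spl n (e n) e = fun k =>
  if (k < n)%N then initial p first n (src (e n)) k else e k.
Proof.
by apply/funext => k; rewrite /splice; case: ltnP => // nk; case: eqP => // ->.
Qed.

(** As in an odometer, the iterates run through the prefixes below a fixed edge, starting from the
    minimal one. By induction, the prefixes below each edge at level n are exhausted before that
    edge moves on. *)
Lemma iter_vershik_splice n e : path e -> exists j, iter j h (spl n (e n) e) = e.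
Proof.
elim: n e => [|n IHn] e pe.
  exists 0%N; rewrite /= splice_self; apply/funext => k; by rewrite ltn0.
pose v := src (e n.+1).
have S f : spl n.+1 (e n.+1) (spl n f e) = spl n.+1 (e n.+1) e.
  apply/funext => k; case: (ltngtP k n.+1) => [kn|kn|->]; last by rewrite !splice_eq.
    by rewrite !splice_lt.
  by rewrite !splice_gt // ltnW.
have step f : tgt f = v -> exists j, iter j h (spl n (first v) e) = spl n f e.
  move: f; apply: climb => [|f tf nf [j jE]]; first by exists 0%N.
  (* The path with maximal prefix below f, the last one before the carry: its image replaces f by
     its successor and resets what lies below. *)
  pose g k := if (k < n)%N then initial q last n (src f) k else if k == n then f else e k.
  have gn : g n = f by rewrite /g ltnn eqxx.
  have pg : path g.
    by apply: is_path_replace => //; rewrite tf pe.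
  have [i iE] := IHn g pg.
  have sg : spl n (g n) g = spl n f e.
    rewrite gn; apply/funext => k; case: (ltngtP k n) => [kn|kn|->]; last by rewrite !splice_eq.
      by rewrite !splice_lt.
    by rewrite !splice_gt // /g ltnNge (ltnW kn) /= gtn_eqF.
  exists (i + j).+1; rewrite iterS iterD jE -sg iE (@vershikE _ _ _ _ _ _ _ _ n).
  - rewrite gn; apply/funext => k; case: (ltngtP k n) => [kn|kn|->]; last by rewrite !splice_eq.
      by rewrite !splice_lt.
    by rewrite !splice_gt // /g ltnNge (ltnW kn) /= gtn_eqF.
  - move=> k kn; rewrite /movable /g kn /initial.
    by case: ifP; rewrite tgt_last eqxx.
  - by rewrite /movable gn tf.
have [j jE] := step (e n) (pe n); have [i iE] := IHn e pe.
exists (i + j)%N; rewrite iterD; suff -> : spl n.+1 (e n.+1) e = spl n (first v) e.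
  by rewrite jE.
apply/funext => k; case: (ltngtP k n) => [kn|kn|->].
- by rewrite !splice_lt ?(leqW kn) // /initial eqSS (ltn_eqF kn) src_first; case: ifP.
- rewrite [RHS]splice_gt //; move: kn; rewrite leq_eqVlt => /predU1P[<-|kn].
    by rewrite splice_eq.
  by rewrite splice_gt.
- by rewrite splice_eq splice_lt // /initial eqxx.
Qed.

Definition special (e : nat -> Ed) := exists n,
  (forall i, (n <= i)%N -> e i = last q) \/ (forall i, (n <= i)%N -> e i = first p).

Lemma reach_orbit (x y z : nat -> Ed) i j : iter i h x = y -> iter j h x = z ->
  exists n, iter n h y = z \/ iter n h z = y.
Proof.
move=> <- <-; have [ij|/ltnW ij] := leqP i j.
  by exists (j - i)%N; left; rewrite -iterD subnK.
by exists (i - j)%N; right; rewrite -iterD subnK.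
Qed.

Lemma vershik_tail e : path e -> (exists n, forall i, (n <= i)%N -> h e i = e i) \/
  (e = fun=> last q) /\ h e = fun=> first p.
Proof.
move=> pe; have [ex|nex] := pselect (exists n, mov e n).
  have [n [mn nm]] := movable_min ex; left; exists n.+1 => i ni.
  by rewrite (vershikE _ _ _ _ nm mn) splice_gt.
have nm k : ~~ mov e k by apply/negP => mk; apply: nex; exists k.
by right; split; [exact: immovable|exact: vershik_last].
Qed.

Lemma special_tail n e e' : (forall i, (n <= i)%N -> e i = e' i) -> special e -> special e'.
Proof.
move=> ee' [m [se|se]]; exists (maxn m n); [left|right] => i;
  by rewrite geq_max => /andP[mi ni]; rewrite -ee' // se.
Qed.

Definition path_equivalent (e e' : nat -> Ed) :=
  (exists n, forall i, (n <= i)%N -> e i = e' i) \/ special e /\ special e'.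

Lemma path_equivalent_sym e e' : path_equivalent e e' -> path_equivalent e' e.
Proof.
move=> [[n ee']|[s s']]; [left; exists n => i ni|right]; last by [].
by rewrite ee'.
Qed.

Lemma path_equivalent_trans e1 e2 e3 :
  path_equivalent e1 e2 -> path_equivalent e2 e3 -> path_equivalent e1 e3.
Proof.
move=> [[m e12]|[s1 s2]] [[n e23]|[s2' s3]].
- left; exists (maxn m n) => i; rewrite geq_max => /andP[mi ni].
  by rewrite e12 // e23.
- right; split=> //; by apply: (special_tail (n := m)) s2' => i mi; exact: esym (e12 i mi).
- by right; split=> //; exact: special_tail e23 s2.
- by right.
Qed.

Lemma iter_path n e : path e -> path (iter n h e).
Proof. by move=> pe; elim: n => //= n; exact: is_path_vershik. Qed.

Lemma iter_equivalent n e : path e -> path_equivalent e (iter n h e).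
Proof.
move=> pe; elim: n => [|n IHn]; first by left; exists 0%N.
apply: path_equivalent_trans IHn _; rewrite iterS.
have [[m mE]|[E1 E2]] := vershik_tail (iter_path n pe).
  by left; exists m => i mi; rewrite mE.
by right; rewrite E2 {1}E1; split; exists 0%N; [left|right].
Qed.

(** With minimal tail, resetting the prefix gives the minimal path itself. With maximal tail, the
    reset path also leads to the maximal path, and one further iterate gives the minimal path. *)
Lemma special_reach e : path e -> special e ->
  exists2 x, path x & (exists i, iter i h x = e) /\ (exists j, iter j h x = fun=> first p).
Proof.
move=> pe [n [se|se]]; last first.
  have E : spl n (e n) e = fun=> first p.
    rewrite splice_self; apply/funext => k; rewrite /initial se // src_first.
    by case: ltnP => nk; [case: ifP|rewrite se].
  have [i iE] := iter_vershik_splice n pe; rewrite E in iE.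
  exists (fun=> first p); first exact: is_path_constant.
  by split; [exists i|exists 0%N].
have [i iE] := iter_vershik_splice n pe.
have pl : path (fun=> last q) by move=> k; rewrite tgt_last src_last.
have [j jE] := iter_vershik_splice n pl.
have E : spl n (e n) e = spl n (last q) (fun=> last q).
  apply/funext => k; rewrite /splice se //; case: ltnP => // nk; case: eqP => // _.
  by rewrite se.
exists (spl n (e n) e); first by apply: is_path_splice.
split; first by exists i.
exists j.+1; rewrite iterS E jE vershik_last // => k.
by rewrite /movable tgt_last eqxx.
Qed.

Theorem vershik_orbit e e' : path e -> path e' ->
  (exists n, iter n h e = e' \/ iter n h e' = e) <-> path_equivalent e e'.
Proof.
move=> pe pe'; split=> [[n [<-|<-]]|].
- exact: iter_equivalent.
- by apply: path_equivalent_sym; exact: iter_equivalent.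
case=> [[n ee']|[s s']].
  have [i iE] := iter_vershik_splice n pe; have [j jE] := iter_vershik_splice n pe'.
  have E : spl n (e n) e = spl n (e' n) e'.
    rewrite !splice_self; apply/funext => k; rewrite ee' //; case: ltnP => // nk.
    exact: ee'.
  by rewrite -E in jE; exact: reach_orbit iE jE.
have [x px [[i xe] [j xb]]] := special_reach pe s.
have [x' px' [[i' xe'] [j' xb']]] := special_reach pe' s'.
(* Both orbits meet the minimal path, after j and j' steps; injectivity allows the shorter run to be
   cancelled, so that x and x' lie on one orbit. *)
have inj m y z : path y -> path z -> iter m h y = iter m h z -> y = z.
  elim: m => //= m IHm py pz e0; apply: IHm => //.
  by rewrite -(vershikK (iter_path m py)) e0 vershikK //; exact: iter_path.
have [jj|/ltnW jj] := leqP j j'.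
  have xE : x = iter (j' - j) h x'.
    by apply: (inj j) => //; [exact: iter_path|rewrite -iterD subnKC // xb xb'].
  by move: xe; rewrite xE -iterD => xe; exact: reach_orbit xe xe'.
have xE : x' = iter (j - j') h x.
  by apply: (inj j') => //; [exact: iter_path|rewrite -iterD subnKC // xb xb'].
by move: xe'; rewrite xE -iterD => xe'; exact: reach_orbit xe xe'.
Qed.
End vershik.

Section edge_order.
Variables (V : eqType) (Ed : finType) (tgt : Ed -> V) (first last : V -> Ed).
Hypothesis tgt_first : forall v, tgt (first v) = v.
Hypothesis tgt_last : forall v, tgt (last v) = v.
Hypothesis first_last : forall v, first v != last v.

(** Only the first and the last incoming edge are prescribed; those between keep the order of the
    enumeration. *)
Definition incoming (v : V) : seq Ed :=
  first v :: rcons [seq e <- enum Ed | [&& tgt e == v, e != first v & e != last v]] (last v).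

Lemma mem_incoming v e : (e \in incoming v) = (tgt e == v).
Proof.
rewrite inE mem_rcons inE mem_filter mem_enum andbT.
have [->|ef] := eqVneq e (first v); first by rewrite tgt_first eqxx.
have [->|el] := eqVneq e (last v); first by rewrite tgt_last eqxx.
by rewrite andbT.
Qed.

Lemma uniq_incoming v : uniq (incoming v).
Proof.
rewrite /= rcons_uniq mem_rcons inE negb_or first_last !mem_filter !eqxx /= !andbF /=.
by rewrite filter_uniq // enum_uniq.
Qed.

(** Taken cyclically, from the last edge back to the first, which makes it a bijection with inverse
    [edge_pred]. *)
Definition edge_succ (e : Ed) : Ed := next (incoming (tgt e)) e.
Definition edge_pred (e : Ed) : Ed := prev (incoming (tgt e)) e.

Lemma tgt_edge_succ e : tgt (edge_succ e) = tgt e.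
Proof. by apply/eqP; rewrite -mem_incoming mem_next mem_incoming. Qed.

Lemma edge_succK : cancel edge_succ edge_pred.
Proof. by move=> e; rewrite /edge_pred tgt_edge_succ /edge_succ prev_next // uniq_incoming. Qed.

Lemma edge_climb (Q : Ed -> Prop) v : Q (first v) ->
  (forall e, tgt e = v -> e != last v -> Q e -> Q (edge_succ e)) ->
  forall e, tgt e = v -> Q e.
Proof.
move=> Qf Qs e te.
suff H k : (k < size (incoming v))%N -> Q (nth (last v) (incoming v) k).
  have /H : (index e (incoming v) < size (incoming v))%N.
    by rewrite index_mem mem_incoming te.
  by rewrite nth_index // mem_incoming te.
elim: k => // k IHk ks.
set x := nth (last v) (incoming v) k.
have kx : index x (incoming v) = k by rewrite index_uniq ?uniq_incoming // ltnW.
have xin : x \in incoming v by rewrite mem_nth // ltnW.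
have tx : tgt x = v by apply/eqP; rewrite -mem_incoming.
have sE : edge_succ x = nth (last v) (incoming v) k.+1.
  rewrite /edge_succ tx next_nth xin kx /=; apply: set_nth_default.
  by move: ks; rewrite /= size_rcons.
have xl : x != last v.
  apply/eqP => xl; move: kx; rewrite xl /incoming /= (negbTE (first_last v)).
  rewrite -cats1 index_cat mem_filter !eqxx /= !andbF /= eqxx addn0 => -[kE].
  by move: ks; rewrite -kE /= size_rcons ltnn.
by rewrite -sE; apply: Qs => //; apply: IHk; exact: ltnW.
Qed.

Lemma edge_predK : cancel edge_pred edge_succ.
Proof.
move=> e; have te : tgt (edge_pred e) = tgt e.
  by apply/eqP; rewrite -mem_incoming mem_prev mem_incoming.
by rewrite /edge_succ te next_prev // uniq_incoming.
Qed.

Lemma tgt_edge_pred e : tgt (edge_pred e) = tgt e.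
Proof. by rewrite -{2}(edge_predK e) tgt_edge_succ. Qed.

Lemma edge_succ_last v : edge_succ (last v) = first v.
Proof.
have l0 : last v \in incoming v by rewrite mem_incoming tgt_last.
rewrite /edge_succ tgt_last next_nth l0 /incoming /= (negbTE (first_last _)).
rewrite -cats1 index_cat mem_filter !eqxx /= !andbF /= eqxx addn0.
by rewrite nth_default // size_cat addn1.
Qed.

Lemma edge_succ_first e : e != last (tgt e) -> edge_succ e != first (tgt e).
Proof. by rewrite -edge_succ_last (can_eq edge_succK). Qed.

Lemma edge_pred_last e : e != first (tgt e) -> edge_pred e != last (tgt e).
Proof. by rewrite -[edge_pred e == _](can_eq edge_succK) edge_predK edge_succ_last. Qed.
End edge_order.

(** * Itineraries of addresses *)

(** The second factor of the address rule: the status at n holds when [turn y n] does and the axes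
    at n and n + 1 agree. Sign and turn together do not involve the axis at n, which allows the
    nodes to forget it. *)
Definition turn (y : nat -> direction * bool) (n : nat) : bool :=
  ((y n).1.1 != (y n.+1).1.1) || (y n.+1).2.

(* The bit of the addresses which the nodes (sign, turn) at n and n + 1, together with the
   bits known before, leave undetermined; false if there is none. *)
Definition label (y : nat -> direction * bool) (n : nat) : bool :=
  if turn y n then [&& (y n).1.1 != (y n.+1).1.1, turn y n.+1 & (y n.+2).1.2]
  else if turn y n.+1 then (y n.+2).1.2 else (y n.+1).1.2.

Definition node := (bool * bool)%type.

Definition itinerary (y : nat -> direction * bool) (n : nat) : node * bool :=
  (((y n).1.1, turn y n), label y n).

(** The rule gives turn n = (signs at n and n + 1 differ) or (axes at n + 1 and n + 2 agree and turn
    n + 1). With turn and equal signs, the next turn holds and no bit is free; with turn and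
    different signs, a bit is free only if the next turn holds; without turn, the signs agree and
    one bit is free. *)
Definition valid (a : node * bool) (w : node) : bool :=
  let: ((p, t), l) := a in let: (p', t') := w in
  if t then if p == p' then t' && ~~ l else t' || ~~ l else p == p'.

(** Axis bits are recovered forwards from the one at 0 and, after a turn, the one at 1; these
    initial data are normalized to false, as in [decode]. *)
Definition based (y : nat -> direction * bool) : bool :=
  ~~ (y 0%N).1.2 && (turn y 0 ==> ~~ (y 1%N).1.2).

Lemma valid_itinerary y : address_rule y ->
  forall n, valid (itinerary y n) (itinerary y n.+1).1.
Proof.
move=> ry n; rewrite /valid /itinerary /=.
have := ry n.+1; rewrite -/(turn y n.+1) /label.
have -> : turn y n = ((y n).1.1 != (y n.+1).1.1) || (y n.+1).2 by [].
move: (turn y n.+1) => t1.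
case: (y n.+1) => [[p1 x1] s1]; case: (y n) => [[p0 x0] s0]; case: (y n.+2) => [[p2 x2] s2] /=.
by case: t1 x2 p0 p1 s1 x1 => [] [] [] [] [] [].
Qed.

(* The first component is the bit (y n).1.2 of the address y; the second one, used only
   when turn y n holds, is the bit of y n.+1, which is then already determined. *)
Fixpoint decode (a : nat -> node * bool) (n : nat) : bool * bool :=
  if n is m.+1 then
    let: (x, z) := decode a m in
    let: ((p, t), l) := a m in let: (p', t') := (a m.+1).1 in
    if t then (z, t' && (if p == p' then z else l))
    else if t' then (~~ l, l) else (l, false)
  else (false, false).

Definition decoded (a : nat -> node * bool) (n : nat) : direction * bool :=
  (((a n).1.1, (decode a n).1), (a n).1.2 && ((decode a n).1 == (decode a n).2)).

Lemma eq_decode a b n : (forall i, (i <= n)%N -> a i = b i) -> decode a n = decode b n.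
Proof.
elim: n => //= n IHn e; rewrite IHn ?e // => i iN; exact: e (leqW iN).
Qed.

Lemma eq_decoded a b n : (forall i, (i <= n)%N -> a i = b i) -> decoded a n = decoded b n.
Proof. by move=> e; rewrite /decoded (eq_decode e) e. Qed.

Lemma decode_itinerary y : address_rule y -> based y -> forall n,
  decode (itinerary y) n = ((y n).1.2, turn y n && (y n.+1).1.2).
Proof.
move=> ry /andP[x0 x1]; elim=> [|n IHn].
  by move: x0 x1; rewrite [LHS]/=; case: (turn y 0); case: (y 0%N).1.2; case: (y 1%N).1.2.
rewrite [LHS]/= IHn /label; have := ry n.+1; rewrite -/(turn y n.+1) /=.
have -> : turn y n = ((y n).1.1 != (y n.+1).1.1) || (y n.+1).2 by [].
move: (turn y n.+1) => t1.
case: (y n) => [[p0 x0'] s0]; case: (y n.+1) => [[p1 x1'] s1]; case: (y n.+2) => [[p2 x2] s2] /=.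
by case: t1 x2 p0 p1 s1 x1' => [] [] [] [] [] [].
Qed.

Lemma decoded_itinerary y : address_rule y -> based y -> forall n,
  decoded (itinerary y) n = y n.
Proof.
move=> ry by_ n; rewrite /decoded decode_itinerary // [RHS]surjective_pairing ry -/(turn y n).
by congr pair; rewrite /= -?surjective_pairing //; case: (turn y n); rewrite ?andbF ?andbT.
Qed.

Section decoded.
Variable a : nat -> node * bool.
Hypothesis va : forall n, valid (a n) (a n.+1).1.

Lemma turn_decoded n : turn (decoded a) n = (a n).1.2.
Proof.
rewrite /turn /=; have := va n.
case: (decode a n) => x z.
case: (a n) => [[p t] l]; case: (a n.+1) => [[p' t'] l'] /=.
by case: t p p' t' z l => [] [] [] [] [] [].
Qed.

Lemma address_rule_decoded : address_rule (decoded a).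
Proof.
move=> n; rewrite -/(turn (decoded a) n) turn_decoded /= andbC; have := va n.
case: (decode a n) => x z.
case: (a n) => [[p t] l]; case: (a n.+1) => [[p' t'] l'] /=.
by case: t p p' t' z l x => [] [] [] [] [] [] [].
Qed.

Lemma based_decoded : based (decoded a).
Proof.
rewrite /based turn_decoded /=; have := va 0.
case: (a 0%N) => [[p t] l]; case: (a 1%N) => [[p' t'] l'] /=.
by case: t p p' t' l => [] [] [] [] [].
Qed.

Lemma itinerary_decoded n : itinerary (decoded a) n = a n.
Proof.
rewrite /itinerary turn_decoded /label !turn_decoded.
rewrite [RHS]surjective_pairing [(a n).1 in RHS]surjective_pairing; congr pair.
rewrite /=; have := va n; have := va n.+1.
case: (decode a n) => x z.
case: (a n) => [[p t] l]; case: (a n.+1) => [[p' t'] l'] /=; case: (a n.+2) => [[p'' t''] l''] /=.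
by case: t p p' t' z l p'' t'' l' => [] [] [] [] [] [] [] [] [].
Qed.
End decoded.

Definition straight_itinerary (n : nat) (a : nat -> node * bool) :=
  forall i, (n <= i)%N -> a i = (((a n).1.1, true), false).

Lemma straight_itineraryP y n : address_rule y ->
  straight n y -> straight_itinerary n (itinerary y).
Proof.
move=> ry sy i ni; rewrite /itinerary /label /turn.
by rewrite (sy i) // (sy i.+1) ?(sy i.+2) ?(sy i.+3) ?leqW //= !eqxx /=.
Qed.

(** With constant sign, the turns give status true from n + 1 on, and status true makes the axis
    constant there. The axis at n may differ, whence the shift by one. *)
Lemma itinerary_straight y n : address_rule y ->
  straight_itinerary n (itinerary y) -> straight n.+1 y.
Proof.
move=> ry sa.
have pE i : (n <= i)%N -> (y i).1.1 = (y n).1.1 by move=> /sa/(congr1 (fun b => b.1.1)).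
have tE i : (n <= i)%N -> turn y i by move=> /sa/(congr1 (fun b => b.1.2)).
have sE i : (n <= i)%N -> (y i.+1).2.
  by move=> ni; have := tE i ni; rewrite /turn !pE ?leqW // eqxx.
have xE i : (n < i)%N -> (y i).1.2 = (y n.+1).1.2.
  elim: i => // i IHi; rewrite ltnS leq_eqVlt => /predU1P[->//|ni].
  rewrite -IHi //; case: i ni {IHi} => // i ni.
  by have := ry i.+1; rewrite sE // => /esym/andP[/eqP->].
move=> i ni; rewrite [LHS]surjective_pairing [(y i).1]surjective_pairing.
case: i ni => // i ni; rewrite sE // xE // (pE i.+1) ?(ltnW ni) //.
by rewrite -(pE n.+1) // -surjective_pairing.
Qed.

Lemma itinerary_tail y y' n : (forall i, (n <= i)%N -> y i = y' i) ->
  forall i, (n <= i)%N -> itinerary y i = itinerary y' i.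
Proof.
by move=> e i ni; rewrite /itinerary /label /turn !e // !leqW.
Qed.

(* The second component of decode is determined as soon as the path leaves the straight
   edges. *)
Lemma decode_leave a a' n i : (forall i, valid (a i) (a i.+1).1) -> (n <= i)%N ->
  (forall i, (n <= i)%N -> a i = a' i) ->
  ~~ [&& (a i).1.2, (a i.+1).1.2 & (a i).1.1 == (a i.+1).1.1] ->
  forall j, (i.+2 <= j)%N -> decode a j = decode a' j.
Proof.
move=> va ni e leave.
have z1 : (decode a i.+1).2 = (decode a' i.+1).2.
  have := leave; have := va i; rewrite /= -!e ?leqW //.
  case: (decode a i) => x z; case: (decode a' i) => x' z'.
  case: (a i) => [[p t] l]; case: (a i.+1) => [[p' t'] l'] /=.
  by case: p p' t t' l l' => [] [] [] [] [] [].
elim=> // j IHj; rewrite ltnS leq_eqVlt => /predU1P[ij|ij].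
  rewrite -ij [LHS]/= [RHS]/= -/(decode a i.+1) -/(decode a' i.+1) -!e ?leqW //.
  by move: z1; case: (decode a i.+1) => x z; case: (decode a' i.+1) => x' z' /= ->.
by rewrite /= IHj // -!e //; lia.
Qed.

(** The only memory of the past is the axis carried along a straight stretch. Either this stretch
    never ends, or the axis is reset at its end and the decoded addresses agree from there on. *)
Lemma tail_itinerary y y' n : address_rule y -> address_rule y' -> based y -> based y' ->
  (forall i, (n <= i)%N -> itinerary y i = itinerary y' i) ->
  straight_itinerary n (itinerary y) \/ exists m, forall i, (m <= i)%N -> y i = y' i.
Proof.
move=> ry ry' by_ by_' e.
pose a := itinerary y; pose a' := itinerary y'.
have va : forall i, valid (a i) (a i.+1).1 := valid_itinerary ry.
have [[i [ni leave]]|stay] := pselect (exists i, (n <= i)%N /\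
    ~~ [&& (a i).1.2, (a i.+1).1.2 & (a i).1.1 == (a i.+1).1.1]); last first.
  have S i (ni : (n <= i)%N) : [&& (a i).1.2, (a i.+1).1.2 & (a i).1.1 == (a i.+1).1.1].
    by apply: contrapT => /negP h; apply: stay; exists i.
  left=> i ni.
  have -> : ((itinerary y n).1.1 = (a i).1.1).
    elim: i ni => [|i IHi]; first by rewrite leqn0 => /eqP->.
    rewrite leq_eqVlt => /predU1P[->//|ni]; rewrite IHi //.
    by have /and3P[_ _ /eqP] := S i ni.
  have := S i ni; have := va i; rewrite -/a /valid.
  case: (a i) => [[p t] l]; case: (a i.+1) => [[p' t'] l'] /=.
  by case: p p' t t' l l' => [] [] [] [] [] [].
right; exists i.+2 => j ij.
have D := decode_leave va ni e leave ij.
rewrite -(decoded_itinerary ry by_) -(decoded_itinerary ry' by_') /decoded.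
by rewrite -/a -/a' D (_ : a j = a' j) //; apply: e; lia.
Qed.

Theorem tail_equivalent_itinerary y y' :
  address_rule y -> address_rule y' -> based y -> based y' ->
  tail_equivalent y y' <->
  (exists n, forall i, (n <= i)%N -> itinerary y i = itinerary y' i) \/
  (exists n, straight_itinerary n (itinerary y) /\ straight_itinerary n (itinerary y')).
Proof.
move=> ry ry' by_ by_'; split.
  move=> [n [e|[s s']]]; [left|right]; exists n; first exact: itinerary_tail.
  by split; exact: straight_itineraryP.
case=> [[n e]|[n [s s']]]; last first.
  by exists n.+1; right; split; exact: itinerary_straight.
have [s|[m h]] := tail_itinerary ry ry' by_ by_' e; last by exists m; left.
exists n.+1; right; split; apply: itinerary_straight => // i ni.
by rewrite -!e // s.
Qed.

(* Two consecutive steps of an itinerary: with a single step, not every node would be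
   reached from both of the nodes (false, true) and (true, true). *)
Definition step2 : Type :=
  {d : (node * bool) * (node * bool) * node | valid d.1.1 d.1.2.1 && valid d.1.2 d.2}.

HB.instance Definition _ := Finite.on step2.
HB.instance Definition _ := SubType.on step2.

Definition src (e : step2) : node := (val e).1.1.1.
Definition tgt (e : step2) : node := (val e).2.

(** A node with turn reaches a node with turn of the same sign, and a node without turn only after a
    change of sign; this determines the sign of the intermediate node. *)
Definition via (a b : node) : node := ((if b.2 then b.1 else ~~ b.1), true).

Lemma via_valid b v : let a := (b, true) in
  valid (a, false) (via a v) && valid (via a v, false) v.
Proof. by case: b v => [] [[] []]. Qed.

(** For b = false and b = true, the future first and last edges at v. Their sources do not depend on
    v, so that the minimal and maximal paths are unique; these repeat [direct b (b, true)] and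
    unfold to the straight itineraries of sign b. *)
Definition direct (b : bool) (v : node) : step2 :=
  exist _ (((b, true), false), (via (b, true) v, false), v) (via_valid b v).

Lemma direct_neq v : direct false v != direct true v.
Proof. by rewrite -val_eqE. Qed.

Lemma step2_connect v w : exists a b, [/\ src a = v, tgt a = src b & tgt b = w].
Proof.
have vv : valid (v, false) (v.1, true) && valid ((v.1, true), false) (v.1, true).
  by case: v => [[] []].
exists (exist _ ((v, false), ((v.1, true), false), (v.1, true)) vv), (direct v.1 w).
by split.
Qed.

Local Notation sequence := (nat -> node * bool).

Definition unfold (e : nat -> step2) (i : nat) : node * bool :=
  if odd i then (val (e i./2)).1.2 else (val (e i./2)).1.1.

Lemma unfoldP e n :
  (unfold e n.*2 = (val (e n)).1.1) * (unfold e n.*2.+1 = (val (e n)).1.2).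
Proof. by split; rewrite /unfold /= odd_double /= ?uphalf_double ?doubleK. Qed.

Lemma valid_unfold e : is_path src tgt e -> forall n, valid (unfold e n) (unfold e n.+1).1.
Proof.
move=> pe n; have := odd_double_half n; case: (odd n) => <-.
  rewrite add1n -doubleS !unfoldP -/(src _) -pe.
  by have /andP[] := valP (e n./2).
by rewrite add0n !unfoldP; have /andP[] := valP (e n./2).
Qed.

Section fold.
Variables (a : sequence) (va : forall n, valid (a n) (a n.+1).1).

Lemma fold_valid n : valid (a n.*2) (a n.*2.+1).1 && valid (a n.*2.+1) (a n.*2.+2).1.
Proof. by rewrite !va. Qed.

Definition fold (n : nat) : step2 :=
  exist _ (a n.*2, a n.*2.+1, (a n.*2.+2).1) (fold_valid n).

Lemma is_path_fold : is_path src tgt fold.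
Proof. by move=> n; rewrite /src /tgt /= doubleS. Qed.

Lemma unfold_fold n : unfold fold n = a n.
Proof.
have := odd_double_half n; case: (odd n) => <-; first by rewrite add1n unfoldP.
by rewrite add0n unfoldP.
Qed.
End fold.

(** Besides its two letters, an edge records a target node; this node is read in the letter 2n + 2,
    as the source of the next edge. *)
Lemma eq_step2 e e' n : is_path src tgt e -> is_path src tgt e' ->
  (forall i, (n.*2 <= i <= n.*2.+2)%N -> unfold e i = unfold e' i) -> e n = e' n.
Proof.
move=> pe pe' h; apply: val_inj.
rewrite [LHS]surjective_pairing [(val (e n)).1]surjective_pairing.
rewrite [RHS]surjective_pairing [(val (e' n)).1]surjective_pairing.
rewrite -!unfoldP !h; try lia.
have := h n.*2.+2; rewrite -doubleS !unfoldP => H.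
by rewrite -!/(tgt _) pe pe' /src H //; lia.
Qed.

Lemma path_equivalent_unfold e e' : is_path src tgt e -> is_path src tgt e' ->
  path_equivalent (false, true) (true, true) (direct false) (direct true) e e' <->
  (exists n, forall i, (n <= i)%N -> unfold e i = unfold e' i) \/
  (exists n, straight_itinerary n (unfold e) /\ straight_itinerary n (unfold e')).
Proof.
move=> pe pe'; pose D b : step2 := direct b (b, true).
have sp x : is_path src tgt x ->
    special (false, true) (true, true) (direct false) (direct true) x <->
    exists n, straight_itinerary n (unfold x).
  move=> px; split=> [[n s]|[n s]].
    exists n.*2; have {}s : exists b, forall i, (n <= i)%N -> x i = D b.
      by case: s => s; [exists true|exists false].
    have [b bE] := s; move=> i ni.
    have ni2 : (n <= i./2)%N by lia.
    by rewrite /unfold bE // odd_double /= bE ?doubleK //; case: ifP.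
  exists n; have : exists b, forall i, (n <= i)%N -> x i = D b.
    exists (unfold x n).1.1 => i ni; apply: (@eq_step2 x (fun=> D (unfold x n).1.1) i) => // k kE.
    rewrite s; last by lia.
    by move: (unfold x n).1.1 => b; rewrite /unfold; case: ifP.
  by move=> [[] h]; [left|right].
rewrite /path_equivalent; split.
  case=> [[n e0]|[s s']].
    left; exists n.*2 => i ni.
    by rewrite /unfold e0 //; lia.
  right; have [n h] := (sp _ pe).1 s; have [n' h'] := (sp _ pe').1 s'.
  have mono m k a : (m <= k)%N -> straight_itinerary m a -> straight_itinerary k a.
    by move=> mk st i ki; rewrite (st i (leq_trans mk ki)) (st k).
  by exists (maxn n n'); split; [apply: mono h|apply: mono h']; rewrite ?leq_maxl ?leq_maxr.
case=> [[n e0]|[n [s s']]].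
  left; exists n => i ni; apply: eq_step2 => // j jE; apply: e0; lia.
by right; split; apply/sp => //; exists n.
Qed.

(** * The transversal *)

Definition gk_transversal : set GK := [set T | rooted_odd T /\ based (addr T)].

Lemma gk_transversal_cylinder (a b : nat -> bool * (direction * bool)) :
  (forall i, (i < 2)%N -> a i = b i) ->
  (a 0%N).1 /\ based (fun i => (a i).2) -> (b 0%N).1 /\ based (fun i => (b i).2).
Proof. by move=> e; rewrite /based /turn !e. Qed.

Lemma open_gk_transversal : open gk_transversal.
Proof.
exact: (coded_cylinder_open coded_key (P := fun a => (a 0%N).1 /\ based (fun i => (a i).2))
  gk_transversal_cylinder).
Qed.

Lemma gk_transversal_meets : meets_all_classes ghys_kenyon_rel gk_transversal.
Proof.
move=> T; pose y := addr T; have ry : address_rule y := key_rule T.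
(* The axis bits at 0 and 1 are set to false, and the two statuses are recomputed backwards by the
   rule from the unchanged letters. *)
pose s1 := ~~ (y 2%N).1.2 && turn y 1.
pose y' i := if i is 0 then (((y 0%N).1.1, false), ((y 0%N).1.1 != (y 1%N).1.1) || s1)
  else if i is 1 then (((y 1%N).1.1, false), s1) else y i.
have ry' : address_rule y'.
  move=> [|[|n]]; [by []| |exact: ry].
  by rewrite /= /s1 /turn; case: (y 2%N).1.2.
have [T' T'E] := key_surj ry'.
have aE : addr T' = y' by apply/funext => i; rewrite /addr T'E.
exists T'; split.
  apply/translation_rel_tail; exists 2%N; left; rewrite aE => -[|[|i]] //.
by split; [rewrite /rooted_odd T'E|rewrite /based aE /= implybT].
Qed.

Notation GZ := (set_type gk_transversal).

Lemma gz_rule (T : GZ) : address_rule (addr (val T)).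
Proof. exact: key_rule. Qed.

Lemma gz_odd (T : GZ) : rooted_odd (val T).
Proof. by have [] := set_mem (valP T). Qed.

Lemma gz_based (T : GZ) : based (addr (val T)).
Proof. by have [] := set_mem (valP T). Qed.

Definition gz_path (T : GZ) : nat -> step2 := fold (valid_itinerary (gz_rule T)).

Lemma is_path_gz (T : GZ) : is_path src tgt (gz_path T).
Proof. exact: is_path_fold. Qed.

Lemma unfold_gz (T : GZ) n : unfold (gz_path T) n = itinerary (addr (val T)) n.
Proof. exact: unfold_fold. Qed.

Lemma gz_path_inj : injective gz_path.
Proof.
move=> T T' e; apply: val_inj; apply: key_inj; first by rewrite !gz_odd.
move=> i; rewrite -(decoded_itinerary (gz_rule T) (gz_based T)).
rewrite -(decoded_itinerary (gz_rule T') (gz_based T')).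
by apply: eq_decoded => j _; rewrite -!unfold_gz e.
Qed.

Lemma gz_path_surj e : is_path src tgt e -> exists T, gz_path T = e.
Proof.
move=> pe; have va := valid_unfold pe.
have [T TE] := key_surj (address_rule_decoded va).
have aE : addr T = decoded (unfold e) by apply/funext => i; rewrite /addr TE.
have ZT : gk_transversal T by split; [rewrite /rooted_odd TE|rewrite aE; exact: based_decoded].
exists (exist _ T (mem_set ZT)); apply/funext => n.
apply: (eq_step2 (is_path_gz _) pe) => i _.
by rewrite unfold_gz /= aE itinerary_decoded.
Qed.

Lemma gz_path_rel (T T' : GZ) : translation_rel (val (val T), val (val T')) <->
  path_equivalent (false, true) (true, true) (direct false) (direct true) (gz_path T) (gz_path T').
Proof.
rewrite translation_rel_tail (path_equivalent_unfold (@is_path_gz T) (@is_path_gz T')).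
rewrite (tail_equivalent_itinerary (gz_rule T) (gz_rule T') (gz_based T) (gz_based T')).
have E (S : GZ) : unfold (gz_path S) = itinerary (addr (val S)) by apply/funext/unfold_gz.
by rewrite !E.
Qed.

Lemma coded_gz_path : coded gz_path.
Proof.
have [nb inj comp] := coded_subset coded_key gk_transversal_cylinder
  (A := gk_transversal) (fun T => iff_refl _).
split=> [T U|T T' e|e h].
- rewrite nb; split=> -[n nU].
    exists n.+1 => T' e; apply: nU => i iN.
    rewrite [LHS]surjective_pairing [RHS]surjective_pairing !(key_odd _ i).
    rewrite -/(rooted_odd (val T)) -/(rooted_odd (val T')) !gz_odd; congr pair.
    rewrite -/(addr (val T) i) -/(addr (val T') i).
    rewrite -(decoded_itinerary (gz_rule T) (gz_based T)).
    rewrite -(decoded_itinerary (gz_rule T') (gz_based T')).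
    apply: eq_decoded => j ji; rewrite -!unfold_gz /unfold e //.
    by apply: leq_ltn_trans (leqW iN); lia.
  (* An edge below n involves itinerary letters of index at most 2n, and each of these reads at most
     two further letters of the address. *)
  exists n.*2.+4 => T' e; apply: nU => i iN.
  have aE j : (j < n.*2.+4)%N -> addr (val T) j = addr (val T') j by rewrite /addr => /e ->.
  apply: eq_step2; [exact: is_path_gz..|move=> j jE].
  rewrite !unfold_gz /itinerary /label /turn !aE //; lia.
- by apply: gz_path_inj; apply/funext.
- have [|T TE] := @gz_path_surj e.
    move=> n; have [T TE] := h n.+2; rewrite -!TE //; exact: is_path_gz.
  by exists T => i; rewrite TE.
Qed.

(** * The Vershik map on the transversal *)

Definition min_node : node := (false, true).
Definition max_node : node := (true, true).

Definition adic : (nat -> step2) -> nat -> step2 :=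
  vershik src tgt min_node (direct false) (direct true)
    (edge_succ tgt (direct false) (direct true)).

Definition adic_inv : (nat -> step2) -> nat -> step2 :=
  vershik src tgt max_node (direct true) (direct false)
    (edge_pred tgt (direct false) (direct true)).

Lemma tgt_direct b v : tgt (direct b v) = v. Proof. by []. Qed.
Local Notation gpath := (is_path src tgt).
Local Notation order lem := (lem _ _ tgt _ _ (tgt_direct false) (tgt_direct true) direct_neq).

Lemma is_path_adic e : gpath e -> gpath (adic e).
Proof.
apply: is_path_vershik => // f _.
exact: (tgt_edge_succ (tgt_direct false) (tgt_direct true)).
Qed.

Lemma is_path_adic_inv e : gpath e -> gpath (adic_inv e).
Proof.
by apply: is_path_vershik => // f _; exact: (order tgt_edge_pred).
Qed.

Lemma adicK e : gpath e -> adic_inv (adic e) = e.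
Proof.
apply: vershikK => // f nf.
- exact: (tgt_edge_succ (tgt_direct false) (tgt_direct true)).
- exact: (order edge_succ_first).
- exact: (order edge_succK).
Qed.

Lemma adic_invK e : gpath e -> adic (adic_inv e) = e.
Proof.
apply: vershikK => // f nf.
- exact: (order tgt_edge_pred).
- exact: (order edge_pred_last).
- exact: (order edge_predK).
Qed.

Lemma adic_orbit e e' : gpath e -> gpath e' ->
  (exists n, iter n adic e = e' \/ iter n adic e' = e) <->
  path_equivalent min_node max_node (direct false) (direct true) e e'.
Proof.
apply: (vershik_orbit (pred := edge_pred tgt (direct false) (direct true))) => //.
- by move=> f _; exact: (tgt_edge_succ (tgt_direct false) (tgt_direct true)).
- by move=> f nf; exact: (order edge_succ_first).
- by move=> f nf; exact: (order edge_succK).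
- by move=> Q v Qf Qs f; exact: (order edge_climb).
Qed.

(** Maps between paths are transported to the transversal through the bijection [gz_path];
    continuity is then a matter of finitely many edges. *)
Section gz_lift.
Variable F : (nat -> step2) -> nat -> step2.
Hypothesis pF : forall e, gpath e -> gpath (F e).

Let lift (T : GZ) := cid (gz_path_surj (pF (is_path_gz T))).

Definition gz_lift (T : GZ) : GZ := projT1 (lift T).

Lemma gz_path_lift T : gz_path (gz_lift T) = F (gz_path T).
Proof. exact: projT2 (lift T). Qed.

Lemma continuous_gz_lift :
  (forall e n, gpath e -> exists m, forall e', gpath e' ->
    (forall i, (i < m)%N -> e i = e' i) -> F e n = F e' n) -> continuous gz_lift.
Proof.
move=> loc; apply: (coded_continuous coded_gz_path coded_gz_path) => T n.
have [m mP] := loc _ n (is_path_gz T); exists m => T' e.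
by rewrite !gz_path_lift; apply: mP => //; exact: is_path_gz.
Qed.
End gz_lift.

Definition gz_adic : GZ -> GZ := gz_lift is_path_adic.

Lemma gz_path_iter n T : gz_path (iter n gz_adic T) = iter n adic (gz_path T).
Proof. by elim: n => //= n <-; exact: gz_path_lift. Qed.

Lemma homeomorphism_gz_adic : homeomorphism gz_adic.
Proof.
split; first by apply: continuous_gz_lift => e n; exact: vershik_local.
exists (gz_lift is_path_adic_inv); split.
- by apply: continuous_gz_lift => e n; exact: vershik_local.
- move=> T; apply: gz_path_inj; rewrite !gz_path_lift adicK //; exact: is_path_gz.
- move=> T; apply: gz_path_inj; rewrite !gz_path_lift adic_invK //; exact: is_path_gz.
Qed.

Lemma gz_adic_orbit (T T' : GZ) :
  orbit_relation gz_adic (T, T') <-> translation_rel (val (val T), val (val T')).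
Proof.
rewrite gz_path_rel -(adic_orbit (is_path_gz T) (is_path_gz T')).
split=> -[n [E|E]]; exists n; [left|right|left|right]; move: E => /=.
- by move=> <-; rewrite gz_path_iter.
- by move=> <-; rewrite gz_path_iter.
- by rewrite -gz_path_iter => /gz_path_inj.
- by rewrite -gz_path_iter => /gz_path_inj.
Qed.

Lemma dense_gz_orbit T : dense (rel_class (orbit_relation gz_adic) T).
Proof.
move=> O [T' OT'] oO; have [nb _ _] := coded_gz_path.
have /nb[n nO] : nbhs T' O by exact: open_nbhs_nbhs.
have [e [pe eT' eT]] := is_path_connect n step2_connect (is_path_gz T) (is_path_gz T').
have [S SE] := gz_path_surj pe; exists S; split.
  by apply: nO => i iN; rewrite SE eT'.
apply/gz_adic_orbit/gz_path_rel; left; exists n.+2 => i ni.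
by rewrite SE eT.
Qed.

(** An isolated point would be determined by a prefix of its path, but every prefix extends to paths
    with the minimal and with the maximal tail. *)
Lemma perfect_gz : perfect_set [set: GZ].
Proof.
apply/perfectTP => T oT; have [nb _ _] := coded_gz_path.
have /nb[n nO] : nbhs T [set T] by exact: open_nbhs_nbhs.
have P b : exists S : GZ, S = T /\ forall i, (n.+1 < i)%N -> gz_path S i = direct b (b, true).
  have pb : gpath (fun=> direct b (b, true)) by [].
  have [e [pe eT eb]] := is_path_connect n step2_connect pb (is_path_gz T).
  have [S SE] := gz_path_surj pe; exists S; split; last by rewrite SE.
  by apply: nO => i iN; rewrite SE eT.
have [S [-> h]] := P false; have [S' [-> h']] := P true.
by have := h n.+2 (ltnSn _); rewrite h'.
Qed.

Lemma cantor_like_gz : cantor_like GZ.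
Proof.
split.
- exact: perfect_gz.
- exact: coded_compact coded_gz_path.
- exact: coded_hausdorff coded_gz_path.
- exact: coded_zero_dimensional coded_gz_path.
Qed.

Lemma gz_cantor : exists f : GZ -> cantor_space, homeomorphism f.
Proof.
have [T0 _] : exists T0 : GZ, gz_path T0 = fun=> direct false min_node.
  exact: gz_path_surj.
pose P := HB.pack_for (pseudoPMetricType Rdefinitions.R) GZ (isPointed.Build GZ T0).
have [k [kc kC]] := @homeomorphism_cantor_like Rdefinitions.R P cantor_like_gz.
pose g (T : GZ) : cantor_space := (k^-1)%FUN T.
have gK : cancel g k by move=> T; apply: invK; rewrite inE.
have kK : cancel k g by move=> c; apply: funK; rewrite inE.
exists g; split; last by exists k; split.
(* The inverse of [k] is continuous because [k] is a closed map. *)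
apply/continuousP => A oA; rewrite -closedC.
rewrite (_ : ~` _ = k @` (~` A)); first by apply: kC; rewrite closedC.
by apply/seteqP; split=> [T nT|_ [c nc <-]]; [exists (g T) => //; exact: gK|rewrite /= kK].
Qed.

Section conjugate.
Variables (X Y : topologicalType) (u : X -> X) (f : X -> Y) (g : Y -> X).
Hypotheses (fc : continuous f) (gc : continuous g) (fK : cancel f g) (gK : cancel g f).

Let v (y : Y) : Y := f (u (g y)).

Lemma iter_conjugate n y : iter n v y = f (iter n u (g y)).
Proof. by elim: n => [|n IHn]; rewrite /= ?gK // IHn /v fK. Qed.

Lemma orbit_relation_conjugate y y' :
  orbit_relation v (y, y') <-> orbit_relation u (g y, g y').
Proof.
split=> -[n [E|E]]; exists n; [left|right|left|right]; move: E; rewrite /= iter_conjugate.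
- by move=> <-; rewrite fK.
- by move=> <-; rewrite fK.
- by move=> ->; rewrite gK.
- by move=> ->; rewrite gK.
Qed.

Lemma minimal_homeomorphism_conjugate : minimal_homeomorphism u -> minimal_homeomorphism v.
Proof.
have cc w : continuous w -> continuous (fun y => f (w (g y))).
  move=> wc y; apply: (@continuous_comp _ _ _ (w \o g) f); last exact: fc.
  by apply: (@continuous_comp _ _ _ g w); [exact: gc|exact: wc].
move=> [[uc [u' [u'c uK u'K]]] du]; split.
  split; first exact: cc.
  by exists (fun y => f (u' (g y))); split; [exact: cc|move=> y..];
    rewrite /v fK ?uK ?u'K gK.
move=> y O [y' Oy'] oO.
have [|x [Ox yx]] := du (g y) (f @^-1` O) _ ((continuousP f).1 fc _ oO).
  by exists (g y'); rewrite /= gK.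
by exists (f x); split=> //; apply/orbit_relation_conjugate; rewrite fK.
Qed.
End conjugate.

Theorem mainTheorem11 :
  affable ghys_kenyon_rel /\
  exists2 h : cantor_space -> cantor_space, minimal_homeomorphism h &
    stably_orbit_equivalent ghys_kenyon_rel (orbit_relation h).
Proof.
split; first exact: ghys_kenyon_affable.
have [f [fc [g [gc fK gK]]]] := gz_cantor.
have mu : minimal_homeomorphism gz_adic.
  by split; [exact: homeomorphism_gz_adic|exact: dense_gz_orbit].
exists (fun c => f (gz_adic (g c))); first exact: minimal_homeomorphism_conjugate.
(* On the side of X the open set is the transversal; on the other side it is the whole Cantor set,
   through the conjugating homeomorphism [f]. *)
exists gk_transversal, setT; split; [exact: open_gk_transversal|exact: openT| | |].
- exact: gk_transversal_meets.
- by move=> c; exists c; split=> //; exists 0%N; left.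
have inT (c : cantor_space) : c \in [set: cantor_space] by rewrite inE.
pose F (T : GZ) : [set: cantor_space] := exist _ (f T) (inT (f T)).
exists F.
  split.
    move=> T U /nbhs_set_type[V /fc nV VU].
    have {}nV : nbhs T (f @^-1` V) by exact: nV.
    by change (nbhs T (F @^-1` U)); apply: filterS nV => S VS; exact: (VU (F S) VS).
  exists (fun c => g (val c)); split.
  - by move=> c U /gc nU; apply/nbhs_set_type; exists (g @^-1` U).
  - by move=> T; rewrite /= fK.
  - by move=> c; apply: val_inj; rewrite /= gK.
move=> T; apply/seteqP; split=> [_ [S TS <-]|c].
  by apply/(orbit_relation_conjugate _ fK gK)/gz_adic_orbit; rewrite !fK.
move=> /(orbit_relation_conjugate _ fK gK); rewrite /= fK => /gz_adic_orbit Tc.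
by exists (g (val c)) => //; apply: val_inj; rewrite /= gK.
Qed.
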